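(* Let $K : \mathrm{Per}(\mathbb{R}) \to C^1(\mathbb{R})\cap \mathrm{Per}(\mathbb{R})$ be a mapping which is continuous as a map $\mathrm{Per}(\mathbb{R})\to\mathrm{Per}(\mathbb{R})$ and for which there exists a constant $v_{\max}>0$ such that $0 \le (K(\rho))(x) \le v_{\max}$ for all $x\in\mathbb{R}$, $\rho\in\mathrm{Per}(\mathbb{R})$. Suppose there exists a non-decreasing function $a:\mathbb{R}_+\to\mathbb{R}_+$ such that for all $\rho,\bar\rho\in\mathrm{Per}(\mathbb{R})$: $$\int_0^1 |\rho(x)-\bar\rho(x)|\,|(K(\rho))(x)-(K(\bar\rho))(x)|\,dx \le a(\|\rho\|_\infty+\|\bar\rho\|_\infty)\int_0^1|\rho(x)-\bar\rho(x)|^2dx,$$ $$\int_0^1 |\rho(x)-\bar\rho(x)|\,\Big|\tfrac{\partial}{\partial x}\big((K(\rho))(x)-(K(\bar\rho))(x)\big)\Big|\,dx \le a(\|\rho\|_\infty+\|\bar\rho\|_\infty)\int_0^1|\rho(x)-\bar\rho(x)|^2dx.$$ Finally suppose there exists a parameterized family $K_N$ that smoothly approximates $K$ (in the sense defined in the context). Then for every $\rho_0 \in W^{2,\infty}(\mathbb{R})\cap\mathrm{Per}(\mathbb{R})$ the initial-value problem $$\frac{\partial\rho}{\partial t}(t,x) + \frac{\partial}{\partial x}\big(\rho(t,x)v(t,x)\big) = 0,\quad v(t,x) = (K(\rho[t]))(x),\quad \rho(t,x+1)=\rho(t,x)\quad (t\ge0,\ x\in\mathbb{R}),\qquad \rho[0]=\rho_0,$$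 has a unique solution $\rho\in C^1(\mathbb{R}_+\times\mathbb{R})$ with $\rho[t]\in W^{2,\infty}(\mathbb{R})\cap\mathrm{Per}(\mathbb{R})$ for all $t\ge0$. Moreover, for all $t\ge0$, $x\in\mathbb{R}$: $$\min_{x\in[0,1]}\rho_0(x) \le \rho(t,x) \le \max_{x\in[0,1]}\rho_0(x).$$
   Context: $\mathbb{R}_+ = [0,+\infty)$. $\mathrm{Per}(\mathbb{R})$ denotes the set of continuous, positive functions $\rho:\mathbb{R}\to(0,+\infty)$ that are periodic with period $1$; continuity of maps on $\mathrm{Per}(\mathbb{R})$ is with respect to the uniform (sup) metric. $W^{2,\infty}(\mathbb{R})$ denotes the $C^1$ functions with Lipschitz derivative. For $\rho:\mathbb{R}_+\times\mathbb{R}\to\mathbb{R}$, $\rho[t]$ denotes the profile $x\mapsto\rho(t,x)$. For $y \in \mathbb{R}^N$, $|y|_\infty = \max_i |y_i|$; for $x,y\in\mathbb{R}^N$, $x \le y$ means componentwise; $1_N = (1,\dots,1)^\top$. For $\rho = (\rho_0,\dots,\rho_{N-1})^\top \in \mathbb{R}^N$ and $i=1,\dots,N-1$, $\rho^{(i)} = (\rho_i,\dots,\rho_{N-1},\rho_0,\dots,\rho_{i-1})^\top$, $\rho^{(0)}=\rho$, and in general $\rho^{(k)}$ is obtained by applying the cyclic left shift $k$ times. For $h=1/N$ and $\rho\in\mathbb{R}^N$, $P_N\rho$ is the $1$-periodic function with $(P_N\rho)(x) = h^{-1}\rho_i((i+1)h - x) + h^{-1}\rho_{i+1}(x - ih)$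 for $x \in [ih,(i+1)h]$, $i=0,\dots,N-2$, and $(P_N\rho)(x) = h^{-1}\rho_{N-1}(1-x) + h^{-1}\rho_0(x+h-1)$ for $x\in[(N-1)h,1]$. Definition (smooth approximation). Let $K:\mathrm{Per}(\mathbb{R})\to\mathrm{Per}(\mathbb{R})$ be continuous with $0 \le (K(\rho))(x) \le v_{\max}$ for all $x,\rho$. A family of mappings $K_N:\mathbb{R}^N\to\mathbb{R}_+$, indexed by integers $N>2$, smoothly approximates $K$ if there exist constants $L,c,C,S\ge 0$ and non-decreasing functions $\gamma,\Gamma,W:\mathbb{R}_+\to\mathbb{R}_+$ such that $K_N(\rho)\le v_{\max}$ for all $\rho\in\mathbb{R}_+^N$, and for all $N>2$, $0<\rho_{\min}\le\rho_{\max}$, $i=0,\dots,N-1$ and all $\rho=(\rho_0,\dots,\rho_{N-1})^\top,\tilde\rho \in\mathbb{R}_+^N$ with $\rho_{\min}1_N\le\rho\le\rho_{\max}1_N$, $\rho_{\min}1_N\le\tilde\rho\le\rho_{\max}1_N$, writing $h=1/N$, $y = h^{-1}(\rho^{(1)}-\rho)$, $\varphi = h^{-2}(\rho^{(2)}-2\rho^{(1)}+\rho)$: (i) $|K_N(\rho)-K_N(\tilde\rho)| \le L|\rho-\tilde\rho|_\infty$; (ii) $|K_N(\rho)-K_N(\rho^{(1)})-K_N(\tilde\rho)+K_N(\tilde\rho^{(1)})| \le (h|\rho-\tilde\rho|_\infty + h^2)\Gamma(\rho_{\max})$; (iii) $-ch(\rho_{\max}-\rho_0) \le K_N(\rho^{(1)})-K_N(\rho)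 \le ch(\rho_0-\rho_{\min})$; (iv) $|2K_N(\rho^{(1)})-K_N(\rho)-K_N(\rho^{(2)})| \le h^2(\gamma(\rho_{\max}) + C|y|_\infty)$; (v) $|3K_N(\rho^{(1)})+K_N(\rho^{(3)})-K_N(\rho)-3K_N(\rho^{(2)})| \le h^3(W(\rho_{\max}+|y|_\infty) + C|\varphi|_\infty)$; (vi) $|(K(P_N\rho))(ih) - K_N(\rho^{(i)})| \le hS\rho_{\max}$. *)

(* Defs.v *)
From Stdlib Require Import Reals ZArith.
From Coquelicot Require Import Coquelicot.
From mathcomp Require Import ssreflect ssrbool eqtype ssrnat div fintype bigop.

Open Scope R_scope.

Definition Per1 (f : R -> R) : Prop :=
  (forall x, continuous f x) /\ (forall x, 0 < f x) /\ (forall x, f (x + 1) = f x).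

Definition C1fun (f : R -> R) : Prop :=
  (forall x, ex_derive f x) /\ (forall x, continuous (Derive f) x).

Definition W2inf (f : R -> R) : Prop :=
  (forall x, ex_derive f x) /\
  exists L, forall x y, Rabs (Derive f x - Derive f y) <= L * Rabs (x - y).

Definition supnorm (f : R -> R) : R :=
  real (Lub_Rbar (fun z => exists x, z = Rabs (f x))).

Definition min01 (f : R -> R) : R :=
  real (Glb_Rbar (fun z => exists y, 0 <= y <= 1 /\ z = f y)).
Definition max01 (f : R -> R) : R :=
  real (Lub_Rbar (fun z => exists y, 0 <= y <= 1 /\ z = f y)).

Definition K_continuous (K : (R -> R) -> (R -> R)) : Prop :=
  forall rho, Per1 rho -> forall eps, 0 < eps -> exists delta, 0 < delta /\
    forall rho', Per1 rho' -> (forall x, Rabs (rho x - rho' x) <= delta) ->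
      forall x, Rabs (K rho x - K rho' x) <= eps.

Definition nondec_nonneg (g : R -> R) : Prop :=
  (forall x, 0 <= x -> 0 <= g x) /\ (forall x y, 0 <= x -> x <= y -> g x <= g y).

Definition vget {N : nat} (rho : 'I_N -> R) (k : nat) : R :=
  match (insub (k %% N)%N : option 'I_N) with
  | Some i => rho i
  | None => 0
  end.

Definition cshift {N : nat} (k : nat) (rho : 'I_N -> R) : 'I_N -> R :=
  fun i => vget rho (nat_of_ord i + k)%N.

Definition vnorm {N : nat} (v : 'I_N -> R) : R :=
  \big[Rmax/0]_(i < N) Rabs (v i).

Definition vsub {N : nat} (u v : 'I_N -> R) : 'I_N -> R := fun i => u i - v i.

(* P_N rho : 1-periodic piecewise linear interpolation, node values rho_i at i/N *)
Definition PN (N : nat) (rho : 'I_N -> R) (x : R) : R :=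
  let y := x - IZR (Int_part x) in
  let i := Z.to_nat (Int_part (INR N * y)) in
  INR N * (vget rho i * (INR (i + 1) / INR N - y)
           + vget rho (i + 1) * (y - INR i / INR N)).

Definition smoothly_approximates (K : (R -> R) -> (R -> R)) (vmax : R)
    (KN : forall N : nat, ('I_N -> R) -> R) : Prop :=
  (forall N (rho : 'I_N -> R), 0 <= KN N rho) /\
  exists L c C S : R, 0 <= L /\ 0 <= c /\ 0 <= C /\ 0 <= S /\
  exists gam Gam W : R -> R,
    nondec_nonneg gam /\ nondec_nonneg Gam /\ nondec_nonneg W /\
    (forall N (rho : 'I_N -> R), (forall i, 0 <= rho i) -> KN N rho <= vmax) /\
    forall N : nat, (2 < N)%N ->
    forall rmin rmax : R, 0 < rmin -> rmin <= rmax ->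
    forall rho rhot : 'I_N -> R,
      (forall i, rmin <= rho i <= rmax) -> (forall i, rmin <= rhot i <= rmax) ->
      let h := / INR N in
      let y := fun i => (cshift 1 rho i - rho i) / h in
      let phi := fun i => (cshift 2 rho i - 2 * cshift 1 rho i + rho i) / (h * h) in
      Rabs (KN N rho - KN N rhot) <= L * vnorm (vsub rho rhot) /\
      Rabs (KN N rho - KN N (cshift 1 rho) - KN N rhot + KN N (cshift 1 rhot))
        <= (h * vnorm (vsub rho rhot) + h * h) * Gam rmax /\
      (forall i0 : 'I_N, nat_of_ord i0 = 0%N ->
        - c * h * (rmax - rho i0) <= KN N (cshift 1 rho) - KN N rho
        /\ KN N (cshift 1 rho) - KN N rho <= c * h * (rho i0 - rmin)) /\
      Rabs (2 * KN N (cshift 1 rho) - KN N rho - KN N (cshift 2 rho))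
        <= h * h * (gam rmax + C * vnorm y) /\
      Rabs (3 * KN N (cshift 1 rho) + KN N (cshift 3 rho) - KN N rho
            - 3 * KN N (cshift 2 rho))
        <= h * h * h * (W (rmax + vnorm y) + C * vnorm phi) /\
      (forall i : 'I_N,
        Rabs (K (PN N rho) (INR i * h) - KN N (cshift i rho)) <= h * S * rmax).

(* rho in C^1(R_+ x R): partial derivatives (one-sided in t at t = 0)
   exist and are continuous on the closed half-plane; the PDE holds with them. *)
Definition solves (K : (R -> R) -> (R -> R)) (rho0 : R -> R) (u : R -> R -> R) : Prop :=
  exists ut ux : R -> R -> R,
    (forall t x, 0 <= t -> is_derive (fun x' => u t x') x (ux t x)) /\
    (forall t x, 0 < t -> is_derive (fun t' => u t' x) t (ut t x)) /\
    (forall x, filterlim (fun s => (u s x - u 0 x) / s) (at_right 0) (locally (ut 0 x))) /\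
    (forall t x, 0 <= t -> forall eps, 0 < eps -> exists delta, 0 < delta /\
       forall t' x', 0 <= t' -> Rabs (t' - t) < delta -> Rabs (x' - x) < delta ->
         Rabs (ut t' x' - ut t x) < eps /\ Rabs (ux t' x' - ux t x) < eps) /\
    (forall t, 0 <= t -> W2inf (u t) /\ Per1 (u t)) /\
    (forall x, u 0 x = rho0 x) /\
    (forall t x, 0 <= t -> u t (x + 1) = u t x) /\
    (forall t x, 0 <= t ->
       ut t x + Derive (fun x' => u t x' * K (u t) x') x = 0).

(* Main.v *)
(** Letting N tend to infinity in the hypotheses on K_N, read on the samples of a
periodic density, gives estimates for K itself: rho |-> K rho is Lipschitz from
the sup norm to C^1, satisfies
  - c (hi - rho) <= (K rho)' <= c (rho - lo)
as soon as lo <= rho <= hi, and gains one derivative, with bounds affine in the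
top-order norm of rho.  Individual increments of K_N carry no information at
scale 1/N because (vi) only has precision 1/N; summing them over a fixed length
does.

Existence: iterate the step S_tau rho = (rho (1 - tau v')) o (id - tau v) with
v = K rho.  It preserves lo <= rho <= hi exactly, propagates C^{1,1} bounds with
at most exponential growth, is stable in the sup norm, and
S_{sigma+tau} = S_tau S_sigma + O(sigma tau); hence the dyadic iterates are
Cauchy, and their limit u satisfies u(t+s) = S_s (u(t)) + O(s^2), which is the
equation.

Uniqueness: at a positive maximum of exp(- lam t) |u - u'| the space derivatives
of u and u' agree, so the sup-norm Lipschitz bounds for K control the time
derivative of u - u' there, a contradiction for large lam. *)

Require Import Defs.
From Stdlib Require Import Reals ZArith Lra Lia FunctionalExtensionality.
From Coquelicot Require Import Coquelicot.
Open Scope R_scope.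

(** * Lipschitz classes *)

(** The obstacle is a loss of derivatives: a step multiplies by a factor containing (K rho)', so
    bounding the Lipschitz constant of the new density calls for a second derivative of K rho, and
    one order higher for a third. The gain of one derivative closes this at each order, and affine
    bounds keep the constants finite for all times: the growth rate of the Lipschitz constant
    involves only [hi] and fixed data, and that of the [lip2] constant involves in addition the
    Lipschitz constant, which is already bounded on [0,T]. The restriction on the step length
    involves only [c] and [hi], and the step preserves [hi], so one restriction serves at all times
    and no continuation argument occurs.

    The two orders of regularity have separate tasks. Stability, consistency and hence convergence
    rest on the Lipschitz constant alone; [lip2] makes the limit differentiable in space, with a
    derivative continuous in time, and permits its expansion in time. The product form sigma * tau
    of the consistency error is used twice: with equal lengths it compares consecutive dyadic
    levels, and with sigma a multiple of tau it compares many short steps with a single long one. *)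

Definition inbox (lo hi : R) (f : R -> R) : Prop := forall x, lo <= f x <= hi.

Definition lip (M : R) (f : R -> R) : Prop :=
  forall x y, Rabs (f x - f y) <= M * Rabs (x - y).

(* Derivative-free form of "f' is M-Lipschitz": stable under composition,
   products and pointwise limits. *)
Definition lip2 (M : R) (f : R -> R) : Prop :=
  forall r s x, 0 <= r -> 0 <= s ->
    Rabs (f (x + r + s) - f (x + r) - f (x + s) + f x) <= M * r * s.

Definition near (d : R) (f g : R -> R) : Prop := forall x, Rabs (f x - g x) <= d.

Lemma lip_nonneg M f : lip M f -> 0 <= M.
Proof.
  intros H; specialize (H 1 0).
  pose proof (Rabs_pos (f 1 - f 0)).
  replace (1 - 0) with 1 in H by ring; rewrite Rabs_R1 in H; lra.
Qed.

Lemma lip2_nonneg M f : lip2 M f -> 0 <= M.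
Proof.
  intros H; specialize (H 1 1 0 Rle_0_1 Rle_0_1).
  pose proof (Rabs_pos (f (0 + 1 + 1) - f (0 + 1) - f (0 + 1) + f 0)); lra.
Qed.

Lemma near_nonneg d f g : near d f g -> 0 <= d.
Proof. intros H; generalize (H 0) (Rabs_pos (f 0 - g 0)); lra. Qed.

Lemma lip_le M M' f : lip M f -> M <= M' -> lip M' f.
Proof.
  intros H HM x y; eapply Rle_trans; [apply H|].
  apply Rmult_le_compat_r; [apply Rabs_pos | lra].
Qed.

Lemma lip2_le M M' f : lip2 M f -> M <= M' -> lip2 M' f.
Proof.
  intros H HM r s x hr hs; eapply Rle_trans; [apply H; auto|].
  repeat apply Rmult_le_compat_r; auto.
Qed.

Lemma lip_continuous M f : lip M f -> forall x, continuous f x.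
Proof.
  intros H x.
  assert (HM := lip_nonneg _ _ H).
  apply continuity_pt_filterlim, continuity_pt_locally; intros [eps Heps].
  assert (Hd : 0 < eps / (M + 1)) by (apply Rdiv_lt_0_compat; lra).
  exists (mkposreal _ Hd); intros y Hy; simpl in *.
  unfold ball in Hy; simpl in Hy; unfold AbsRing_ball, abs, minus, plus, opp in Hy; simpl in Hy.
  eapply Rle_lt_trans; [apply H|].
  assert (Hp := Rabs_pos (y - x)).
  apply Rle_lt_trans with ((M + 1) * Rabs (y - x)); [nra|].
  replace eps with ((M + 1) * (eps / (M + 1))) by (field; lra).
  apply Rmult_lt_compat_l; [lra | exact Hy].
Qed.

Lemma continuous_eps f x : continuous f x <->
  forall eps, 0 < eps -> exists d, 0 < d /\ forall y, Rabs (y - x) < d -> Rabs (f y - f x) < eps.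
Proof.
  split.
  - intros H eps Heps.
    apply continuity_pt_filterlim in H; rewrite continuity_pt_locally in H.
    destruct (H (mkposreal eps Heps)) as [d Hd].
    exists d; split; [apply cond_pos | intros y Hy; exact (Hd y Hy)].
  - intros H; apply continuity_pt_filterlim, continuity_pt_locally; intros [eps Heps].
    destruct (H eps Heps) as [d [Hd Hy]].
    exists (mkposreal d Hd); intros y Hb; exact (Hy y Hb).
Qed.

Lemma is_derive_eps f x l : is_derive f x l <->
  forall eps, 0 < eps -> exists d, 0 < d /\
    forall h, Rabs h < d -> Rabs (f (x + h) - f x - h * l) <= eps * Rabs h.
Proof.
  rewrite is_derive_Reals; split; intros H eps Heps.
  - destruct (H eps Heps) as [d Hd].
    exists d; split; [apply cond_pos|]; intros h Hh.
    destruct (Req_dec h 0) as [->|Hn].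
    + rewrite Rplus_0_r, Rabs_R0; replace (f x - f x - 0 * l) with 0 by ring.
      rewrite Rabs_R0; lra.
    + specialize (Hd h Hn Hh).
      replace (f (x + h) - f x - h * l) with (((f (x + h) - f x) / h - l) * h) by (field; auto).
      rewrite Rabs_mult; apply Rmult_le_compat_r; [apply Rabs_pos | lra].
  - destruct (H (eps / 2)) as [d [Hd HH]]; [lra|].
    exists (mkposreal d Hd); intros h Hn Hh; specialize (HH h Hh).
    assert (Hp := Rabs_pos_lt h Hn).
    replace ((f (x + h) - f x) / h - l) with ((f (x + h) - f x - h * l) / h) by (field; auto).
    unfold Rdiv; rewrite Rabs_mult, Rabs_inv.
    apply Rle_lt_trans with (eps / 2); [|lra].
    apply Rmult_le_reg_r with (Rabs h); auto.
    rewrite Rmult_assoc, Rinv_l, Rmult_1_r; lra.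
Qed.

Lemma is_derive_shift (f : R -> R) (x r l : R) : is_derive f (x + r) l -> is_derive (fun y => f (y + r)) x l.
Proof.
  rewrite !is_derive_eps; intros H eps Heps; destruct (H eps Heps) as [d [Hd HH]].
  exists d; split; auto; intros h Hh; replace (x + h + r) with (x + r + h) by ring; auto.
Qed.

Lemma Derive_periodic f : (forall x, f (x + 1) = f x) -> forall x, Derive f (x + 1) = Derive f x.
Proof.
  intros H x; unfold Derive; f_equal; apply Lim_ext; intros h.
  now rewrite H; replace (x + 1 + h) with (x + h + 1) by ring; rewrite H.
Qed.

(** Only forward quotients over a short interval are tested; this is the form in which slope bounds
    come out of the passage to the limit on grids. *)
Lemma derive_le_of_slope f x l B d : is_derive f x l -> 0 < d ->
  (forall s, 0 < s < d -> f (x + s) - f x <= B * s) -> l <= B.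
Proof.
  intros Hf Hd Hs; apply Rnot_lt_le; intros HB.
  rewrite is_derive_eps in Hf.
  destruct (Hf ((l - B) / 2)) as [d' [Hd' H]]; [lra|].
  pose (s := Rmin d d' / 2).
  assert (Hm : 0 < Rmin d d') by (apply Rmin_glb_lt; auto).
  assert (Rmin d d' <= d) by apply Rmin_l. assert (Rmin d d' <= d') by apply Rmin_r.
  assert (0 < s < d /\ s < d') as [Hs1 Hs2] by (unfold s; lra).
  specialize (Hs s Hs1); specialize (H s); rewrite Rabs_pos_eq in H by lra.
  specialize (H Hs2); apply Rabs_le_between in H; nra.
Qed.

Lemma derive_abs_le_of_slope f x l B : is_derive f x l ->
  (forall s, 0 <= s -> Rabs (f (x + s) - f x) <= B * s) -> Rabs l <= B.
Proof.
  intros Hf Hs; apply Rabs_le; split.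
  - apply Ropp_le_cancel; rewrite Ropp_involutive.
    apply (derive_le_of_slope (fun y => - f y) x (- l) B 1); [|lra|].
    + exact (is_derive_opp f x l Hf).
    + intros s H; generalize (Rabs_le_between (f (x + s) - f x) (B * s)); intros [E _].
      destruct E; [apply Hs; lra | lra].
  - apply (derive_le_of_slope f x l B 1); [auto|lra|].
    intros s H; eapply Rle_trans; [apply Rle_abs | apply Hs; lra].
Qed.

Lemma lip_of_derive f df M : (forall x, is_derive f x (df x)) ->
  (forall x, Rabs (df x) <= M) -> lip M f.
Proof.
  intros Hf HM x y.
  destruct (MVT_gen f y x df) as [c [_ Hc]].
  - intros z _; apply Hf.
  - intros z _; apply continuity_pt_filterlim.
    apply (ex_derive_continuous f); eexists; apply Hf.
  - rewrite Hc, Rabs_mult; apply Rmult_le_compat_r; [apply Rabs_pos | apply HM].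
Qed.

(** Inequalities for a limit are proved below by writing them for the dyadic approximation of level
    [n], with an error proportional to 2^-n, and removing the error here. *)
Lemma le_of_geom a b c : (forall n, a <= b + c * (/ 2) ^ n) -> a <= b.
Proof.
  intros H; apply Rnot_lt_le; intros Hab.
  assert (He : 0 < (a - b) / (Rabs c + 1)).
  { apply Rdiv_lt_0_compat; [lra | generalize (Rabs_pos c); lra]. }
  destruct (pow_lt_1_zero (/ 2)) with (2 := He) as [N HN].
  { rewrite Rabs_pos_eq; lra. }
  specialize (H N); specialize (HN N (le_n _)).
  assert (Hp : 0 < (/ 2) ^ N) by (apply pow_lt; lra).
  rewrite Rabs_pos_eq in HN by lra.
  assert (Hc := Rabs_pos c); assert (Hc' := Rle_abs c).
  assert ((Rabs c + 1) * (/ 2) ^ N < a - b).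
  { replace (a - b) with ((Rabs c + 1) * ((a - b) / (Rabs c + 1))) by (field; lra).
    apply Rmult_lt_compat_l; lra. }
  nra.
Qed.

(** The factor 1 - (1/2)^m comes from the finite geometric sum; keeping it lets the induction on [m]
    close. *)
Lemma geom_cauchy_le (a : nat -> R) C : (forall n, Rabs (a (S n) - a n) <= C * (/ 2) ^ n) ->
  forall n m, Rabs (a (n + m)%nat - a n) <= 2 * C * (/ 2) ^ n * (1 - (/ 2) ^ m).
Proof.
  intros H n m; induction m as [|m IH].
  - rewrite Nat.add_0_r; simpl; rewrite Rminus_diag, Rabs_R0; lra.
  - rewrite Nat.add_succ_r.
    replace (a (S (n + m)) - a n) with ((a (S (n + m)) - a (n + m)%nat) + (a (n + m)%nat - a n)) by ring.
    eapply Rle_trans; [apply Rabs_triang|].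
    specialize (H (n + m)%nat); rewrite pow_add in H; simpl; lra.
Qed.

Lemma geom_cauchy_lim (a : nat -> R) C : (forall n, Rabs (a (S n) - a n) <= C * (/ 2) ^ n) ->
  forall n, Rabs (a n - real (Lim_seq a)) <= 2 * C * (/ 2) ^ n.
Proof.
  intros H.
  assert (HC : 0 <= C).
  { generalize (H O) (Rabs_pos (a 1%nat - a 0%nat)); simpl; lra. }
  assert (Hle : forall n m, Rabs (a (n + m)%nat - a n) <= 2 * C * (/ 2) ^ n).
  { intros n m; eapply Rle_trans; [apply geom_cauchy_le, H|].
    assert (0 < (/ 2) ^ m) by (apply pow_lt; lra).
    assert (0 < (/ 2) ^ n) by (apply pow_lt; lra).
    assert (0 <= 2 * C * (/ 2) ^ n) by nra. nra. }
  assert (Hlim : ex_finite_lim_seq a).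
  { apply ex_lim_seq_cauchy_corr; intros [eps Heps]; simpl.
    assert (He : 0 < eps / (4 * C + 1)) by (apply Rdiv_lt_0_compat; lra).
    destruct (pow_lt_1_zero (/ 2)) with (2 := He) as [N HN].
    { rewrite Rabs_pos_eq; lra. }
    specialize (HN N (le_n _)).
    assert (Hp : 0 < (/ 2) ^ N) by (apply pow_lt; lra).
    rewrite Rabs_pos_eq in HN by lra.
    exists N; intros n m Hn Hm.
    replace n with (N + (n - N))%nat by lia; replace m with (N + (m - N))%nat by lia.
    generalize (Hle N (n - N)%nat) (Hle N (m - N)%nat); intros H1 H2.
    apply Rabs_le_between in H1; apply Rabs_le_between in H2.
    assert ((4 * C + 1) * (/ 2) ^ N < eps).
    { replace eps with ((4 * C + 1) * (eps / (4 * C + 1))) by (field; lra).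
      apply Rmult_lt_compat_l; lra. }
    apply Rabs_def1; lra. }
  intros n.
  assert (Hl := Lim_seq_correct' _ Hlim).
  set (l := real (Lim_seq a)) in *.
  assert (Hl' : is_lim_seq (fun m => Rabs (a n - a (m + n)%nat)) (Rabs (a n - l))).
  { apply (is_lim_seq_abs _ (a n - l)).
    apply (is_lim_seq_minus' (fun _ => a n) (fun m => a (m + n)%nat)); [apply is_lim_seq_const|].
    apply (is_lim_seq_incr_n a n l), Hl. }
  apply (is_lim_seq_le _ (fun _ => 2 * C * (/ 2) ^ n) _ (2 * C * (/ 2) ^ n)) in Hl'; [exact Hl'| |apply is_lim_seq_const].
  intros m; rewrite Rabs_minus_sym, Nat.add_comm; apply Hle.
Qed.

(** Discrete Gronwall inequality, from 1 + a <= exp a at each step. The one-step estimate is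
    required only for [j < n], because the Lipschitz bounds behind it hold up to a fixed time. *)
Lemma near_gronwall (F G : nat -> R -> R) a b n : 0 <= a -> 0 <= b -> near 0 (F O) (G O) ->
  (forall j d, (j < n)%nat -> near d (F j) (G j) -> near ((1 + a) * d + b) (F (S j)) (G (S j))) ->
  near (INR n * b * exp (INR n * a)) (F n) (G n).
Proof.
  intros Ha Hb H0; induction n as [|n IH]; intros H.
  - intros x; specialize (H0 x); simpl; lra.
  - assert (He : near (INR n * b * exp (INR n * a)) (F n) (G n)) by (apply IH; intros; apply H; auto).
    generalize (H n _ (Nat.lt_succ_diag_r n) He); intros Hs x; eapply Rle_trans; [apply Hs|].
    assert (Hn := pos_INR n).
    rewrite S_INR; replace ((INR n + 1) * a) with (INR n * a + a) by ring; rewrite exp_plus.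
    assert (H1 := exp_ineq1_le a); assert (H2 := exp_ineq1_le (INR n * a)).
    assert (0 <= INR n * a) by nra.
    assert (1 <= exp (INR n * a) * exp a) by nra.
    assert (0 <= INR n * b * exp (INR n * a)) by (repeat apply Rmult_le_pos; auto; lra).
    nra.
Qed.

Lemma near_trans d d' f g h : near d f g -> near d' g h -> near (d + d') f h.
Proof.
  intros H H' x; replace (f x - h x) with ((f x - g x) + (g x - h x)) by ring.
  eapply Rle_trans; [apply Rabs_triang|]; apply Rplus_le_compat; auto.
Qed.

Lemma near_sym d f g : near d f g -> near d g f.
Proof. intros H x; rewrite Rabs_minus_sym; apply H. Qed.

Lemma near_le d d' f g : near d f g -> d <= d' -> near d' f g.
Proof. intros H Hd x; eapply Rle_trans; [apply H | exact Hd]. Qed.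

Definition nf (x : R) : nat := Z.to_nat (Int_part x).

Lemma nf_spec x : 0 <= x -> INR (nf x) <= x < INR (nf x) + 1.
Proof.
  intros Hx; destruct (base_Int_part x) as [H1 H2]; unfold nf.
  assert (Hz : (0 <= Int_part x)%Z).
  { assert (-1 < Int_part x)%Z by (apply lt_IZR; simpl; lra). lia. }
  rewrite INR_IZR_INZ, Z2Nat.id by exact Hz; lra.
Qed.

Lemma nf_scale t h : 0 <= t -> 0 < h -> INR (nf (t / h)) * h <= t < INR (nf (t / h)) * h + h.
Proof.
  intros Ht Hh; destruct (nf_spec (t / h)) as [H1 H2].
  { apply Rmult_le_pos; [auto | apply Rlt_le, Rinv_0_lt_compat, Hh]. }
  assert (E : t = t / h * h) by (field; lra).
  split; [rewrite E at 2; apply Rmult_le_compat_r; lra|].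
  rewrite E at 1; replace (INR (nf (t / h)) * h + h) with ((INR (nf (t / h)) + 1) * h) by ring.
  apply Rmult_lt_compat_r; lra.
Qed.

(* The dyadic difference quotients converge because consecutive ones differ by
   a second difference, and telescoping second differences gives the Taylor bound. *)
Lemma lip2_derivable M1 M2 f : lip M1 f -> lip2 M2 f -> exists p : R -> R,
  lip M2 p /\ (forall x s, Rabs (f (x + s) - f x - s * p x) <= 2 * M2 * (s * s)).
Proof.
  intros H1 H2.
  assert (HM1 := lip_nonneg _ _ H1); assert (HM2 := lip2_nonneg _ _ H2).
  pose (h := fun n : nat => (/ 2) ^ n).
  assert (Hh : forall n, 0 < h n) by (intros n; apply pow_lt; lra).
  pose (q := fun n x => (f (x + h n) - f x) / h n).
  pose (p := fun x => real (Lim_seq (fun n => q n x))).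
  assert (Hq : forall n x, f (x + h n) - f x = h n * q n x).
  { intros n x; unfold q; field; apply Rgt_not_eq, Hh. }
  assert (Hqp : forall n x, Rabs (q n x - p x) <= 2 * M2 * h n).
  { intros n x; apply (geom_cauchy_lim (fun n => q n x)); clear n; intros n.
    assert (Hn := Hh (S n)).
    assert (E : h n = 2 * h (S n)) by (unfold h; simpl; field).
    fold (h n); unfold q; rewrite E.
    replace (x + 2 * h (S n)) with (x + h (S n) + h (S n)) by ring.
    specialize (H2 (h (S n)) (h (S n)) x (Rlt_le _ _ Hn) (Rlt_le _ _ Hn)).
    set (k := h (S n)) in *.
    replace ((f (x + k) - f x) / k - (f (x + k + k) - f x) / (2 * k))
      with (- ((f (x + k + k) - f (x + k) - f (x + k) + f x) * / (2 * k))) by (field; lra).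
    rewrite Rabs_Ropp, Rabs_mult, (Rabs_pos_eq (/ (2 * k))) by (apply Rlt_le, Rinv_0_lt_compat; lra).
    apply Rmult_le_reg_r with (2 * k); [lra|].
    rewrite Rmult_assoc, Rinv_l, Rmult_1_r by lra; nra. }
  assert (Hq1 : forall n x, Rabs (q n x) <= M1).
  { intros n x; specialize (H1 (x + h n) x); rewrite Hq in H1.
    replace (x + h n - x) with (h n) in H1 by ring.
    rewrite Rabs_mult, Rmult_comm in H1.
    apply Rmult_le_reg_r with (Rabs (h n)); [apply Rabs_pos_lt, Rgt_not_eq, Hh | exact H1]. }
  assert (Hql : forall n x r, 0 <= r -> Rabs (q n (x + r) - q n x) <= M2 * r).
  { intros n x r Hr; specialize (H2 r (h n) x Hr (Rlt_le _ _ (Hh n))).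
    replace (f (x + r + h n) - f (x + r) - f (x + h n) + f x)
      with (h n * (q n (x + r) - q n x)) in H2 by (rewrite Rmult_minus_distr_l, <- !Hq; ring).
    rewrite Rabs_mult, (Rabs_pos_eq (h n)) in H2 by apply Rlt_le, Hh.
    apply Rmult_le_reg_l with (h n); [apply Hh | lra]. }
  assert (Hpl : forall x r, 0 <= r -> Rabs (p (x + r) - p x) <= M2 * r).
  { intros x r Hr; apply le_of_geom with (4 * M2); intros n.
    generalize (Hql n x r Hr) (Hqp n x) (Hqp n (x + r)); fold (h n); intros A B C.
    apply Rabs_le_between in A; apply Rabs_le_between in B; apply Rabs_le_between in C.
    apply Rabs_le; lra. }
  assert (Hplip : lip M2 p).
  { intros x y; destruct (Rle_dec y x) as [E|E].
    - rewrite (Rabs_pos_eq (x - y)) by lra.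
      replace x with (y + (x - y)) at 1 by ring; apply Hpl; lra.
    - rewrite (Rabs_minus_sym x y), (Rabs_minus_sym (p x)), (Rabs_pos_eq (y - x)) by lra.
      replace y with (x + (y - x)) at 1 by ring; apply Hpl; lra. }
  assert (Htay : forall n x m, Rabs (f (x + INR m * h n) - f x - INR m * h n * q n x)
                   <= M2 * (INR m * h n) * (INR m * h n)).
  { intros n x m; induction m as [|m IH].
    - simpl; rewrite !Rmult_0_l, Rplus_0_r; replace (f x - f x - 0) with 0 by ring.
      rewrite Rabs_R0; lra.
    - assert (Hm := pos_INR m); assert (Hn := Hh n).
      assert (Hmh : 0 <= INR m * h n) by nra.
      specialize (H2 (INR m * h n) (h n) x Hmh (Rlt_le _ _ Hn)).
      rewrite S_INR; replace (x + (INR m + 1) * h n) with (x + INR m * h n + h n) by ring.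
      assert (E := Hq n x).
      apply Rabs_le_between in H2; apply Rabs_le_between in IH.
      assert (0 <= M2 * h n * h n) by (repeat apply Rmult_le_pos; lra).
      assert (0 <= M2 * (INR m * h n) * h n) by (repeat apply Rmult_le_pos; lra).
      apply Rabs_le; nra. }
  (* A general [s] is rounded down to a multiple of [h n]; the Lipschitz bound on [f] and the error
     of [q n] against [p] control the rounding, and both vanish as [n] grows. *)
  assert (Hpos : forall x s, 0 <= s -> Rabs (f (x + s) - f x - s * p x) <= M2 * (s * s)).
  { intros x s Hs; apply le_of_geom with (2 * M1 + 2 * M2 * s); intros n; fold (h n).
    assert (Hn := Hh n).
    destruct (nf_scale s (h n) Hs Hn) as [Hm1 Hm2]; set (m := nf (s / h n)) in *.
    assert (Hm0 : 0 <= INR m * h n) by (generalize (pos_INR m); nra).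
    specialize (Htay n x m).
    set (z := INR m * h n) in *.
    assert (A : Rabs (f (x + s) - f (x + z)) <= M1 * h n).
    { eapply Rle_trans; [apply H1|]; apply Rmult_le_compat_l; [auto|].
      apply Rabs_le; lra. }
    assert (B : Rabs (z * q n x - s * p x) <= M1 * h n + s * (2 * M2 * h n)).
    { replace (z * q n x - s * p x) with ((z - s) * q n x + s * (q n x - p x)) by ring.
      eapply Rle_trans; [apply Rabs_triang|].
      rewrite !Rabs_mult, (Rabs_pos_eq s Hs); apply Rplus_le_compat.
      - rewrite Rmult_comm; apply Rmult_le_compat; try apply Rabs_pos; [apply Hq1|].
        apply Rabs_le; lra.
      - apply Rmult_le_compat_l; auto. }
    assert (D : M2 * z * z <= M2 * (s * s)) by (rewrite Rmult_assoc; apply Rmult_le_compat_l; [auto | nra]).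
    apply Rabs_le_between in A; apply Rabs_le_between in B; apply Rabs_le_between in Htay.
    apply Rabs_le; lra. }
  exists p; split; [exact Hplip|]; intros x s.
  destruct (Rle_dec 0 s) as [Hs|Hs].
  - eapply Rle_trans; [apply Hpos, Hs|]; nra.
  (* A negative step is expanded forward from [x + s]; moving the slope from [x + s] back to [x]
     costs a second [M2 * (s * s)], hence the factor 2. *)
  - generalize (Hpos (x + s) (- s)) (Hpl (x + s) (- s)); intros A B.
    replace (x + s + - s) with x in * by ring.
    specialize (A ltac:(lra)); specialize (B ltac:(lra)).
    apply Rabs_le_between in A; apply Rabs_le_between in B.
    apply Rabs_le; split; nra.
Qed.

Lemma lip2_derive M1 M2 f : lip M1 f -> lip2 M2 f ->
  (forall x, ex_derive f x) /\ lip M2 (Derive f) /\ (forall x, Rabs (Derive f x) <= M1) /\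
  (forall x s, Rabs (f (x + s) - f x - s * Derive f x) <= 2 * M2 * (s * s)).
Proof.
  intros H1 H2.
  assert (HM2 := lip2_nonneg _ _ H2).
  destruct (lip2_derivable _ _ _ H1 H2) as [p [Hp Ht]].
  assert (Hd : forall x, is_derive f x (p x)).
  { intros x; apply is_derive_eps; intros eps Heps.
    exists (eps / (2 * M2 + 1)); split; [apply Rdiv_lt_0_compat; lra|]; intros s Hs.
    eapply Rle_trans; [apply Ht|].
    replace (2 * M2 * (s * s)) with ((2 * M2 * Rabs s) * Rabs s)
      by (rewrite Rmult_assoc, <- Rabs_mult, (Rabs_pos_eq (s * s)) by nra; ring).
    apply Rmult_le_compat_r; [apply Rabs_pos|].
    apply Rlt_le, Rle_lt_trans with ((2 * M2 + 1) * Rabs s); [generalize (Rabs_pos s); nra|].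
    replace eps with ((2 * M2 + 1) * (eps / (2 * M2 + 1))) by (field; lra).
    apply Rmult_lt_compat_l; lra. }
  assert (E : forall x, Derive f x = p x) by (intros x; apply is_derive_unique, Hd).
  repeat split.
  - intros x; eexists; apply Hd.
  - intros x y; rewrite !E; apply Hp.
  - intros x; rewrite E; apply (derive_abs_le_of_slope f x); [apply Hd|].
    intros s Hs; eapply Rle_trans; [apply H1|].
    replace (x + s - x) with s by ring; rewrite (Rabs_pos_eq s Hs); lra.
  - intros x s; rewrite E; apply Ht.
Qed.

Lemma lip_mult f g M N F G : lip M f -> lip N g ->
  (forall x, Rabs (f x) <= F) -> (forall x, Rabs (g x) <= G) ->
  lip (M * G + F * N) (fun x => f x * g x).
Proof.
  intros Hf Hg HF HG x y.
  replace (f x * g x - f y * g y) with ((f x - f y) * g x + f y * (g x - g y)) by ring.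
  eapply Rle_trans; [apply Rabs_triang|]; rewrite !Rabs_mult, Rmult_plus_distr_r.
  specialize (Hf x y); specialize (Hg x y); specialize (HF y); specialize (HG x).
  assert (HM := lip_nonneg M f).
  apply Rplus_le_compat.
  - replace (M * G * Rabs (x - y)) with (M * Rabs (x - y) * G) by ring.
    apply Rmult_le_compat; auto using Rabs_pos.
  - rewrite Rmult_assoc; apply Rmult_le_compat; auto using Rabs_pos.
Qed.

(** Discrete Leibniz rule: in the four-term expansion of the second difference, each of the two
    cross terms contributes [M * N]. *)
Lemma lip2_mult f g M N M2 N2 F G : lip M f -> lip N g -> lip2 M2 f -> lip2 N2 g ->
  (forall x, Rabs (f x) <= F) -> (forall x, Rabs (g x) <= G) ->
  lip2 (M2 * G + 2 * M * N + F * N2) (fun x => f x * g x).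
Proof.
  intros Hf Hg Hf2 Hg2 HF HG r s x Hr Hs.
  assert (HM := lip_nonneg _ _ Hf); assert (HN := lip_nonneg _ _ Hg).
  set (a := f (x + r + s)); set (b := f (x + r)); set (c := f (x + s)); set (d := f x).
  set (a' := g (x + r + s)); set (b' := g (x + r)); set (c' := g (x + s)); set (d' := g x).
  replace (a * a' - b * b' - c * c' + d * d') with
    ((a - b - c + d) * a' + (b - d) * (a' - b') + (c - d) * (a' - c') + d * (a' - b' - c' + d')) by ring.
  specialize (Hf2 r s x Hr Hs); specialize (Hg2 r s x Hr Hs).
  assert (A : forall k y, 0 <= k -> Rabs (f (y + k) - f y) <= M * k).
  { intros k y Hk; eapply Rle_trans; [apply Hf|]; replace (y + k - y) with k by ring.
    rewrite (Rabs_pos_eq k Hk); lra. }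
  assert (B : forall k y, 0 <= k -> Rabs (g (y + k) - g y) <= N * k).
  { intros k y Hk; eapply Rle_trans; [apply Hg|]; replace (y + k - y) with k by ring.
    rewrite (Rabs_pos_eq k Hk); lra. }
  assert (A1 := A r x Hr); assert (A2 := A s x Hs).
  assert (B1 := B s (x + r) Hs); assert (B2 := B r (x + s) Hr).
  replace (x + s + r) with (x + r + s) in B2 by ring.
  fold a b c d in Hf2, A1, A2; fold a' b' c' d' in Hg2, B1, B2.
  specialize (HF x); specialize (HG (x + r + s)); fold d in HF; fold a' in HG.
  replace ((M2 * G + 2 * M * N + F * N2) * r * s) with
    (M2 * r * s * G + M * r * (N * s) + M * s * (N * r) + F * (N2 * r * s)) by ring.
  repeat (eapply Rle_trans; [apply Rabs_triang|]; apply Rplus_le_compat);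
    rewrite Rabs_mult; apply Rmult_le_compat; auto using Rabs_pos.
Qed.

(* Compare with the second difference of g based at phi x, with steps
   phi (x + r) - phi x and phi (x + s) - phi x. *)
Lemma lip2_comp g phi M M2 P P2 : lip M g -> lip2 M2 g -> lip P phi -> lip2 P2 phi ->
  (forall x y, x <= y -> phi x <= phi y) ->
  lip2 (M2 * (P * P) + M * P2) (fun x => g (phi x)).
Proof.
  intros Hg Hg2 Hp Hp2 Hm r s x Hr Hs.
  assert (HM := lip_nonneg _ _ Hg); assert (HM2 := lip2_nonneg _ _ Hg2).
  assert (HP := lip_nonneg _ _ Hp).
  set (a := phi x); set (b := phi (x + s)); set (c := phi (x + r)); set (d := phi (x + r + s)).
  assert (Hb : 0 <= b - a <= P * s).
  { split; [unfold a, b; generalize (Hm x (x + s)); lra|].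
    eapply Rle_trans; [apply Rle_abs|]; eapply Rle_trans; [apply Hp|].
    replace (x + s - x) with s by ring; rewrite (Rabs_pos_eq s Hs); lra. }
  assert (Hc : 0 <= c - a <= P * r).
  { split; [unfold a, c; generalize (Hm x (x + r)); lra|].
    eapply Rle_trans; [apply Rle_abs|]; eapply Rle_trans; [apply Hp|].
    replace (x + r - x) with r by ring; rewrite (Rabs_pos_eq r Hr); lra. }
  specialize (Hp2 r s x Hr Hs); fold a b c d in Hp2.
  generalize (Hg2 (c - a) (b - a) a (proj1 Hc) (proj1 Hb)).
  replace (a + (c - a) + (b - a)) with (c + b - a) by ring.
  replace (a + (c - a)) with c by ring; replace (a + (b - a)) with b by ring; intros A.
  generalize (Hg d (c + b - a)); replace (d - (c + b - a)) with (d - c - b + a) by ring; intros B.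
  assert (C : M2 * (c - a) * (b - a) <= M2 * (P * P) * r * s).
  { replace (M2 * (P * P) * r * s) with (M2 * ((P * r) * (P * s))) by ring.
    rewrite Rmult_assoc; apply Rmult_le_compat_l; [auto|]. apply Rmult_le_compat; lra. }
  assert (D : M * Rabs (d - c - b + a) <= M * P2 * r * s).
  { replace (M * P2 * r * s) with (M * (P2 * r * s)) by ring; apply Rmult_le_compat_l; auto. }
  apply Rabs_le_between in A; apply Rabs_le_between in B; apply Rabs_le; lra.
Qed.

(** Interpolation between the sup norm and a C^{1,1} bound: the quotient of length [s] is within
    [2 * M2 * s] of the derivative, for [f] and for [g]. The length stays free, to be balanced
    against [d] by the user. *)
Lemma derive_near M1 M2 f g d s x : lip M1 f -> lip2 M2 f -> lip M1 g -> lip2 M2 g ->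
  near d f g -> 0 < s -> Rabs (Derive f x - Derive g x) <= 4 * M2 * s + 2 * d / s.
Proof.
  intros Hf Hf2 Hg Hg2 Hd Hs.
  destruct (lip2_derive _ _ _ Hf Hf2) as [_ [_ [_ Tf]]].
  destruct (lip2_derive _ _ _ Hg Hg2) as [_ [_ [_ Tg]]].
  specialize (Tf x s); specialize (Tg x s).
  assert (D1 := Hd x); assert (D2 := Hd (x + s)).
  apply Rabs_le_between in Tf; apply Rabs_le_between in Tg.
  apply Rabs_le_between in D1; apply Rabs_le_between in D2.
  apply Rmult_le_reg_r with s; auto.
  replace ((4 * M2 * s + 2 * d / s) * s) with (4 * M2 * (s * s) + 2 * d) by (field; lra).
  rewrite <- (Rabs_pos_eq s) at 1 by lra; rewrite <- Rabs_mult; apply Rabs_le; lra.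
Qed.

(** * Joint continuity on the closed half-plane *)

Definition jcont (F : R -> R -> R) (t x : R) : Prop :=
  forall eps, 0 < eps -> exists d, 0 < d /\
    forall t' x', 0 <= t' -> Rabs (t' - t) < d -> Rabs (x' - x) < d -> Rabs (F t' x' - F t x) < eps.

Lemma jcont_lip F t x C d0 : 0 < d0 ->
  (forall t' x', 0 <= t' -> Rabs (t' - t) < d0 -> Rabs (x' - x) < d0 ->
     Rabs (F t' x' - F t x) <= C * (Rabs (t' - t) + Rabs (x' - x))) -> jcont F t x.
Proof.
  intros Hd0 H eps Heps.
  assert (HC := Rabs_pos C); assert (HC' := Rle_abs C).
  exists (Rmin d0 (eps / (2 * (Rabs C + 1)))); split.
  - apply Rmin_glb_lt; [auto | apply Rdiv_lt_0_compat; lra].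
  - intros t' x' Ht' H1 H2.
    assert (Hm := Rmin_l d0 (eps / (2 * (Rabs C + 1)))).
    assert (Hm' := Rmin_r d0 (eps / (2 * (Rabs C + 1)))).
    eapply Rle_lt_trans; [apply H; auto; lra|].
    assert (P1 := Rabs_pos (t' - t)); assert (P2 := Rabs_pos (x' - x)).
    apply Rle_lt_trans with ((Rabs C + 1) * (Rabs (t' - t) + Rabs (x' - x))); [nra|].
    replace eps with ((Rabs C + 1) * (2 * (eps / (2 * (Rabs C + 1))))) by (field; lra).
    apply Rmult_lt_compat_l; lra.
Qed.

Lemma jcont_plus F G t x : jcont F t x -> jcont G t x -> jcont (fun t x => F t x + G t x) t x.
Proof.
  intros HF HG eps Heps.
  destruct (HF (eps / 2)) as [d1 [Hd1 H1]]; [lra|].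
  destruct (HG (eps / 2)) as [d2 [Hd2 H2]]; [lra|].
  exists (Rmin d1 d2); split; [apply Rmin_glb_lt; auto|]; intros t' x' Ht' Ha Hb.
  assert (Hm := Rmin_l d1 d2); assert (Hm' := Rmin_r d1 d2).
  specialize (H1 t' x' Ht' ltac:(lra) ltac:(lra)); specialize (H2 t' x' Ht' ltac:(lra) ltac:(lra)).
  apply Rabs_def2 in H1; apply Rabs_def2 in H2; apply Rabs_def1; lra.
Qed.

Lemma jcont_mult F G t x : jcont F t x -> jcont G t x -> jcont (fun t x => F t x * G t x) t x.
Proof.
  intros HF HG eps Heps.
  set (a := Rabs (F t x)); set (b := Rabs (G t x)).
  assert (Ha := Rabs_pos (F t x)); assert (Hb := Rabs_pos (G t x)); fold a b in Ha, Hb.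
  set (e := Rmin 1 (eps / (a + b + 2))).
  assert (He : 0 < e) by (apply Rmin_glb_lt; [lra | apply Rdiv_lt_0_compat; lra]).
  assert (He1 : e <= 1) by apply Rmin_l.
  assert (He2 : (a + b + 2) * e <= eps).
  { replace eps with ((a + b + 2) * (eps / (a + b + 2))) by (field; lra).
    apply Rmult_le_compat_l; [lra | apply Rmin_r]. }
  destruct (HF e He) as [d1 [Hd1 H1]]; destruct (HG e He) as [d2 [Hd2 H2]].
  exists (Rmin d1 d2); split; [apply Rmin_glb_lt; auto|]; intros t' x' Ht' Hta Hxb.
  assert (Hm := Rmin_l d1 d2); assert (Hm' := Rmin_r d1 d2).
  specialize (H1 t' x' Ht' ltac:(lra) ltac:(lra)); specialize (H2 t' x' Ht' ltac:(lra) ltac:(lra)).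
  replace (F t' x' * G t' x' - F t x * G t x) with
    ((F t' x' - F t x) * (G t' x' - G t x) + (F t' x' - F t x) * G t x + F t x * (G t' x' - G t x)) by ring.
  apply Rle_lt_trans with (e * e + e * b + a * e); [|nra].
  eapply Rle_trans; [apply Rabs_triang|]; apply Rplus_le_compat;
    [eapply Rle_trans; [apply Rabs_triang|]; apply Rplus_le_compat|]; rewrite Rabs_mult;
    apply Rmult_le_compat; auto using Rabs_pos; fold a b; lra.
Qed.

Lemma jcont_opp F t x : jcont F t x -> jcont (fun t x => - F t x) t x.
Proof.
  intros HF eps Heps; destruct (HF eps Heps) as [d [Hd H]]; exists d; split; auto.
  intros t' x' Ht' Ha Hb; replace (- F t' x' - - F t x) with (- (F t' x' - F t x)) by ring.
  rewrite Rabs_Ropp; auto.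
Qed.

(** * The semi-Lagrangian step *)

(* The last five fields are the limits as N tends to infinity of (i)-(v). *)
Record tame (K : (R -> R) -> R -> R) (vmax L c C : R) (gam Gam W : R -> R) : Prop := {
  tame_C1 : forall rho, Per1 rho -> C1fun (K rho);
  tame_Per1 : forall rho, Per1 rho -> Per1 (K rho);
  tame_bound : forall rho x, Per1 rho -> 0 <= K rho x <= vmax;
  tame_L : 0 <= L;
  tame_c : 0 <= c;
  tame_C : 0 <= C;
  tame_gam : nondec_nonneg gam;
  tame_Gam : nondec_nonneg Gam;
  tame_W : nondec_nonneg W;
  tame_sup : forall lo hi d f g, 0 < lo -> Per1 f -> Per1 g -> inbox lo hi f -> inbox lo hi g ->
    near d f g -> near (L * d) (K f) (K g);
  tame_der : forall lo hi d f g, 0 < lo -> Per1 f -> Per1 g -> inbox lo hi f -> inbox lo hi g ->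
    near d f g -> near (Gam hi * d) (Derive (K f)) (Derive (K g));
  tame_comparison : forall lo hi f x, 0 < lo -> Per1 f -> inbox lo hi f ->
    - c * (hi - f x) <= Derive (K f) x <= c * (f x - lo);
  tame_lip : forall lo hi M f, 0 < lo -> Per1 f -> inbox lo hi f -> lip M f ->
    lip (gam hi + C * M) (Derive (K f));
  tame_lip2 : forall lo hi M M2 f, 0 < lo -> Per1 f -> inbox lo hi f -> lip M f -> lip2 M2 f ->
    lip2 (W (hi + M) + C * M2) (Derive (K f))
}.

Definition weight (K : (R -> R) -> R -> R) (tau : R) (rho : R -> R) (y : R) : R :=
  rho y * (1 - tau * Derive (K rho) y).

(* One semi-Lagrangian step: follow the characteristic backwards to its foot and
   apply the compression factor there. Evaluating the factor at the foot is what
   makes the maximum principle exact. *)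
Definition step (K : (R -> R) -> R -> R) (tau : R) (rho : R -> R) (x : R) : R :=
  weight K tau rho (x - tau * K rho x).

Section Step.

Context (K : (R -> R) -> R -> R) (vmax L c C : R) (gam Gam W : R -> R).
Context (HK : tame K vmax L c C gam Gam W).
Context (lo hi : R) (Hlo : 0 < lo).

Definition adm (f : R -> R) : Prop := Per1 f /\ inbox lo hi f.

(* A bound for the derivative of the velocity of an admissible density. *)
Let A := c * hi.

(** The bound on [tau * (c * hi)] is a condition of CFL type: it yields the maximum principle and
    keeps the foot map nondecreasing. The bound [tau <= 1] only serves to discard higher powers of
    [tau]. *)
Definition small (tau : R) : Prop := 0 <= tau /\ tau <= 1 /\ tau * (c * hi) <= 1.

(** These constants are the coefficients collected in the estimates of this section. Two dependences
    matter: [c_grow] does not involve [M], and [c_grow2] involves [M] but not the second-order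
    constant. Both growth recursions are therefore linear and cannot blow up in finite time. *)
Definition c_vel (M : R) : R := gam hi + C * M.
Definition c_weight (M : R) : R := 2 * M + hi * c_vel M.
Definition c_grow : R := 3 * A + 2 * hi * gam hi + 2 * hi * C.
Definition c_grow2 (M : R) : R :=
  7 * A + 4 * hi * C + 8 * M * c_vel M + 4 * hi * W (hi + M) + c_weight M * c_vel M.
Definition c_stab (M : R) : R := A + hi * Gam hi + c_weight M * L.
Definition c_move (M : R) : R := M * vmax + hi * A.
Definition c_foot (M : R) : R := L * c_move M + A * vmax.
Definition c_cons (M : R) : R :=
  2 * M * c_foot M + hi * (c_vel M * c_foot M + Gam hi * c_move M
                           + c_vel M * (L * c_move M + vmax) + A * A).

Lemma adm_hi f : adm f -> 0 < hi.
Proof. intros [_ H]; specialize (H 0); lra. Qed.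

Lemma A_nonneg f : adm f -> 0 <= A.
Proof.
  intros H; apply adm_hi in H; apply Rmult_le_pos; [apply (tame_c _ _ _ _ _ _ _ _ HK) | lra].
Qed.

Lemma adm_abs f : adm f -> forall x, Rabs (f x) <= hi.
Proof. intros [_ H] x; specialize (H x); rewrite Rabs_pos_eq; lra. Qed.

Lemma c_vel_nonneg f M : adm f -> 0 <= M -> 0 <= c_vel M.
Proof.
  intros Hf HM; apply adm_hi in Hf.
  apply Rplus_le_le_0_compat; [apply (tame_gam _ _ _ _ _ _ _ _ HK); lra|].
  apply Rmult_le_pos; [apply (tame_C _ _ _ _ _ _ _ _ HK) | auto].
Qed.

Lemma c_weight_nonneg f M : adm f -> 0 <= M -> 0 <= c_weight M.
Proof.
  intros Hf HM; assert (H1 := c_vel_nonneg f M Hf HM); apply adm_hi in Hf.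
  unfold c_weight; nra.
Qed.

Lemma vel_der_abs f : adm f -> forall x, Rabs (Derive (K f) x) <= A.
Proof.
  intros [H1 H2] x; destruct (tame_comparison _ _ _ _ _ _ _ _ HK lo hi f x Hlo H1 H2).
  assert (Hc := tame_c _ _ _ _ _ _ _ _ HK); specialize (H2 x).
  apply Rabs_le; unfold A; nra.
Qed.

Lemma vel_lip f : adm f -> lip A (K f).
Proof.
  intros Hf; apply lip_of_derive with (Derive (K f)); [|apply vel_der_abs, Hf].
  intros x; apply Derive_correct, (tame_C1 _ _ _ _ _ _ _ _ HK), Hf.
Qed.

Lemma vel_lip2 f M : adm f -> lip M f -> lip2 (c_vel M) (K f).
Proof.
  intros [H1 H2] HM r s x Hr Hs.
  assert (Hl := tame_lip _ _ _ _ _ _ _ _ HK lo hi M f Hlo H1 H2 HM).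
  assert (Hd : forall y, is_derive (fun y => K f (y + r) - K f y) y
                 (Derive (K f) (y + r) - Derive (K f) y)).
  { intros y.
    assert (D := fun z => Derive_correct _ z (proj1 (tame_C1 _ _ _ _ _ _ _ _ HK f H1) z)).
    apply (is_derive_minus (fun y => K f (y + r)) (K f)); [apply is_derive_shift|]; apply D. }
  assert (Hlip : lip (c_vel M * r) (fun y => K f (y + r) - K f y)).
  { eapply lip_of_derive; [apply Hd|]; intros y; eapply Rle_trans; [apply Hl|].
    replace (y + r - y) with r by ring; rewrite (Rabs_pos_eq r Hr); unfold c_vel; lra. }
  specialize (Hlip (x + s) x).
  replace (x + s - x) with s in Hlip by ring; rewrite (Rabs_pos_eq s Hs) in Hlip.
  replace (x + s + r) with (x + r + s) in Hlip by ring.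
  replace (K f (x + r + s) - K f (x + r) - K f (x + s) + K f x)
    with (K f (x + r + s) - K f (x + s) - (K f (x + r) - K f x)) by ring.
  exact Hlip.
Qed.

Lemma step_adm tau f : small tau -> adm f -> adm (step K tau f).
Proof.
  intros [Ht0 [_ Ht]] Hf; assert (Hf' := Hf); destruct Hf as [[Hc [Hp Hper]] Hb].
  (* With [y] the foot, the upper bound on the velocity derivative shows that the new value exceeds
     [lo] by at least [(f y - lo) * (1 - tau * (c * f y))], and the lower bound gives the mirror
     statement at [hi]. Since [f y <= hi], smallness of [tau] makes the last factor nonnegative. *)
  assert (Hbox : inbox lo hi (step K tau f)).
  { intros x; unfold step, weight; set (y := x - tau * K f x).
    generalize (tame_comparison _ _ _ _ _ _ _ _ HK lo hi f y Hlo (proj1 Hf') (proj2 Hf')).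
    specialize (Hb y); intros [H1 H2].
    assert (Hcc := tame_c _ _ _ _ _ _ _ _ HK).
    assert (Hfy : tau * (c * f y) <= 1).
    { eapply Rle_trans; [|exact Ht]; apply Rmult_le_compat_l; nra. }
    split.
    - assert (tau * Derive (K f) y <= tau * (c * (f y - lo))) by (apply Rmult_le_compat_l; lra).
      assert (0 <= (f y - lo) * (1 - tau * (c * f y))) by (apply Rmult_le_pos; lra). nra.
    - assert (tau * (- c * (hi - f y)) <= tau * Derive (K f) y) by (apply Rmult_le_compat_l; lra).
      assert (0 <= (hi - f y) * (1 - tau * (c * f y))) by (apply Rmult_le_pos; lra). nra. }
  split; [|exact Hbox].
  assert (HKf := tame_C1 _ _ _ _ _ _ _ _ HK f (proj1 Hf')).
  assert (HKp := tame_Per1 _ _ _ _ _ _ _ _ HK f (proj1 Hf')).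
  split; [|split].
  - intros x; unfold step, weight.
    assert (Cphi : continuous (fun x => x - tau * K f x) x).
    { apply (continuous_minus (fun x => x) (fun x => tau * K f x)); [apply continuous_id|].
      apply (continuous_mult (fun _ => tau) (K f)); [apply continuous_const | apply HKp]. }
    apply (continuous_mult (fun x => f (x - tau * K f x))
             (fun x => 1 - tau * Derive (K f) (x - tau * K f x))).
    + apply (continuous_comp (fun x => x - tau * K f x) f); auto.
    + apply (continuous_minus (fun _ => 1) (fun x => tau * Derive (K f) (x - tau * K f x)));
        [apply continuous_const|].
      apply (continuous_mult (fun _ => tau)); [apply continuous_const|].
      apply (continuous_comp (fun x => x - tau * K f x) (Derive (K f))); [auto | apply HKf].
  - intros x; specialize (Hbox x); lra.
  - intros x; unfold step, weight; rewrite (proj2 (proj2 HKp)).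
    replace (x + 1 - tau * K f x) with (x - tau * K f x + 1) by ring.
    rewrite Hper, Derive_periodic; [reflexivity | apply HKp].
Qed.

Lemma factor_abs tau f : 0 <= tau -> adm f ->
  forall x, Rabs (1 - tau * Derive (K f) x) <= 1 + tau * A.
Proof.
  intros Ht Hf x; assert (H := vel_der_abs f Hf x); apply Rabs_le_between in H.
  apply Rabs_le; nra.
Qed.

Lemma factor_lip tau f M : 0 <= tau -> adm f -> lip M f ->
  lip (tau * c_vel M) (fun x => 1 - tau * Derive (K f) x).
Proof.
  intros Ht [H1 H2] HM x y.
  assert (Hl := tame_lip _ _ _ _ _ _ _ _ HK lo hi M f Hlo H1 H2 HM x y).
  replace (1 - tau * Derive (K f) x - (1 - tau * Derive (K f) y))
    with (- (tau * (Derive (K f) x - Derive (K f) y))) by ring.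
  rewrite Rabs_Ropp, Rabs_mult, (Rabs_pos_eq tau Ht), Rmult_assoc.
  apply Rmult_le_compat_l; auto.
Qed.

(** Here the coefficient reduces to [M] at [tau = 0], as the growth recursions require. The cruder
    [weight_lip] is enough wherever a factor [tau] already stands in front. *)
Lemma weight_lip_exact tau f M : 0 <= tau -> adm f -> lip M f ->
  lip (M * (1 + tau * A) + hi * (tau * c_vel M)) (weight K tau f).
Proof.
  intros Ht Hf HM; apply (lip_mult f (fun x => 1 - tau * Derive (K f) x)).
  - exact HM.
  - apply factor_lip; auto.
  - apply adm_abs, Hf.
  - apply factor_abs; auto.
Qed.

Lemma weight_lip tau f M : small tau -> adm f -> lip M f -> lip (c_weight M) (weight K tau f).
Proof.
  intros [Ht [Ht1 HtA]] Hf HM.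
  eapply lip_le; [apply weight_lip_exact; eauto|]; unfold c_weight; fold A in HtA.
  assert (H0 := lip_nonneg _ _ HM).
  assert (H1 := c_vel_nonneg f M Hf H0); apply adm_hi in Hf.
  assert (tau * c_vel M <= c_vel M) by nra. nra.
Qed.

Lemma foot_lip tau f : 0 <= tau -> adm f -> lip (1 + tau * A) (fun x => x - tau * K f x).
Proof.
  intros Ht Hf x y; assert (H := vel_lip f Hf x y).
  replace (x - tau * K f x - (y - tau * K f y)) with ((x - y) - tau * (K f x - K f y)) by ring.
  eapply Rle_trans; [apply Rabs_triang|].
  rewrite Rabs_Ropp, Rabs_mult, (Rabs_pos_eq tau Ht).
  assert (tau * Rabs (K f x - K f y) <= tau * (A * Rabs (x - y))) by (apply Rmult_le_compat_l; auto).
  lra.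
Qed.

(** Composition with the foot map multiplies the constant of the weight by [1 + tau * A]. As [c_vel]
    is affine in [M], the increase is at most [tau] times a multiple of [M + 1]. *)
Lemma step_lip tau f M : small tau -> adm f -> lip M f ->
  lip (M + tau * c_grow * (M + 1)) (step K tau f).
Proof.
  intros Hs Hf HM; assert (Hs' := Hs); destruct Hs as [Ht [Ht1 HtA]].
  assert (H0 := lip_nonneg _ _ HM); assert (H1 := c_vel_nonneg f M Hf H0).
  assert (HA := A_nonneg f Hf); assert (Hh := adm_hi f Hf); fold A in HtA.
  apply lip_le with ((M * (1 + tau * A) + hi * (tau * c_vel M)) * (1 + tau * A)).
  - intros x y; unfold step; eapply Rle_trans; [apply weight_lip_exact; eauto|].
    rewrite Rmult_assoc; apply Rmult_le_compat_l.
    + assert (0 <= tau * A) by nra. assert (0 <= tau * c_vel M) by nra. nra.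
    + apply foot_lip; auto.
  - unfold c_grow; set (z := tau * A) in *.
    assert (Hz : 0 <= z) by (apply Rmult_le_pos; auto).
    assert (Hg : 0 <= gam hi) by (apply (tame_gam _ _ _ _ _ _ _ _ HK); lra).
    assert (HC := tame_C _ _ _ _ _ _ _ _ HK).
    (* Since [z <= 1], (1 + z)^2 <= 1 + 3z; this is the 3 in [c_grow]. *)
    assert (E1 : M * ((1 + z) * (1 + z)) <= M * (1 + 3 * z)) by (apply Rmult_le_compat_l; nra).
    assert (E2 : hi * (tau * c_vel M) * (1 + z) <= hi * (tau * c_vel M) * 2).
    { apply Rmult_le_compat_l; [|lra]. apply Rmult_le_pos; [lra|]; apply Rmult_le_pos; auto. }
    assert (E3 : 0 <= tau * (2 * hi * gam hi) * M) by (repeat apply Rmult_le_pos; lra).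
    assert (E4 : 0 <= tau * (2 * hi * C)) by (repeat apply Rmult_le_pos; lra).
    unfold c_vel in *. replace (tau * (3 * A + 2 * hi * gam hi + 2 * hi * C) * (M + 1)) with
      (3 * z * M + 3 * z + tau * (2 * hi * gam hi) * M + tau * (2 * hi * gam hi)
       + tau * (2 * hi * C) * M + tau * (2 * hi * C)) by (unfold z; ring).
    nra.
Qed.

(** The second-order constant enters through [f] and, by the gain of one derivative, through a bound
    affine in [M2] for (K f)'. All else depends on [M] only and carries a factor [tau]. *)
Lemma step_lip2 tau f M M2 : small tau -> adm f -> lip M f -> lip2 M2 f ->
  lip2 (M2 + tau * c_grow2 M * (M2 + 1)) (step K tau f).
Proof.
  intros Hs Hf HM HM2; assert (Hs' := Hs); destruct Hs as [Ht [Ht1 HtA]].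
  assert (H0 := lip_nonneg _ _ HM); assert (H1 := c_vel_nonneg f M Hf H0).
  assert (H2 := lip2_nonneg _ _ HM2).
  assert (HA := A_nonneg f Hf); assert (Hh := adm_hi f Hf); fold A in HtA.
  set (b3 := W (hi + M) + C * M2).
  assert (F2 : lip2 (tau * b3) (fun x => 1 - tau * Derive (K f) x)).
  { intros r s x Hr Hs.
    assert (Hl := tame_lip2 _ _ _ _ _ _ _ _ HK lo hi M M2 f Hlo (proj1 Hf) (proj2 Hf) HM HM2 r s x Hr Hs).
    fold b3 in Hl; set (w := Derive (K f)) in *.
    replace (1 - tau * w (x + r + s) - (1 - tau * w (x + r)) - (1 - tau * w (x + s)) + (1 - tau * w x))
      with (- (tau * (w (x + r + s) - w (x + r) - w (x + s) + w x))) by ring.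
    rewrite Rabs_Ropp, Rabs_mult, (Rabs_pos_eq tau Ht), !Rmult_assoc.
    rewrite Rmult_assoc in Hl; apply Rmult_le_compat_l; auto. }
  assert (G2 : lip2 (M2 * (1 + tau * A) + 2 * M * (tau * c_vel M) + hi * (tau * b3)) (weight K tau f)).
  { apply (lip2_mult f (fun x => 1 - tau * Derive (K f) x)); auto.
    - apply factor_lip; auto.
    - apply adm_abs, Hf.
    - apply factor_abs; auto. }
  assert (P2 : lip2 (tau * c_vel M) (fun x => x - tau * K f x)).
  { intros r s x Hr Hs; assert (Hl := vel_lip2 f M Hf HM r s x Hr Hs); set (w := K f) in *.
    replace (x + r + s - tau * w (x + r + s) - (x + r - tau * w (x + r)) - (x + s - tau * w (x + s)) + (x - tau * w x))
      with (- (tau * (w (x + r + s) - w (x + r) - w (x + s) + w x))) by ring.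
    rewrite Rabs_Ropp, Rabs_mult, (Rabs_pos_eq tau Ht), !Rmult_assoc.
    rewrite Rmult_assoc in Hl; apply Rmult_le_compat_l; auto. }
  (* [lip2_comp] needs a nondecreasing inner map; [tau * A <= 1] provides it. *)
  assert (Mono : forall x y, x <= y -> x - tau * K f x <= y - tau * K f y).
  { intros x y Hxy; assert (Hl := vel_lip f Hf y x).
    rewrite (Rabs_pos_eq (y - x)) in Hl by lra; apply Rabs_le_between in Hl.
    assert (tau * (K f y - K f x) <= tau * (A * (y - x))) by (apply Rmult_le_compat_l; lra).
    assert (tau * A * (y - x) <= 1 * (y - x)) by (apply Rmult_le_compat_r; lra).
    lra. }
  eapply lip2_le.
  - apply (lip2_comp (weight K tau f) (fun x => x - tau * K f x)).
    + exact (weight_lip tau f M Hs' Hf HM).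
    + exact G2.
    + exact (foot_lip tau f Ht Hf).
    + exact P2.
    + exact Mono.
  - unfold c_grow2; set (z := tau * A) in *.
    assert (Hz : 0 <= z) by (apply Rmult_le_pos; auto).
    assert (HW : 0 <= W (hi + M)) by (apply (tame_W _ _ _ _ _ _ _ _ HK); lra).
    assert (HC := tame_C _ _ _ _ _ _ _ _ HK).
    assert (Hw := c_weight_nonneg f M Hf H0).
    assert (Hb3 : 0 <= b3) by (unfold b3; nra).
    (* The leading term [M2] is multiplied by (1 + z)^3 <= 1 + 7z, the 7 of [c_grow2]; the other
       terms already contain [tau], so the crude bound 4 suffices for them. *)
    assert (E0 : (1 + z) * (1 + z) <= 4) by nra.
    assert (E1 : M2 * ((1 + z) * ((1 + z) * (1 + z))) <= M2 * (1 + 7 * z)).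
    { apply Rmult_le_compat_l; auto.
      assert (z * z <= z) by nra. assert (z * z * z <= z) by nra. nra. }
    assert (E2 : 2 * M * (tau * c_vel M) * ((1 + z) * (1 + z)) <= 2 * M * (tau * c_vel M) * 4).
    { apply Rmult_le_compat_l; auto; repeat apply Rmult_le_pos; lra. }
    assert (E3 : hi * (tau * b3) * ((1 + z) * (1 + z)) <= hi * (tau * b3) * 4).
    { apply Rmult_le_compat_l; auto; repeat apply Rmult_le_pos; lra. }
    assert (P1 : 0 <= tau * (8 * M * c_vel M + 4 * hi * W (hi + M) + c_weight M * c_vel M) * M2).
    { repeat apply Rmult_le_pos; auto. repeat apply Rplus_le_le_0_compat; repeat apply Rmult_le_pos; lra. }
    assert (P3 : 0 <= tau * (4 * hi * C)) by (repeat apply Rmult_le_pos; lra).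
    replace (tau * (7 * A + 4 * hi * C + 8 * M * c_vel M + 4 * hi * W (hi + M) + c_weight M * c_vel M) * (M2 + 1))
      with (7 * z * M2 + 7 * z + tau * (4 * hi * C) * M2 + tau * (4 * hi * C)
        + tau * (8 * M * c_vel M + 4 * hi * W (hi + M) + c_weight M * c_vel M) * M2
        + tau * (8 * M * c_vel M + 4 * hi * W (hi + M) + c_weight M * c_vel M)) by (unfold z; ring).
    unfold b3 in *. nra.
Qed.

Lemma step_near tau f M : small tau -> adm f -> lip M f -> near (c_move M * tau) (step K tau f) f.
Proof.
  intros [Ht [Ht1 HtA]] Hf HM x; unfold step, weight, c_move.
  set (y := x - tau * K f x).
  assert (H0 := lip_nonneg _ _ HM).
  assert (Hv := tame_bound _ _ _ _ _ _ _ _ HK f x (proj1 Hf)).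
  assert (H1 : Rabs (f y - f x) <= M * (tau * vmax)).
  { eapply Rle_trans; [apply HM|]; apply Rmult_le_compat_l; auto.
    unfold y; replace (x - tau * K f x - x) with (- (tau * K f x)) by ring.
    rewrite Rabs_Ropp, Rabs_pos_eq by nra; apply Rmult_le_compat_l; lra. }
  assert (H2 : Rabs (f y * (tau * Derive (K f) y)) <= hi * (tau * A)).
  { rewrite !Rabs_mult, (Rabs_pos_eq tau Ht); apply Rmult_le_compat; try apply Rabs_pos.
    - apply Rmult_le_pos; auto using Rabs_pos.
    - apply adm_abs, Hf.
    - apply Rmult_le_compat_l; auto; apply vel_der_abs, Hf. }
  replace (f y * (1 - tau * Derive (K f) y) - f x) with
    ((f y - f x) - f y * (tau * Derive (K f) y)) by ring.
  eapply Rle_trans; [apply Rabs_triang|]; rewrite Rabs_Ropp; lra.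
Qed.

(** Only [g] has to be Lipschitz: the weights of [f] and [g] are first compared at the foot
    belonging to [f], and then the weight of [g] alone is moved to its own foot. *)
Lemma step_stable tau f g M d : small tau -> adm f -> adm g -> lip M g -> near d f g ->
  near ((1 + tau * c_stab M) * d) (step K tau f) (step K tau g).
Proof.
  intros Hs Hf Hg HM Hd x; assert (Hs' := Hs); destruct Hs as [Ht [Ht1 HtA]].
  assert (H0 := lip_nonneg _ _ HM); assert (Hd0 := near_nonneg _ _ _ Hd).
  unfold step; set (y := x - tau * K f x); set (y' := x - tau * K g x).
  assert (E1 : Rabs (weight K tau g y - weight K tau g y') <= c_weight M * (tau * (L * d))).
  { eapply Rle_trans; [apply (weight_lip tau g M); auto|].
    apply Rmult_le_compat_l; [apply (c_weight_nonneg g); auto|].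
    unfold y, y'; replace (x - tau * K f x - (x - tau * K g x)) with (- (tau * (K f x - K g x))) by ring.
    rewrite Rabs_Ropp, Rabs_mult, (Rabs_pos_eq tau Ht); apply Rmult_le_compat_l; auto.
    exact (tame_sup _ _ _ _ _ _ _ _ HK lo hi d f g Hlo (proj1 Hf) (proj1 Hg) (proj2 Hf) (proj2 Hg) Hd x). }
  assert (E2 : Rabs ((f y - g y) * (1 - tau * Derive (K f) y)) <= d * (1 + tau * A)).
  { rewrite Rabs_mult; apply Rmult_le_compat; auto using Rabs_pos, factor_abs. }
  assert (E3 : Rabs (g y * (tau * (Derive (K f) y - Derive (K g) y))) <= hi * (tau * (Gam hi * d))).
  { rewrite !Rabs_mult, (Rabs_pos_eq tau Ht); apply Rmult_le_compat; try apply Rabs_pos.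
    - apply Rmult_le_pos; auto using Rabs_pos.
    - apply adm_abs, Hg.
    - apply Rmult_le_compat_l; auto.
      exact (tame_der _ _ _ _ _ _ _ _ HK lo hi d f g Hlo (proj1 Hf) (proj1 Hg) (proj2 Hf) (proj2 Hg) Hd y). }
  replace (weight K tau f y - weight K tau g y') with
    ((f y - g y) * (1 - tau * Derive (K f) y) - g y * (tau * (Derive (K f) y - Derive (K g) y))
     + (weight K tau g y - weight K tau g y')) by (unfold weight; ring).
  eapply Rle_trans; [apply Rabs_triang|].
  apply Rle_trans with (d * (1 + tau * A) + hi * (tau * (Gam hi * d)) + c_weight M * (tau * (L * d)));
    [|unfold c_stab; lra].
  apply Rplus_le_compat; auto.
  eapply Rle_trans; [apply Rabs_triang|]; rewrite Rabs_Ropp; lra.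
Qed.

Lemma c_move_nonneg f M : adm f -> 0 <= M -> 0 <= c_move M.
Proof.
  intros Hf HM; assert (HA := A_nonneg f Hf); assert (Hh := adm_hi f Hf).
  assert (Hv := tame_bound _ _ _ _ _ _ _ _ HK f 0 (proj1 Hf)).
  unfold c_move; apply Rplus_le_le_0_compat; apply Rmult_le_pos; lra.
Qed.

(** Each discrepancy is a product of two small effects: over a time [sigma] the density, hence the
    velocity, changes by O(sigma), and this acts during [tau]; over a time [tau] the position
    changes by O(tau), and this acts during [sigma]. *)
Lemma step_consistent sigma tau f M : 0 <= sigma -> 0 <= tau -> small (sigma + tau) ->
  adm f -> lip M f ->
  near (c_cons M * sigma * tau) (step K (sigma + tau) f) (step K tau (step K sigma f)).
Proof.
  intros Hsg Ht Hs Hf HM x; destruct Hs as [_ [Hs1 HsA]]; fold A in HsA.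
  assert (H0 := lip_nonneg _ _ HM); assert (Hb2 := c_vel_nonneg f M Hf H0).
  assert (HA := A_nonneg f Hf); assert (Hh := adm_hi f Hf).
  assert (HL := tame_L _ _ _ _ _ _ _ _ HK).
  assert (HG : 0 <= Gam hi) by (apply (tame_Gam _ _ _ _ _ _ _ _ HK); lra).
  assert (Hmv := c_move_nonneg f M Hf H0).
  assert (Hss : small sigma) by (repeat split; fold A; nra).
  assert (Hst : small tau) by (repeat split; fold A; nra).
  set (g := step K sigma f).
  assert (Hg : adm g) by (apply step_adm; auto).
  assert (Hgf : near (c_move M * sigma) g f) by (apply step_near; auto).
  assert (Dv : near (L * (c_move M * sigma)) (K g) (K f)).
  { exact (tame_sup _ _ _ _ _ _ _ _ HK lo hi _ g f Hlo (proj1 Hg) (proj1 Hf) (proj2 Hg) (proj2 Hf) Hgf). }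
  assert (Dw : near (Gam hi * (c_move M * sigma)) (Derive (K g)) (Derive (K f))).
  { exact (tame_der _ _ _ _ _ _ _ _ HK lo hi _ g f Hlo (proj1 Hg) (proj1 Hf) (proj2 Hg) (proj2 Hf) Hgf). }
  assert (Vf := tame_bound _ _ _ _ _ _ _ _ HK f x (proj1 Hf)).
  assert (Vg := tame_bound _ _ _ _ _ _ _ _ HK g x (proj1 Hg)).
  assert (Vm : 0 <= vmax) by lra.
  assert (Lv := vel_lip f Hf).
  assert (Lw := tame_lip _ _ _ _ _ _ _ _ HK lo hi M f Hlo (proj1 Hf) (proj2 Hf) HM).
  fold (c_vel M) in Lw.
  set (z' := x - (sigma + tau) * K f x); set (y := x - tau * K g x).
  set (z := y - sigma * K f y).
  change (Rabs (weight K (sigma + tau) f z' - weight K tau g y) <= c_cons M * sigma * tau).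
  assert (Eg : g y = weight K sigma f z) by reflexivity.
  unfold weight at 2; rewrite Eg; unfold weight.
  set (w := Derive (K f)) in *; set (w1 := Derive (K g)) in *.
  assert (Sy : Rabs (x - y) <= tau * vmax).
  { unfold y; replace (x - (x - tau * K g x)) with (tau * K g x) by ring.
    rewrite Rabs_pos_eq by nra; nra. }
  assert (Sv : Rabs (K f x - K f y) <= A * (tau * vmax)).
  { eapply Rle_trans; [apply Lv|]; apply Rmult_le_compat_l; auto. }
  assert (Sz : Rabs (z - z') <= sigma * tau * c_foot M).
  { unfold z, z'. replace (y - sigma * K f y - (x - (sigma + tau) * K f x))
      with (- (tau * (K g x - K f x)) + sigma * (K f x - K f y)) by (unfold y; ring).
    eapply Rle_trans; [apply Rabs_triang|].
    rewrite Rabs_Ropp, !Rabs_mult, (Rabs_pos_eq tau Ht), (Rabs_pos_eq sigma Hsg).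
    specialize (Dv x).
    assert (tau * Rabs (K g x - K f x) <= tau * (L * (c_move M * sigma))) by (apply Rmult_le_compat_l; auto).
    assert (sigma * Rabs (K f x - K f y) <= sigma * (A * (tau * vmax))) by (apply Rmult_le_compat_l; auto).
    unfold c_foot; lra. }
  (* This distance is only O(sigma), which is enough because it is used in a term that has the
     prefactor [tau]. *)
  assert (Syz : Rabs (y - z') <= sigma * (L * c_move M + vmax)).
  { unfold y, z'. replace (x - tau * K g x - (x - (sigma + tau) * K f x))
      with (- (tau * (K g x - K f x)) + sigma * K f x) by ring.
    eapply Rle_trans; [apply Rabs_triang|].
    rewrite Rabs_Ropp, !Rabs_mult, (Rabs_pos_eq tau Ht), (Rabs_pos_eq sigma Hsg), (Rabs_pos_eq (K f x)) by lra.
    specialize (Dv x).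
    assert (tau * Rabs (K g x - K f x) <= tau * (L * (c_move M * sigma))) by (apply Rmult_le_compat_l; auto).
    assert (0 <= L * (c_move M * sigma)) by (repeat apply Rmult_le_pos; auto).
    assert (tau * (L * (c_move M * sigma)) <= 1 * (L * (c_move M * sigma))) by (apply Rmult_le_compat_r; lra).
    assert (sigma * K f x <= sigma * vmax) by (apply Rmult_le_compat_l; lra). lra. }
  assert (Hft : 0 <= c_foot M).
  { unfold c_foot; apply Rplus_le_le_0_compat; apply Rmult_le_pos; auto. }
  assert (T1 : Rabs ((f z' - f z) * (1 - (sigma + tau) * w z')) <= M * (sigma * tau * c_foot M) * 2).
  { rewrite Rabs_mult; apply Rmult_le_compat; auto using Rabs_pos.
    - rewrite Rabs_minus_sym; eapply Rle_trans; [apply HM|]; apply Rmult_le_compat_l; auto.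
    - eapply Rle_trans; [apply factor_abs; auto; lra|]; lra. }
  (* [q] is the single compression factor minus the product of the two; its last term is the cross
     term of that product. *)
  set (q := sigma * (w z - w z') + tau * (w1 y - w y) + tau * (w y - w z') - sigma * tau * (w z * w1 y)).
  assert (T2 : Rabs q <= sigma * tau * (c_vel M * c_foot M + Gam hi * c_move M
                           + c_vel M * (L * c_move M + vmax) + A * A)).
  { assert (Q1 : Rabs (sigma * (w z - w z')) <= sigma * tau * (c_vel M * c_foot M)).
    { rewrite Rabs_mult, (Rabs_pos_eq sigma Hsg).
      assert (Rabs (w z - w z') <= c_vel M * (sigma * tau * c_foot M)).
      { eapply Rle_trans; [apply Lw|]; apply Rmult_le_compat_l; auto. }
      assert (sigma * Rabs (w z - w z') <= 1 * (c_vel M * (sigma * tau * c_foot M))).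
      { apply Rmult_le_compat; auto using Rabs_pos; lra. }
      lra. }
    assert (Q2 : Rabs (tau * (w1 y - w y)) <= tau * (Gam hi * (c_move M * sigma))).
    { rewrite Rabs_mult, (Rabs_pos_eq tau Ht); apply Rmult_le_compat_l; auto; apply Dw. }
    assert (Q3 : Rabs (tau * (w y - w z')) <= tau * (c_vel M * (sigma * (L * c_move M + vmax)))).
    { rewrite Rabs_mult, (Rabs_pos_eq tau Ht); apply Rmult_le_compat_l; auto.
      eapply Rle_trans; [apply Lw|]; apply Rmult_le_compat_l; auto. }
    assert (Q4 : Rabs (sigma * tau * (w z * w1 y)) <= sigma * tau * (A * A)).
    { rewrite !Rabs_mult, (Rabs_pos_eq sigma Hsg), (Rabs_pos_eq tau Ht); apply Rmult_le_compat_l; [nra|].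
      apply Rmult_le_compat; auto using Rabs_pos; apply vel_der_abs; auto. }
    unfold q.
    apply Rabs_le_between in Q1; apply Rabs_le_between in Q2.
    apply Rabs_le_between in Q3; apply Rabs_le_between in Q4.
    apply Rabs_le; lra. }
  assert (T3 : Rabs (f z * q) <= hi * (sigma * tau * (c_vel M * c_foot M + Gam hi * c_move M
                           + c_vel M * (L * c_move M + vmax) + A * A))).
  { rewrite Rabs_mult; apply Rmult_le_compat; auto using Rabs_pos, adm_abs. }
  replace (f z' * (1 - (sigma + tau) * w z') - f z * (1 - sigma * w z) * (1 - tau * w1 y))
    with ((f z' - f z) * (1 - (sigma + tau) * w z') + f z * q) by (unfold q; ring).
  eapply Rle_trans; [apply Rabs_triang|]; unfold c_cons; lra.
Qed.

(** * Iterated steps: growth, refinement and comparison with one long step *)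

Let tau0 : R := / (1 + A).

Definition lip_at (M T : R) : R := exp (c_grow * T) * (M + 1).
Definition lip2_at (M M2 T : R) : R := exp (c_grow2 (lip_at M T) * T) * (M2 + 1).

Lemma exp_le x y : x <= y -> exp x <= exp y.
Proof. intros [H| ->]; [apply Rlt_le, exp_increasing, H | lra]. Qed.

Lemma iter_adm tau n f : small tau -> adm f -> adm (Nat.iter n (step K tau) f).
Proof. intros Ht Hf; induction n as [|n IH]; simpl; auto using step_adm. Qed.

(** By [step_lip], [M + 1] is multiplied by at most [1 + tau * c_grow] per step; the final -1 undoes
    the shift and keeps the induction exact. *)
Lemma iter_lip_exact tau n f M : small tau -> adm f -> lip M f ->
  lip (exp (c_grow * (INR n * tau)) * (M + 1) - 1) (Nat.iter n (step K tau) f).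
Proof.
  intros Ht Hf HM; assert (H0 := lip_nonneg _ _ HM); induction n as [|n IH].
  - simpl; rewrite Rmult_0_l, Rmult_0_r, exp_0; replace (1 * (M + 1) - 1) with M by ring; exact HM.
  - change (Nat.iter (S n) (step K tau) f) with (step K tau (Nat.iter n (step K tau) f)).
    eapply lip_le; [apply step_lip; eauto using iter_adm|].
    rewrite S_INR; replace (c_grow * ((INR n + 1) * tau)) with (c_grow * (INR n * tau) + tau * c_grow) by ring.
    rewrite exp_plus; assert (H := exp_ineq1_le (tau * c_grow)).
    assert (0 <= exp (c_grow * (INR n * tau)) * (M + 1)) by (apply Rmult_le_pos; [apply Rlt_le, exp_pos | lra]).
    nra.
Qed.

Lemma c_grow_nonneg f : adm f -> 0 <= c_grow.
Proof.
  intros Hf; assert (HA := A_nonneg f Hf); assert (Hh := adm_hi f Hf).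
  assert (Hc := tame_c _ _ _ _ _ _ _ _ HK).
  assert (Hg : 0 <= gam hi) by (apply (tame_gam _ _ _ _ _ _ _ _ HK); lra).
  assert (HC := tame_C _ _ _ _ _ _ _ _ HK).
  unfold c_grow; repeat apply Rplus_le_le_0_compat; repeat apply Rmult_le_pos; lra.
Qed.

Lemma c_grow2_nonneg f M : adm f -> 0 <= M -> 0 <= c_grow2 M.
Proof.
  intros Hf HM; assert (HA := A_nonneg f Hf); assert (Hh := adm_hi f Hf).
  assert (Hc := tame_c _ _ _ _ _ _ _ _ HK).
  assert (HW : 0 <= W (hi + M)) by (apply (tame_W _ _ _ _ _ _ _ _ HK); lra).
  assert (HC := tame_C _ _ _ _ _ _ _ _ HK).
  assert (H1 := c_vel_nonneg f M Hf HM); assert (H2 := c_weight_nonneg f M Hf HM).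
  unfold c_grow2; repeat apply Rplus_le_le_0_compat; repeat apply Rmult_le_pos; lra.
Qed.

Lemma c_stab_nonneg f M : adm f -> 0 <= M -> 0 <= c_stab M.
Proof.
  intros Hf HM; assert (HA := A_nonneg f Hf); assert (Hh := adm_hi f Hf).
  assert (Hc := tame_c _ _ _ _ _ _ _ _ HK).
  assert (HG : 0 <= Gam hi) by (apply (tame_Gam _ _ _ _ _ _ _ _ HK); lra).
  assert (HL := tame_L _ _ _ _ _ _ _ _ HK).
  assert (H2 := c_weight_nonneg f M Hf HM).
  unfold c_stab; repeat apply Rplus_le_le_0_compat; repeat apply Rmult_le_pos; lra.
Qed.

Lemma c_cons_nonneg f M : adm f -> 0 <= M -> 0 <= c_cons M.
Proof.
  intros Hf HM; assert (HA := A_nonneg f Hf); assert (Hh := adm_hi f Hf).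
  assert (Hc := tame_c _ _ _ _ _ _ _ _ HK).
  assert (HG : 0 <= Gam hi) by (apply (tame_Gam _ _ _ _ _ _ _ _ HK); lra).
  assert (HL := tame_L _ _ _ _ _ _ _ _ HK).
  assert (Hv := tame_bound _ _ _ _ _ _ _ _ HK f 0 (proj1 Hf)).
  assert (H1 := c_vel_nonneg f M Hf HM); assert (H2 := c_move_nonneg f M Hf HM).
  assert (H3 : 0 <= L * c_move M) by (apply Rmult_le_pos; auto).
  assert (H4 : 0 <= A * vmax) by (apply Rmult_le_pos; lra).
  unfold c_cons, c_foot; generalize dependent (c_vel M); generalize dependent (c_move M).
  intros; repeat (apply Rplus_le_le_0_compat || apply Rmult_le_pos); lra.
Qed.

Lemma lip_at_nonneg M T : 0 <= M -> 0 <= lip_at M T.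
Proof. intros H; apply Rmult_le_pos; [apply Rlt_le, exp_pos | lra]. Qed.

Lemma iter_lip tau n f M T : small tau -> adm f -> lip M f -> INR n * tau <= T ->
  lip (lip_at M T) (Nat.iter n (step K tau) f).
Proof.
  intros Ht Hf HM HT; eapply lip_le; [apply iter_lip_exact; eauto|].
  assert (H := lip_nonneg _ _ HM); unfold lip_at.
  assert (E : exp (c_grow * (INR n * tau)) <= exp (c_grow * T)).
  { apply exp_le, Rmult_le_compat_l; [eapply c_grow_nonneg; eauto | auto]. }
  nra.
Qed.

(** The Lipschitz constants of all iterates up to time [T] are at most [lip_at M T], so the rate can
    be frozen at [c_grow2 (lip_at M T)]. What remains is a linear recursion for [M2 + 1]. *)
Lemma iter_lip2 tau n f M M2 T : small tau -> adm f -> lip M f -> lip2 M2 f -> INR n * tau <= T ->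
  lip2 (lip2_at M M2 T) (Nat.iter n (step K tau) f).
Proof.
  intros Ht Hf HM HM2 HT; assert (H := lip_nonneg _ _ HM); assert (H2 := lip2_nonneg _ _ HM2).
  set (G := c_grow2 (lip_at M T)).
  assert (HG : 0 <= G) by (eapply c_grow2_nonneg; eauto using lip_at_nonneg).
  assert (Hex : lip2 (exp (G * (INR n * tau)) * (M2 + 1) - 1) (Nat.iter n (step K tau) f)).
  { induction n as [|n IH].
    - simpl; rewrite Rmult_0_l, Rmult_0_r, exp_0; replace (1 * (M2 + 1) - 1) with M2 by ring; exact HM2.
    - rewrite S_INR in HT; destruct (Ht) as [Ht0 _].
      assert (HT' : INR n * tau <= T) by lra.
      change (Nat.iter (S n) (step K tau) f) with (step K tau (Nat.iter n (step K tau) f)).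
      eapply lip2_le; [apply step_lip2; eauto using iter_adm, iter_lip|].
      fold G; rewrite S_INR; replace (G * ((INR n + 1) * tau)) with (G * (INR n * tau) + tau * G) by ring.
      rewrite exp_plus; assert (E := exp_ineq1_le (tau * G)).
      assert (0 <= exp (G * (INR n * tau)) * (M2 + 1)) by (apply Rmult_le_pos; [apply Rlt_le, exp_pos | lra]).
      nra. }
  eapply lip2_le; [exact Hex|]; unfold lip2_at; fold G.
  assert (E : exp (G * (INR n * tau)) <= exp (G * T)) by (apply exp_le, Rmult_le_compat_l; auto).
  nra.
Qed.

(** Consistency with two halves gives a local error O(tau^2) between one coarse step and two fine
    ones; at most T / tau of them accumulate to O(tau) by Gronwall. Stability is applied with the
    fine iterate as its Lipschitz argument. *)
Lemma iter_halve tau n f M T : small tau -> adm f -> lip M f -> INR n * tau <= T ->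
  near (T * c_cons (lip_at M T) * exp (T * c_stab (lip_at M T)) * tau)
    (Nat.iter n (step K tau) f) (Nat.iter (2 * n) (step K (tau / 2)) f).
Proof.
  intros Ht Hf HM HT; assert (H0 := lip_nonneg _ _ HM); set (Mb := lip_at M T).
  assert (HMb : 0 <= Mb) by (apply lip_at_nonneg; auto).
  assert (Hst := c_stab_nonneg f Mb Hf HMb); assert (Hco := c_cons_nonneg f Mb Hf HMb).
  destruct (Ht) as [Ht0 [Ht1 HtA]].
  assert (Hh : small (tau / 2)).
  { assert (HA := A_nonneg f Hf); unfold A in HA; repeat split; try lra; nra. }
  assert (Hn := pos_INR n).
  eapply near_le.
  - apply (near_gronwall (fun j => Nat.iter j (step K tau) f)
             (fun j => Nat.iter (2 * j) (step K (tau / 2)) f) (tau * c_stab Mb) (c_cons Mb * (tau * tau)) n).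
    + apply Rmult_le_pos; auto.
    + apply Rmult_le_pos; nra.
    + intros x; simpl; rewrite Rminus_diag, Rabs_R0; lra.
    + intros j d Hj Hd.
      assert (Hj' : INR j <= INR n) by (apply le_INR; lia).
      assert (Had : adm (Nat.iter (2 * j) (step K (tau / 2)) f)) by (apply iter_adm; auto).
      assert (Hl : lip Mb (Nat.iter (2 * j) (step K (tau / 2)) f)).
      { apply iter_lip; auto; rewrite mult_INR; change (INR 2) with 2; nra. }
      replace (2 * S j)%nat with (S (S (2 * j))) by lia.
      set (g := Nat.iter (2 * j) (step K (tau / 2)) f) in *.
      change (near ((1 + tau * c_stab Mb) * d + c_cons Mb * (tau * tau))
                (step K tau (Nat.iter j (step K tau) f)) (step K (tau / 2) (step K (tau / 2) g))).
      apply near_trans with (step K tau g).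
      * apply step_stable; auto; apply iter_adm; auto.
      * assert (E : tau / 2 + tau / 2 = tau) by field.
        assert (Hcs : near (c_cons Mb * (tau / 2) * (tau / 2)) (step K (tau / 2 + tau / 2) g)
                        (step K (tau / 2) (step K (tau / 2) g))).
        { apply step_consistent; auto; try lra; rewrite E; auto. }
        rewrite E in Hcs; eapply near_le; [exact Hcs|].
        assert (0 <= c_cons Mb * (tau * tau)) by (apply Rmult_le_pos; nra).
        unfold Rdiv; lra.
  - assert (E : exp (INR n * (tau * c_stab Mb)) <= exp (T * c_stab Mb)).
    { apply exp_le; rewrite <- Rmult_assoc; apply Rmult_le_compat_r; auto. }
    replace (T * c_cons Mb * exp (T * c_stab Mb) * tau) with (T * (c_cons Mb * tau) * exp (T * c_stab Mb)) by ring.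
    replace (INR n * (c_cons Mb * (tau * tau))) with (INR n * tau * (c_cons Mb * tau)) by ring.
    apply Rmult_le_compat; [ | apply Rlt_le, exp_pos | | exact E].
    + repeat apply Rmult_le_pos; auto.
    + apply Rmult_le_compat_r; [apply Rmult_le_pos|]; auto.
Qed.

Lemma small_le s t : 0 <= s -> s <= t -> 0 <= A -> small t -> small s.
Proof. unfold A; intros Hs Hst HA [H0 [H1 H2]]; repeat split; nra. Qed.

(** Gronwall between [j] short steps and one step of length j tau: lengthening the long step by
    [tau] costs (j tau) tau, at most s tau with s = m tau, and [m] such errors add up to s^2. The
    bound does not depend on [tau] except through s. *)
Lemma iter_vs_step tau m f M : 0 <= tau -> small (INR m * tau) -> adm f -> lip M f ->
  near (c_cons M * exp (c_stab (M + c_grow * (M + 1))) * ((INR m * tau) * (INR m * tau)))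
    (Nat.iter m (step K tau) f) (step K (INR m * tau) f).
Proof.
  intros Ht Hm Hf HM; assert (H0 := lip_nonneg _ _ HM).
  assert (HA := A_nonneg f Hf).
  set (M' := M + c_grow * (M + 1)).
  assert (Hgr := c_grow_nonneg f Hf).
  assert (HM' : 0 <= M') by (unfold M'; nra).
  assert (Hst := c_stab_nonneg f M' Hf HM'); assert (Hco := c_cons_nonneg f M Hf H0).
  assert (Hm0 := pos_INR m).
  set (s := INR m * tau) in *.
  assert (Hs0 : 0 <= s) by (apply Rmult_le_pos; auto).
  eapply near_le.
  - apply (near_gronwall (fun j => Nat.iter j (step K tau) f)
             (fun j => step K (INR j * tau) f) (tau * c_stab M') (c_cons M * s * tau) m).
    + apply Rmult_le_pos; auto.
    + repeat apply Rmult_le_pos; auto.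
    + intros x; unfold step, weight; simpl; rewrite !Rmult_0_l, !Rminus_0_r, Rmult_1_r, Rminus_diag, Rabs_R0; lra.
    + intros j d Hj Hd.
      assert (Hj' : INR (S j) <= INR m) by (apply le_INR; lia).
      rewrite S_INR in *; assert (Hj0 := pos_INR j).
      assert (Hjt : INR j * tau + tau <= s) by (unfold s; nra).
      assert (Hjt0 : 0 <= INR j * tau) by (apply Rmult_le_pos; auto).
      assert (Sj : small (INR j * tau)) by (apply small_le with s; auto; lra).
      assert (St : small tau) by (apply small_le with s; auto; lra).
      apply near_trans with (step K tau (step K (INR j * tau) f)).
      * apply step_stable; auto.
        { apply iter_adm; auto. } { apply step_adm; auto. }
        { eapply lip_le; [apply step_lip; eauto|]. destruct Sj as [_ [Sj _]]; unfold M'.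
          assert (0 <= c_grow * (M + 1)) by nra. nra. }
      * apply near_sym; replace ((INR j + 1) * tau) with (INR j * tau + tau) by ring.
        eapply near_le; [apply step_consistent with (M := M); auto|].
        { apply small_le with s; auto; lra. }
        apply Rmult_le_compat_r; auto; apply Rmult_le_compat_l; auto; lra.
  - replace (INR m * (tau * c_stab M')) with (s * c_stab M') by (unfold s; ring).
    replace (INR m * (c_cons M * s * tau)) with (c_cons M * (s * s)) by (unfold s; ring).
    assert (E : exp (s * c_stab M') <= exp (c_stab M')).
    { apply exp_le; destruct Hm as [_ [Hm _]]. nra. }
    replace (c_cons M * exp (c_stab M') * (s * s)) with (c_cons M * (s * s) * exp (c_stab M')) by ring.
    apply Rmult_le_compat_l; auto; apply Rmult_le_pos; nra.
Qed.

(** By consistency the longer step is, up to an error proportional to s' - s, the shorter one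
    followed by a step of length s' - s, which moves the density little. *)
Lemma step_time s s' f M : 0 <= s -> s <= s' -> small s' -> adm f -> lip M f ->
  near ((c_cons M + c_move (M + c_grow * (M + 1))) * (s' - s)) (step K s f) (step K s' f).
Proof.
  intros Hs Hs' Hsm Hf HM; assert (H0 := lip_nonneg _ _ HM); assert (HA := A_nonneg f Hf).
  assert (Hgr := c_grow_nonneg f Hf); assert (Hco := c_cons_nonneg f M Hf H0).
  assert (Ss : small s) by (apply small_le with s'; auto).
  assert (Sd : small (s' - s)) by (apply small_le with s'; auto; lra).
  assert (E : s + (s' - s) = s') by ring.
  apply near_sym; eapply near_le; [apply near_trans with (step K (s' - s) (step K s f))|].
  - rewrite <- E at 1; apply step_consistent with (M := M); auto; [lra|]; rewrite E; auto.
  - apply step_near with (M := M + c_grow * (M + 1)); [auto|apply step_adm; auto|].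
    eapply lip_le; [apply step_lip; eauto|]. destruct Ss as [_ [Ss _]].
    assert (0 <= c_grow * (M + 1)) by nra. nra.
  - destruct Ss as [_ [Ss _]]. assert (0 <= c_cons M * (s' - s)) by nra. nra.
Qed.

(** * The limit of the dyadic iterates *)

Context (rho0 : R -> R) (M0 M20 : R).
Context (Hrho0 : adm rho0) (HM0 : lip M0 rho0) (HM20 : lip2 M20 rho0).

Let tau (k : nat) : R := tau0 * (/ 2) ^ k.

(** Piecewise constant in time, without interpolation between grid times: the error of one step size
    is of the order of the discretisation error. The step is halved at each level so that
    [iter_halve] compares consecutive levels. *)
Definition approx (k : nat) (t : R) : R -> R :=
  Nat.iter (nf (t / (/ (1 + c * hi) * (/ 2) ^ k))) (step K (/ (1 + c * hi) * (/ 2) ^ k)) rho0.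

Definition flow (t x : R) : R := real (Lim_seq (fun k => approx k t x)).

Let Mt (T : R) : R := lip_at M0 T.
Let M2t (T : R) : R := lip2_at M0 M20 T.

Lemma A_ge0 : 0 <= A.
Proof. exact (A_nonneg rho0 Hrho0). Qed.

Lemma Mt_nonneg T : 0 <= Mt T.
Proof. apply lip_at_nonneg, (lip_nonneg _ _ HM0). Qed.

(** The 1 in the denominator of [tau0] gives [tau0 <= 1] and covers the case [A = 0]. *)
Lemma tau0_bounds : 0 < tau0 <= 1 /\ tau0 * A <= 1.
Proof.
  assert (HA := A_ge0); unfold tau0.
  assert (Hp : 0 < / (1 + A)) by (apply Rinv_0_lt_compat; lra).
  assert (E : / (1 + A) * (1 + A) = 1) by (field; lra).
  repeat split; nra.
Qed.

Lemma small_tau0 : small tau0.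
Proof. destruct tau0_bounds as [H1 H2]; repeat split; try lra; exact H2. Qed.

Lemma half_pow_bounds k : 0 < (/ 2) ^ k <= 1.
Proof. induction k as [|k IH]; simpl; lra. Qed.

Lemma tau_bounds k : 0 < tau k <= tau0.
Proof. destruct tau0_bounds as [H1 H2]; assert (H := half_pow_bounds k); unfold tau; nra. Qed.

Lemma small_tau k : small (tau k).
Proof.
  assert (H := tau_bounds k); apply small_le with tau0; try lra; [apply A_ge0 | apply small_tau0].
Qed.

Lemma approx_eq k t : approx k t = Nat.iter (nf (t / tau k)) (step K (tau k)) rho0.
Proof. reflexivity. Qed.

Lemma approx_adm k t : adm (approx k t).
Proof. rewrite approx_eq; apply iter_adm; [apply small_tau | exact Hrho0]. Qed.

Lemma approx_lip k t T : 0 <= t <= T -> lip (Mt T) (approx k t).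
Proof.
  intros Ht; rewrite approx_eq; apply iter_lip; auto; [apply small_tau|].
  destruct (nf_scale t (tau k)) as [H _]; [lra | apply tau_bounds | lra].
Qed.

Lemma approx_lip2 k t T : 0 <= t <= T -> lip2 (M2t T) (approx k t).
Proof.
  intros Ht; rewrite approx_eq; apply iter_lip2; auto; [apply small_tau|].
  destruct (nf_scale t (tau k)) as [H _]; [lra | apply tau_bounds | lra].
Qed.

Definition c_cauchy (T : R) : R :=
  T * c_cons (lip_at M0 T) * exp (T * c_stab (lip_at M0 T)) + c_move (lip_at M0 T).

Lemma approx_succ k t T : 0 <= t <= T ->
  near (c_cauchy T * (/ 2) ^ k) (approx (S k) t) (approx k t).
Proof.
  intros Ht; rewrite !approx_eq.
  assert (Hk := tau_bounds k); assert (Ek : tau (S k) = tau k / 2) by (unfold tau; simpl; field).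
  rewrite Ek.
  destruct (nf_scale t (tau k)) as [H1 H2]; try lra.
  destruct (nf_scale t (tau k / 2)) as [H3 H4]; try lra.
  set (n := nf (t / tau k)) in *; set (n' := nf (t / (tau k / 2))) in *.
  assert (Sk := small_tau k); assert (Sk' := small_tau (S k)); rewrite Ek in Sk'.
  assert (HM := Mt_nonneg T).
  assert (Hmv := c_move_nonneg rho0 _ Hrho0 HM).
  assert (Hh : near (T * c_cons (Mt T) * exp (T * c_stab (Mt T)) * tau k)
            (Nat.iter (2 * n) (step K (tau k / 2)) rho0) (Nat.iter n (step K (tau k)) rho0)).
  { apply near_sym, iter_halve; auto; lra. }
  assert (Hq : 0 <= T * c_cons (Mt T) * exp (T * c_stab (Mt T))).
  { repeat apply Rmult_le_pos; [lra | apply c_cons_nonneg with rho0; auto | apply Rlt_le, exp_pos]. }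
  assert (Ht1 : tau k <= (/ 2) ^ k).
  { destruct tau0_bounds; assert (H5 := half_pow_bounds k); unfold tau; nra. }
  (* Halving the step turns the floor [n] into 2n or 2n + 1; the possible extra fine step costs only
     [c_move] times its length. *)
  assert (Hn' : n' = (2 * n)%nat \/ n' = S (2 * n)).
  { assert (Ha : (n' < 2 * n + 2)%nat).
    { apply INR_lt; rewrite plus_INR, mult_INR; simpl.
      apply Rmult_lt_reg_r with (tau k / 2); lra. }
    assert (Hb : (2 * n < n' + 1)%nat).
    { apply INR_lt; rewrite plus_INR, mult_INR; simpl.
      apply Rmult_lt_reg_r with (tau k / 2); lra. }
    lia. }
  unfold c_cauchy; fold (Mt T).
  destruct Hn' as [-> | ->].
  - eapply near_le; [exact Hh|]; nra.
  - eapply near_le; [apply near_trans with (Nat.iter (2 * n) (step K (tau k / 2)) rho0); [|exact Hh]|].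
    + simpl Nat.iter at 1; apply step_near with (M := Mt T); [auto | apply iter_adm; auto|].
      apply iter_lip; auto; rewrite mult_INR; simpl; lra.
    + assert (c_move (Mt T) * (tau k / 2) <= c_move (Mt T) * (/ 2) ^ k)
        by (apply Rmult_le_compat_l; lra). nra.
Qed.

Lemma approx_flow k t T : 0 <= t <= T ->
  near (2 * c_cauchy T * (/ 2) ^ k) (approx k t) (flow t).
Proof.
  intros Ht x; apply (geom_cauchy_lim (fun k => approx k t x)); intros n.
  apply approx_succ; auto.
Qed.

Lemma flow_lip t T : 0 <= t <= T -> lip (Mt T) (flow t).
Proof.
  intros Ht x y; apply le_of_geom with (4 * c_cauchy T); intros n.
  generalize (approx_lip n t T Ht x y) (approx_flow n t T Ht x) (approx_flow n t T Ht y); intros H1 H2 H3.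
  apply Rabs_le_between in H1; apply Rabs_le_between in H2; apply Rabs_le_between in H3.
  apply Rabs_le; lra.
Qed.

Lemma flow_lip2 t T : 0 <= t <= T -> lip2 (M2t T) (flow t).
Proof.
  intros Ht r s x Hr Hs; apply le_of_geom with (8 * c_cauchy T); intros n.
  generalize (approx_lip2 n t T Ht r s x Hr Hs) (approx_flow n t T Ht x) (approx_flow n t T Ht (x + r))
    (approx_flow n t T Ht (x + s)) (approx_flow n t T Ht (x + r + s)); intros H1 H2 H3 H4 H5.
  apply Rabs_le_between in H1; apply Rabs_le_between in H2; apply Rabs_le_between in H3.
  apply Rabs_le_between in H4; apply Rabs_le_between in H5.
  apply Rabs_le; lra.
Qed.

Lemma flow_adm t : 0 <= t -> adm (flow t).
Proof.
  intros Ht; assert (Ht' : 0 <= t <= t) by lra.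
  assert (Hb : inbox lo hi (flow t)).
  { intros x; split; apply le_of_geom with (2 * c_cauchy t); intros n;
      destruct (approx_adm n t) as [_ Hb]; specialize (Hb x);
      assert (H := approx_flow n t t Ht' x); apply Rabs_le_between in H; lra. }
  split; [|exact Hb]; split; [|split].
  - apply lip_continuous with (Mt t), flow_lip, Ht'.
  - intros x; specialize (Hb x); lra.
  - intros x; unfold flow; f_equal; apply Lim_seq_ext; intros n; apply approx_adm.
Qed.

Lemma flow_0 x : flow 0 x = rho0 x.
Proof.
  unfold flow; rewrite (Lim_seq_ext _ (fun _ => rho0 x)); [now rewrite Lim_seq_const|].
  intros n; rewrite approx_eq; unfold Rdiv; rewrite Rmult_0_l.
  assert (H := nf_spec 0 (Rle_refl 0)).
  replace (nf 0) with O; [reflexivity|].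
  symmetry; apply INR_eq; simpl; generalize (pos_INR (nf 0)); lra.
Qed.

Let M' (T : R) : R := Mt T + c_grow * (Mt T + 1).

Definition c_flow (T : R) : R :=
  c_cons (lip_at M0 T) * exp (c_stab (lip_at M0 T + c_grow * (lip_at M0 T + 1))).

(** At level [k] the two times are separated by [m] grid steps of total length [z], with [z] within
    one step of [s]. Comparing iteration with one step of length [z] gives the error z^2; replacing
    [z] by [s], and approximants by the limit, costs terms that vanish with the level. *)
Lemma flow_step t s T : 0 <= t -> 0 <= s -> s <= tau0 / 2 -> t + s <= T ->
  near (c_flow T * (s * s)) (flow (t + s)) (step K s (flow t)).
Proof.
  intros Ht Hs Hs' HT x.
  assert (HM := Mt_nonneg T); assert (Hgr := c_grow_nonneg rho0 Hrho0).
  assert (HM' : 0 <= M' T) by (unfold M'; nra).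
  assert (Hco := c_cons_nonneg rho0 _ Hrho0 HM).
  assert (Hcf : 0 <= c_flow T) by (apply Rmult_le_pos; [exact Hco | apply Rlt_le, exp_pos]).
  assert (Hmv := c_move_nonneg rho0 _ Hrho0 HM').
  assert (Ht01 := tau0_bounds).
  set (c1 := c_cons (Mt T) + c_move (M' T)).
  assert (Hc1 : 0 <= c1) by (unfold c1; lra).
  apply le_of_geom with (2 * c_cauchy T + 3 * c_flow T + c1 + (1 + s * c_stab (Mt T)) * (2 * c_cauchy T)).
  (* One level is skipped so that [tau k <= tau0 / 2]; together with [s <= tau0 / 2] this keeps the
     length [z] admissible. *)
  intros n; set (k := S n).
  assert (Hk := tau_bounds k).
  assert (Hk2 : tau k <= (/ 2) ^ n /\ tau k <= tau0 / 2).
  { assert (H5 := half_pow_bounds n); unfold k, tau; simpl; nra. }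
  assert (Hp : 0 < (/ 2) ^ n) by apply half_pow_bounds.
  assert (B1 := approx_flow k (t + s) T ltac:(lra) x).
  assert (B2 := approx_flow k t T ltac:(lra)).
  assert (Hkn : (/ 2) ^ k = (/ 2) ^ n / 2) by (unfold k; simpl; field).
  destruct (nf_scale t (tau k)) as [N1 N2]; try lra.
  destruct (nf_scale (t + s) (tau k)) as [N3 N4]; try lra.
  assert (E1 := approx_eq k t); assert (E2 := approx_eq k (t + s)).
  set (n1 := nf (t / tau k)) in *; set (n2 := nf ((t + s) / tau k)) in *.
  assert (Hn : (n1 <= n2)%nat).
  { assert (n1 < n2 + 1)%nat; [|lia]. apply INR_lt; rewrite plus_INR; simpl.
    apply Rmult_lt_reg_r with (tau k); lra. }
  set (m := (n2 - n1)%nat).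
  assert (Hm : INR m * tau k = INR n2 * tau k - INR n1 * tau k).
  { unfold m; rewrite minus_INR by exact Hn; ring. }
  assert (Em : approx k (t + s) = Nat.iter m (step K (tau k)) (approx k t)).
  { rewrite E1, E2; replace n2 with (m + n1)%nat by (unfold m; lia).
    apply Nat.iter_add. }
  set (z := INR m * tau k) in *.
  assert (Hz0 : 0 <= z) by (apply Rmult_le_pos; [apply pos_INR | lra]).
  assert (Sz : small z) by (apply small_le with tau0; [auto | lra | apply A_ge0 | apply small_tau0]).
  assert (Ss : small s) by (apply small_le with tau0; [auto | lra | apply A_ge0 | apply small_tau0]).
  assert (Ha := approx_adm k t); assert (Hl := approx_lip k t T ltac:(lra)).
  assert (B3 : Rabs (approx k (t + s) x - step K z (approx k t) x) <= c_flow T * (z * z)).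
  { rewrite Em; apply iter_vs_step; auto; lra. }
  assert (B4 : Rabs (step K z (approx k t) x - step K s (approx k t) x) <= c1 * tau k).
  { destruct (Rle_dec z s) as [Hzs|Hzs].
    - eapply Rle_trans; [apply step_time with (M := Mt T); auto|]. fold (M' T); fold c1.
      apply Rmult_le_compat_l; auto; lra.
    - rewrite Rabs_minus_sym; eapply Rle_trans; [apply step_time with (M := Mt T); auto; lra|].
      fold (M' T); fold c1. apply Rmult_le_compat_l; auto; lra. }
  assert (B5 : Rabs (step K s (approx k t) x - step K s (flow t) x)
            <= (1 + s * c_stab (Mt T)) * (2 * c_cauchy T * (/ 2) ^ k)).
  { apply step_stable; auto; [apply flow_adm; auto | apply flow_lip; lra]. }
  assert (Hzz : z * z <= s * s + 3 * (/ 2) ^ n).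
  { assert (z <= s + tau k) by lra. assert (z * z <= (s + tau k) * (s + tau k)) by nra. nra. }
  assert (B6 : c_flow T * (z * z) <= c_flow T * (s * s + 3 * (/ 2) ^ n)) by (apply Rmult_le_compat_l; auto).
  assert (B7 : c1 * tau k <= c1 * (/ 2) ^ n) by (apply Rmult_le_compat_l; lra).
  assert (Hcy : 0 <= c_cauchy T).
  { assert (B8 := Rabs_pos (approx k (t + s) x - flow (t + s) x)).
    apply Rmult_le_reg_r with ((/ 2) ^ k); [apply half_pow_bounds|]; lra. }
  assert (Hst : 0 <= (1 + s * c_stab (Mt T)) * (2 * c_cauchy T)).
  { apply Rmult_le_pos; [|lra]. assert (Hst := c_stab_nonneg rho0 _ Hrho0 HM). nra. }
  rewrite Hkn in *.
  apply Rabs_le_between in B1; apply Rabs_le_between in B3.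
  apply Rabs_le_between in B4; apply Rabs_le_between in B5.
  assert (0 <= (1 + s * c_stab (Mt T)) * (2 * c_cauchy T) * (/ 2) ^ n) by (apply Rmult_le_pos; lra).
  assert (0 <= c_cauchy T * (/ 2) ^ n) by (apply Rmult_le_pos; lra).
  apply Rabs_le; lra.
Qed.

(** * Time derivative of the limit and joint continuity of the derivatives *)

Definition rate (t x : R) : R :=
  - (Derive (flow t) x * K (flow t) x + flow t x * Derive (K (flow t)) x).

Definition c_taylor (T : R) : R :=
  c_flow T + 2 * lip2_at M0 M20 T * (vmax * vmax)
  + (lip_at M0 T * A + hi * c_vel (lip_at M0 T)) * vmax.

(** Expands the step in [flow_step] at [x]. Besides the error of that lemma, [c_taylor] collects the
    second-order remainder of the density at the foot, where [lip2] is used, and the variation of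
    density times velocity derivative between the foot and [x]. *)
Lemma flow_taylor t s x T : 0 <= t -> 0 <= s -> s <= tau0 / 2 -> t + s <= T ->
  Rabs (flow (t + s) x - flow t x - s * rate t x) <= c_taylor T * (s * s).
Proof.
  intros Ht Hs Hs' HT.
  assert (H1 := flow_step t s T Ht Hs Hs' HT x).
  assert (Ha := flow_adm t Ht).
  assert (Hl := flow_lip t T ltac:(lra)); assert (Hl2 := flow_lip2 t T ltac:(lra)).
  destruct (lip2_derive _ _ _ Hl Hl2) as [_ [_ [_ HT2]]].
  assert (HM := Mt_nonneg T); assert (HM2 := lip2_nonneg _ _ Hl2).
  assert (Hv := tame_bound _ _ _ _ _ _ _ _ HK (flow t) x (proj1 Ha)).
  assert (Hwl : lip (Mt T * A + hi * c_vel (Mt T)) (fun y => flow t y * Derive (K (flow t)) y)).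
  { apply lip_mult; auto.
    - exact (tame_lip _ _ _ _ _ _ _ _ HK lo hi _ _ Hlo (proj1 Ha) (proj2 Ha) Hl).
    - apply adm_abs, Ha.
    - apply vel_der_abs, Ha. }
  assert (Hwc := lip_nonneg _ _ Hwl).
  unfold step, weight in H1; unfold rate.
  set (v := K (flow t) x) in *; set (y := x - s * v) in *.
  assert (Hsv : 0 <= s * v <= s * vmax) by nra.
  assert (H2 := HT2 x (- (s * v))); replace (x + - (s * v)) with y in H2 by (unfold y; ring).
  assert (H3 := Hwl y x); cbv beta in H3.
  replace (Rabs (y - x)) with (s * v) in H3
    by (unfold y; replace (x - s * v - x) with (- (s * v)) by ring; rewrite Rabs_Ropp, Rabs_pos_eq; lra).
  assert (H4 : 2 * M2t T * (- (s * v) * - (s * v)) <= 2 * M2t T * (vmax * vmax) * (s * s)).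
  { rewrite (Rmult_assoc (2 * M2t T)); apply Rmult_le_compat_l; [lra|]; nra. }
  assert (H5 : (Mt T * A + hi * c_vel (Mt T)) * (s * v) <= (Mt T * A + hi * c_vel (Mt T)) * (s * vmax))
    by (apply Rmult_le_compat_l; lra).
  set (w := Derive (K (flow t))) in *; set (D := Derive (flow t) x) in *.
  set (q := flow t y * w y - flow t x * w x) in *.
  assert (H6 : Rabs (s * q) <= s * ((Mt T * A + hi * c_vel (Mt T)) * (s * vmax))).
  { rewrite Rabs_mult, (Rabs_pos_eq s Hs); apply Rmult_le_compat_l; lra. }
  apply Rabs_le_between in H1; apply Rabs_le_between in H2; apply Rabs_le_between in H6.
  unfold c_taylor; fold (Mt T) (M2t T).
  assert (E : flow (t + s) x - flow t x - s * - (D * v + flow t x * w x)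
    = (flow (t + s) x - flow t y * (1 - s * w y)) + (flow t y - flow t x - - (s * v) * D) - s * q)
    by (unfold q; ring).
  rewrite E; apply Rabs_le; lra.
Qed.

Definition c_time (T : R) : R := c_flow T + c_move (lip_at M0 T).

Lemma flow_time t s T : 0 <= t -> 0 <= s -> s <= tau0 / 2 -> t + s <= T ->
  near (c_time T * s) (flow (t + s)) (flow t).
Proof.
  intros Ht Hs Hs' HT; destruct tau0_bounds as [B1 B2].
  assert (HM := Mt_nonneg T); assert (Hco := c_cons_nonneg rho0 _ Hrho0 HM).
  assert (Hcf : 0 <= c_flow T) by (apply Rmult_le_pos; [exact Hco | apply Rlt_le, exp_pos]).
  assert (Ss : small s) by (apply small_le with tau0; [auto | lra | apply A_ge0 | apply small_tau0]).
  eapply near_le; [apply near_trans with (step K s (flow t))|].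
  - apply flow_step with (T := T); auto.
  - apply step_near with (M := Mt T); auto; [apply flow_adm; auto | apply flow_lip; lra].
  - unfold c_time; fold (Mt T).
    assert (c_flow T * (s * s) <= c_flow T * s) by (apply Rmult_le_compat_l; [auto | nra]). lra.
Qed.

Lemma flow_time_abs t t' T : 0 <= t <= T -> 0 <= t' <= T -> Rabs (t' - t) <= tau0 / 2 ->
  near (c_time T * Rabs (t' - t)) (flow t') (flow t).
Proof.
  intros Ht Ht' Hd; destruct (Rle_dec t t') as [H|H].
  - rewrite Rabs_pos_eq in * by lra.
    assert (F := flow_time t (t' - t) T ltac:(lra) ltac:(lra) Hd ltac:(lra)).
    replace (t + (t' - t)) with t' in F by ring; exact F.
  - rewrite Rabs_minus_sym in *; rewrite Rabs_pos_eq in * by lra; apply near_sym.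
    assert (F := flow_time t' (t - t') T ltac:(lra) ltac:(lra) Hd ltac:(lra)).
    replace (t' + (t - t')) with t in F by ring; exact F.
Qed.

(** Time variation passes through [Q] in the sup norm, space variation is Lipschitz at the fixed
    time. It is applied to the density, the velocity and the velocity derivative. *)
Lemma jcont_profile (Q : (R -> R) -> R -> R) B C1 t x : 0 <= t -> 0 <= B ->
  (forall f g d, adm f -> adm g -> near d f g -> near (B * d) (Q f) (Q g)) ->
  lip C1 (Q (flow t)) -> jcont (fun t => Q (flow t)) t x.
Proof.
  intros Ht HB HQ Hl; assert (HC1 := lip_nonneg _ _ Hl).
  destruct tau0_bounds as [B1 B2].
  apply jcont_lip with (C := B * c_time (t + 1) + C1) (d0 := tau0 / 2); [lra|].
  intros t' x' Ht' H1 H2.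
  assert (Ht1 : t' <= t + 1) by (apply Rabs_def2 in H1; lra).
  assert (Hn := flow_time_abs t t' (t + 1) ltac:(lra) ltac:(lra) ltac:(lra)).
  assert (H0 := near_nonneg _ _ _ Hn).
  assert (E1 := HQ _ _ _ (flow_adm t' Ht') (flow_adm t Ht) Hn x').
  assert (E2 := Hl x' x).
  assert (P1 := Rabs_pos (t' - t)); assert (P2 := Rabs_pos (x' - x)).
  replace (Q (flow t') x' - Q (flow t) x) with
    ((Q (flow t') x' - Q (flow t) x') + (Q (flow t) x' - Q (flow t) x)) by ring.
  eapply Rle_trans; [apply Rabs_triang|].
  destruct (Req_dec (t' - t) 0) as [Hz|Hz].
  - rewrite Hz, Rabs_R0, Rmult_0_r, Rmult_0_r in E1; rewrite Hz, Rabs_R0.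
    assert (Hct : 0 <= c_time (t + 1)).
    { unfold c_time; apply Rplus_le_le_0_compat.
      - apply Rmult_le_pos; [apply c_cons_nonneg with rho0 | apply Rlt_le, exp_pos]; auto; apply Mt_nonneg.
      - apply c_move_nonneg with rho0; auto; apply Mt_nonneg. }
    assert (0 <= B * c_time (t + 1)) by (apply Rmult_le_pos; auto).
    nra.
  - assert (Hct : 0 <= c_time (t + 1)).
    { apply Rmult_le_reg_r with (Rabs (t' - t)); [apply Rabs_pos_lt, Hz | lra]. }
    assert (0 <= B * c_time (t + 1)) by (apply Rmult_le_pos; auto). nra.
Qed.

Lemma jcont_flow t x : 0 <= t -> jcont flow t x.
Proof.
  intros Ht; apply (jcont_profile (fun f => f) 1 (Mt t)); auto; [lra | | apply flow_lip; lra].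
  intros f g d _ _ H y; rewrite Rmult_1_l; apply H.
Qed.

Lemma jcont_vel t x : 0 <= t -> jcont (fun t => K (flow t)) t x.
Proof.
  intros Ht; apply (jcont_profile K L A); auto.
  - apply (tame_L _ _ _ _ _ _ _ _ HK).
  - intros f g d [F1 F2] [G1 G2] H.
    exact (tame_sup _ _ _ _ _ _ _ _ HK lo hi d f g Hlo F1 G1 F2 G2 H).
  - apply vel_lip, flow_adm, Ht.
Qed.

Lemma jcont_vel_der t x : 0 <= t -> jcont (fun t => Derive (K (flow t))) t x.
Proof.
  intros Ht; assert (Hh := adm_hi rho0 Hrho0); assert (Ha := flow_adm t Ht).
  apply (jcont_profile (fun f => Derive (K f)) (Gam hi) (c_vel (Mt t))); auto.
  - apply (tame_Gam _ _ _ _ _ _ _ _ HK); lra.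
  - intros f g d [F1 F2] [G1 G2] H.
    exact (tame_der _ _ _ _ _ _ _ _ HK lo hi d f g Hlo F1 G1 F2 G2 H).
  - refine (tame_lip _ _ _ _ _ _ _ _ HK lo hi _ _ Hlo (proj1 Ha) (proj2 Ha) _).
    apply flow_lip; lra.
Qed.

(** Differentiation is not Lipschitz for the sup norm, so [jcont_profile] does not apply; the
    uniform [lip2] bound and the interpolation estimate [derive_near] replace it. *)
Lemma jcont_flow_x t x : 0 <= t -> jcont (fun t => Derive (flow t)) t x.
Proof.
  intros Ht eps Heps; destruct tau0_bounds as [B1 B2].
  set (T := t + 1).
  assert (HM2 := lip2_nonneg _ _ (flow_lip2 t T ltac:(unfold T; lra))).
  (* The quotient length [s] is fixed first, to make [4 * M2t T * s] small; then [d1] bounds the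
     time variation divided by [s], and [d2] the displacement in space. *)
  set (s := eps / (16 * (M2t T + 1))).
  assert (Hs : 0 < s) by (apply Rdiv_lt_0_compat; lra).
  assert (Hs1 : 4 * M2t T * s <= eps / 4).
  { replace (eps / 4) with (4 * (M2t T + 1) * s) by (unfold s; field; lra).
    apply Rmult_le_compat_r; lra. }
  set (Hc := Rabs (c_time T)); assert (HHc := Rabs_pos (c_time T)); fold Hc in HHc.
  assert (HHc' : c_time T <= Hc) by apply Rle_abs.
  set (d1 := s * eps / (8 * (Hc + 1))).
  assert (Hd1 : 0 < d1) by (apply Rdiv_lt_0_compat; nra).
  set (d2 := eps / (4 * (M2t T + 1))).
  assert (Hd2 : 0 < d2) by (apply Rdiv_lt_0_compat; lra).
  exists (Rmin (tau0 / 2) (Rmin d1 d2)); split; [repeat apply Rmin_glb_lt; lra|].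
  intros t' x' Ht' Hta Hxb.
  assert (Hm1 := Rmin_l (tau0 / 2) (Rmin d1 d2)); assert (Hm2 := Rmin_r (tau0 / 2) (Rmin d1 d2)).
  assert (Hm3 := Rmin_l d1 d2); assert (Hm4 := Rmin_r d1 d2).
  assert (Ht1 : t' <= T) by (unfold T; apply Rabs_def2 in Hta; lra).
  assert (Ht2 : t <= T) by (unfold T; lra).
  assert (Hn := flow_time_abs t t' T ltac:(lra) ltac:(lra) ltac:(lra)).
  assert (E1 := derive_near _ _ _ _ _ s x' (flow_lip t' T ltac:(lra)) (flow_lip2 t' T ltac:(lra))
                  (flow_lip t T ltac:(lra)) (flow_lip2 t T ltac:(lra)) Hn Hs).
  destruct (lip2_derive _ _ _ (flow_lip t T ltac:(lra)) (flow_lip2 t T ltac:(lra))) as [_ [E2 _]].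
  specialize (E2 x' x).
  assert (P1 := Rabs_pos (t' - t)); assert (P2 := Rabs_pos (x' - x)).
  assert (E3 : 2 * (c_time T * Rabs (t' - t)) / s <= eps / 4).
  { apply Rmult_le_reg_r with s; auto.
    replace (2 * (c_time T * Rabs (t' - t)) / s * s) with (2 * (c_time T * Rabs (t' - t))) by (field; lra).
    assert (c_time T * Rabs (t' - t) <= (Hc + 1) * d1) by (apply Rle_trans with ((Hc + 1) * Rabs (t' - t)); nra).
    assert ((Hc + 1) * d1 = s * eps / 8) by (unfold d1; field; lra). lra. }
  assert (E4 : M2t T * Rabs (x' - x) <= eps / 4).
  { replace (eps / 4) with ((M2t T + 1) * d2) by (unfold d2; field; lra).
    apply Rmult_le_compat; lra. }
  replace (Derive (flow t') x' - Derive (flow t) x) with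
    ((Derive (flow t') x' - Derive (flow t) x') + (Derive (flow t) x' - Derive (flow t) x)) by ring.
  eapply Rle_lt_trans; [apply Rabs_triang|]; lra.
Qed.

Lemma jcont_rate t x : 0 <= t -> jcont rate t x.
Proof.
  intros Ht.
  apply (jcont_opp (fun t x => Derive (flow t) x * K (flow t) x + flow t x * Derive (K (flow t)) x)).
  apply (jcont_plus (fun t x => Derive (flow t) x * K (flow t) x)
           (fun t x => flow t x * Derive (K (flow t)) x)).
  - apply (jcont_mult (fun t => Derive (flow t)) (fun t => K (flow t)));
      [apply jcont_flow_x | apply jcont_vel]; auto.
  - apply (jcont_mult flow (fun t => Derive (K (flow t))));
      [apply jcont_flow | apply jcont_vel_der]; auto.
Qed.

Lemma flow_derive_right t x eps : 0 <= t -> 0 < eps -> exists d, 0 < d /\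
  forall s, 0 <= s -> s < d -> Rabs (flow (t + s) x - flow t x - s * rate t x) <= eps * s.
Proof.
  intros Ht Heps; destruct tau0_bounds as [B1 B2].
  set (k := Rabs (c_taylor (t + 1))); assert (Hk := Rabs_pos (c_taylor (t + 1))); fold k in Hk.
  assert (Hk' : c_taylor (t + 1) <= k) by apply Rle_abs.
  exists (Rmin (tau0 / 2) (eps / (k + 1))); split.
  { apply Rmin_glb_lt; [lra | apply Rdiv_lt_0_compat; lra]. }
  intros s Hs Hsd.
  assert (Hm1 := Rmin_l (tau0 / 2) (eps / (k + 1))); assert (Hm2 := Rmin_r (tau0 / 2) (eps / (k + 1))).
  eapply Rle_trans; [apply flow_taylor with (T := t + 1); lra|].
  assert ((k + 1) * s <= eps).
  { replace eps with ((k + 1) * (eps / (k + 1))) by (field; lra). apply Rmult_le_compat_l; lra. }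
  rewrite <- Rmult_assoc; apply Rmult_le_compat_r; auto. nra.
Qed.

(** For negative increments the expansion is made at the earlier time, forward to [t], and
    continuity of [rate] brings its coefficient back to time [t]. *)
Lemma flow_derive_t t x : 0 < t -> is_derive (fun t => flow t x) t (rate t x).
Proof.
  intros Ht; apply is_derive_eps; intros eps Heps; destruct tau0_bounds as [B1 B2].
  destruct (flow_derive_right t x eps ltac:(lra) Heps) as [d1 [Hd1 H1]].
  destruct (jcont_rate t x ltac:(lra) (eps / 2) ltac:(lra)) as [d2 [Hd2 H2]].
  set (k := Rabs (c_taylor (t + 1))); assert (Hk := Rabs_pos (c_taylor (t + 1))); fold k in Hk.
  assert (Hk' : c_taylor (t + 1) <= k) by apply Rle_abs.
  set (d3 := eps / (2 * (k + 1))).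
  assert (Hd3 : 0 < d3) by (apply Rdiv_lt_0_compat; lra).
  exists (Rmin (Rmin d1 d2) (Rmin (Rmin t (tau0 / 2)) d3)); split; [repeat apply Rmin_glb_lt; lra|].
  intros h Hh.
  assert (Hr : h < d1 /\ Rabs h < d2 /\ Rabs h < t /\ Rabs h < tau0 / 2 /\ Rabs h < d3).
  { assert (m1 := Rmin_l (Rmin d1 d2) (Rmin (Rmin t (tau0 / 2)) d3)).
    assert (m2 := Rmin_r (Rmin d1 d2) (Rmin (Rmin t (tau0 / 2)) d3)).
    assert (m3 := Rmin_l d1 d2). assert (m4 := Rmin_r d1 d2).
    assert (m5 := Rmin_l (Rmin t (tau0 / 2)) d3). assert (m6 := Rmin_r (Rmin t (tau0 / 2)) d3).
    assert (m7 := Rmin_l t (tau0 / 2)). assert (m8 := Rmin_r t (tau0 / 2)).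
    assert (m9 := Rle_abs h). lra. }
  destruct Hr as [R1 [R2 [R3 [R4 R5]]]].
  destruct (Rle_dec 0 h) as [Hp|Hp].
  - rewrite (Rabs_pos_eq h Hp); apply H1; auto.
  - assert (Eh : h = - (- h)) by ring; rewrite Eh in *; clear Eh.
    generalize dependent (- h); intros s; intros; clear h.
    rewrite Rabs_Ropp, (Rabs_pos_eq s) in * by lra.
    assert (E1 := flow_taylor (t + - s) s x (t + 1) ltac:(lra) ltac:(lra) ltac:(lra) ltac:(lra)).
    replace (t + - s + s) with t in E1 by ring.
    assert (E2 : Rabs (rate (t + - s) x - rate t x) < eps / 2).
    { apply H2; try lra.
      - replace (t + - s - t) with (- s) by ring; rewrite Rabs_Ropp, Rabs_pos_eq; lra.
      - rewrite Rminus_diag, Rabs_R0; lra. }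
    assert (E3 : c_taylor (t + 1) * (s * s) <= eps / 2 * s).
    { rewrite <- Rmult_assoc; apply Rmult_le_compat_r; [lra|].
      replace (eps / 2) with ((k + 1) * d3) by (unfold d3; field; lra).
      apply Rle_trans with ((k + 1) * s); [nra|]. apply Rmult_le_compat_l; lra. }
    apply Rabs_le_between in E1; apply Rabs_def2 in E2.
    assert (D1 : s * (rate (t + - s) x - rate t x) <= s * (eps / 2)) by (apply Rmult_le_compat_l; lra).
    assert (D2 : s * - (eps / 2) <= s * (rate (t + - s) x - rate t x)) by (apply Rmult_le_compat_l; lra).
    rewrite Rmult_minus_distr_l in D1, D2; apply Rabs_le; lra.
Qed.

Lemma flow_derive_0 x :
  filterlim (fun s => (flow s x - flow 0 x) / s) (at_right 0) (locally (rate 0 x)).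
Proof.
  apply filterlim_locally; intros [eps Heps].
  destruct (flow_derive_right 0 x (eps / 2) (Rle_refl 0) ltac:(lra)) as [d [Hd H]].
  exists (mkposreal d Hd); intros s Hs Hs0.
  assert (Hs' : Rabs (s - 0) < d) by exact Hs.
  rewrite Rminus_0_r, Rabs_pos_eq in Hs' by lra.
  specialize (H s ltac:(lra) Hs'); rewrite Rplus_0_l in H.
  change (Rabs ((flow s x - flow 0 x) / s - rate 0 x) < eps).
  replace ((flow s x - flow 0 x) / s - rate 0 x) with ((flow s x - flow 0 x - s * rate 0 x) / s)
    by (field; lra).
  unfold Rdiv at 1; rewrite Rabs_mult, Rabs_inv, (Rabs_pos_eq s) by lra.
  apply Rle_lt_trans with (eps / 2); [|lra].
  apply Rmult_le_reg_r with s; auto.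
  rewrite Rmult_assoc, Rinv_l, Rmult_1_r; lra.
Qed.

Theorem flow_solves : solves K rho0 flow.
Proof.
  exists rate, (fun t => Derive (flow t)).
  assert (HD : forall t, 0 <= t -> forall x, ex_derive (flow t) x).
  { intros t Ht; apply (lip2_derive (Mt t) (M2t t)); [apply flow_lip | apply flow_lip2]; lra. }
  split; [|split; [|split; [|split; [|split; [|split; [|split]]]]]].
  - intros t x Ht; apply Derive_correct, HD, Ht.
  - intros t x Ht; apply flow_derive_t, Ht.
  - apply flow_derive_0.
  - intros t x Ht eps Heps.
    destruct (jcont_rate t x Ht eps Heps) as [d1 [Hd1 H1]].
    destruct (jcont_flow_x t x Ht eps Heps) as [d2 [Hd2 H2]].
    exists (Rmin d1 d2); split; [apply Rmin_glb_lt; auto|]; intros t' x' Ht' Ha Hb.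
    assert (Hm := Rmin_l d1 d2); assert (Hm' := Rmin_r d1 d2).
    split; [apply H1 | apply H2]; lra.
  - intros t Ht; split; [|apply flow_adm, Ht].
    destruct (lip2_derive (Mt t) (M2t t) (flow t)) as [E1 [E2 _]];
      [apply flow_lip; lra | apply flow_lip2; lra|].
    split; [exact E1 | exists (M2t t); exact E2].
  - apply flow_0.
  - intros t x Ht; apply flow_adm, Ht.
  - intros t x Ht; rewrite Derive_mult.
    + unfold rate; ring.
    + apply HD, Ht.
    + apply (tame_C1 _ _ _ _ _ _ _ _ HK), flow_adm, Ht.
Qed.

End Step.

(** * Maximum principle and uniqueness *)

Lemma per_IZR (f : R -> R) : (forall x, f (x + 1) = f x) -> forall (n : Z) x, f (x + IZR n) = f x.
Proof.
  intros H n; induction n using Z.peano_ind; intros x.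
  - now rewrite Rplus_0_r.
  - rewrite succ_IZR, <- Rplus_assoc, H; auto.
  - rewrite <- (IHn x), <- Z.sub_1_r, minus_IZR, <- (H (x + (IZR n - 1))); f_equal; ring.
Qed.

Lemma per_reduce (f : R -> R) : (forall x, f (x + 1) = f x) ->
  forall x, let y := x - IZR (Int_part x) in 0 <= y < 1 /\ f x = f y.
Proof.
  intros H x y; destruct (base_Int_part x) as [H1 H2]; split; [unfold y; lra|].
  rewrite <- (per_IZR f H (Int_part x) y); f_equal; unfold y; ring.
Qed.

Lemma max01_spec f : (forall x, continuous f x) ->
  (exists x, 0 <= x <= 1 /\ max01 f = f x) /\ (forall y, 0 <= y <= 1 -> f y <= max01 f).
Proof.
  intros Hc; destruct (continuity_ab_maj f 0 1) as [x [Hx Hx1]]; [lra | |].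
  { intros y _; apply continuity_pt_filterlim, Hc. }
  assert (E : max01 f = f x).
  { unfold max01; rewrite (is_lub_Rbar_unique _ (f x)); [reflexivity|]; split.
    - intros z [y [Hy ->]]; exact (Hx y Hy).
    - intros b Hb; apply Hb; now exists x. }
  rewrite E; split; [now exists x | auto].
Qed.

Lemma min01_spec f : (forall x, continuous f x) ->
  (exists x, 0 <= x <= 1 /\ min01 f = f x) /\ (forall y, 0 <= y <= 1 -> min01 f <= f y).
Proof.
  intros Hc; destruct (continuity_ab_min f 0 1) as [x [Hx Hx1]]; [lra | |].
  { intros y _; apply continuity_pt_filterlim, Hc. }
  assert (E : min01 f = f x).
  { unfold min01; rewrite (is_glb_Rbar_unique _ (f x)); [reflexivity|]; split.
    - intros z [y [Hy ->]]; exact (Hx y Hy).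
    - intros b Hb; apply Hb; now exists x. }
  rewrite E; split; [now exists x | auto].
Qed.

Lemma Per1_inbox f : Per1 f -> 0 < min01 f /\ inbox (min01 f) (max01 f) f.
Proof.
  intros [Hc [Hp Hper]].
  destruct (max01_spec f Hc) as [_ H2]; destruct (min01_spec f Hc) as [[x [_ Hx]] H3].
  split; [rewrite Hx; apply Hp|]; intros y.
  destruct (per_reduce f Hper y) as [Hy E]; rewrite E.
  split; [apply H3 | apply H2]; lra.
Qed.

(** Periodicity reduces the strip to the compact set [0,T] x [0,1]. The maximum over space is
    continuous in time by uniform continuity, and is then maximised over time. *)
Lemma jcont_max F T : 0 <= T -> (forall t x, 0 <= t -> jcont F t x) ->
  (forall t x, 0 <= t -> F t (x + 1) = F t x) ->
  exists t x, 0 <= t <= T /\ forall t' x', 0 <= t' <= T -> F t' x' <= F t x.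
Proof.
  intros HT HF Hper.
  (* Clamping the time extends [F] from [0,T] to a function continuous on the whole plane. *)
  pose (cl := fun t => Rmax 0 (Rmin T t)).
  assert (Hcl : forall t, 0 <= cl t <= T).
  { intros t; unfold cl, Rmax, Rmin; repeat destruct Rle_dec; lra. }
  assert (Hid : forall t, 0 <= t <= T -> cl t = t).
  { intros t Ht; unfold cl, Rmax, Rmin; repeat destruct Rle_dec; lra. }
  assert (Hc1 : forall t t', Rabs (cl t' - cl t) <= Rabs (t' - t)).
  { intros t t'; unfold cl, Rmax, Rmin, Rabs; repeat destruct Rle_dec; repeat destruct Rcase_abs; lra. }
  assert (Hcx : forall t, 0 <= t -> forall x, continuous (F t) x).
  { intros t Ht x; apply continuous_eps; intros eps Heps.
    destruct (HF t x Ht eps Heps) as [d [Hd H]]; exists d; split; auto; intros y Hy.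
    apply H; auto; rewrite Rminus_diag, Rabs_R0; auto. }
  assert (H2d : forall t x, continuity_2d_pt (fun t x => F (cl t) x) t x).
  { intros t x eps; destruct (HF (cl t) x (proj1 (Hcl t)) eps (cond_pos eps)) as [d [Hd H]].
    exists (mkposreal d Hd); intros t' x' Ht' Hx'; simpl in *; apply H; auto; [apply Hcl|].
    eapply Rle_lt_trans; [apply Hc1 | auto]. }
  pose (m := fun t => max01 (F (cl t))).
  assert (Hmx : forall t, (exists x, 0 <= x <= 1 /\ m t = F (cl t) x) /\
                          forall y, 0 <= y <= 1 -> F (cl t) y <= m t).
  { intros t; apply max01_spec, Hcx, Hcl. }
  destruct (continuity_ab_maj m 0 T HT) as [t [Ht1 Ht2]].
  { intros t Ht; apply continuity_pt_locally; intros eps.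
    destruct (uniform_continuity_2d (fun t x => F (cl t) x) 0 T 0 1) with (eps := eps) as [d Hd].
    { intros; apply H2d. }
    exists d; intros t' Ht'.
    assert (Hdt : Rabs (cl t' - cl t) < d) by (eapply Rle_lt_trans; [apply Hc1 | exact Ht']).
    assert (Hu : forall y, 0 <= y <= 1 -> Rabs (F (cl t') y - F (cl t) y) < eps).
    { intros y Hy; generalize (Hd (cl t) y (cl t') y (Hcl t) Hy (Hcl t') Hy Hdt).
      rewrite (Hid (cl t')), (Hid (cl t)) by apply Hcl; intros HH; apply HH.
      rewrite Rminus_diag, Rabs_R0; apply cond_pos. }
    destruct (Hmx t) as [[x [Hx Ex]] Mx]; destruct (Hmx t') as [[x' [Hx' Ex']] Mx'].
    assert (Hua := Hu x Hx); assert (Hub := Hu x' Hx').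
    specialize (Mx x' Hx'); specialize (Mx' x Hx).
    apply Rabs_def2 in Hua; apply Rabs_def2 in Hub; apply Rabs_def1; lra. }
  destruct (Hmx t) as [[x [Hx Ex]] _].
  exists t, x; split; [exact Ht2|]; intros t' x' Ht'.
  specialize (Ht1 t' Ht'); destruct (Hmx t') as [_ Mx'].
  rewrite (Hid t) in Ex by auto; rewrite (Hid t') in Mx' by auto.
  destruct (per_reduce (F t') (fun x => Hper t' x (proj1 Ht')) x') as [Hy ->].
  specialize (Mx' (x' - IZR (Int_part x')) ltac:(lra)). lra.
Qed.

(** One-sided test for a maximum in time, which may sit at the final time, where only earlier times
    can be compared. *)
Lemma derive_ge0_of_left f x l d : is_derive f x l -> 0 < d ->
  (forall s, 0 < s < d -> f (x - s) <= f x) -> 0 <= l.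
Proof.
  intros Hf Hd Hs; apply Rnot_lt_le; intros HB.
  rewrite is_derive_eps in Hf.
  destruct (Hf (- l / 2)) as [d' [Hd' H]]; [lra|].
  pose (s := Rmin d d' / 2).
  assert (Hm : 0 < Rmin d d') by (apply Rmin_glb_lt; auto).
  assert (Rmin d d' <= d) by apply Rmin_l. assert (Rmin d d' <= d') by apply Rmin_r.
  assert (0 < s < d /\ s < d') as [Hs1 Hs2] by (unfold s; lra).
  specialize (Hs s Hs1); specialize (H (- s)); rewrite Rabs_Ropp, Rabs_pos_eq in H by lra.
  specialize (H Hs2); replace (x + - s) with (x - s) in H by ring.
  apply Rabs_le_between in H; nra.
Qed.

Lemma derive_zero_at_max f x l : is_derive f x l -> (forall y, f y <= f x) -> l = 0.
Proof.
  intros Hf Hm; apply Rle_antisym.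
  - apply (derive_le_of_slope f x l 0 1); auto; [lra|]; intros s _; specialize (Hm (x + s)); lra.
  - apply (derive_ge0_of_left f x l 1); auto; lra.
Qed.

(** Continuity of [u] itself is not a clause of [solves]. It is obtained along the segment in time
    at fixed [x], then along the segment in space at the new time, where the joint continuity of the
    space derivative gives a slope bound uniform in time. *)
Lemma solves_jcont K rho0 u : solves K rho0 u ->
  (forall t x, 0 <= t -> jcont u t x) /\ (forall t x, 0 <= t -> jcont (fun t => Derive (u t)) t x).
Proof.
  intros [ut [ux [Hx [Ht [H0 [Hc _]]]]]].
  assert (Ex : forall t x, 0 <= t -> Derive (u t) x = ux t x).
  { intros t x H; apply is_derive_unique, Hx, H. }
  assert (Jx : forall t x, 0 <= t -> jcont ux t x).
  { intros t x Htt eps Heps; destruct (Hc t x Htt eps Heps) as [d [Hd H]].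
    exists d; split; auto; intros t' x' Ht' Ha Hb; now apply H. }
  split.
  2:{ intros t x Htt eps Heps; destruct (Jx t x Htt eps Heps) as [d [Hd H]].
      exists d; split; auto; intros t' x' Ht' Ha Hb; rewrite !Ex; auto. }
  intros t x Htt eps Heps.
  assert (Hct : exists d, 0 < d /\ forall t', 0 <= t' -> Rabs (t' - t) < d -> Rabs (u t' x - u t x) < eps / 2).
  { destruct (Rle_lt_or_eq_dec 0 t Htt) as [Hp | <-].
    - assert (Hcc : continuous (fun t => u t x) t).
      { apply (ex_derive_continuous (fun t => u t x)); eexists; apply Ht, Hp. }
      rewrite continuous_eps in Hcc; destruct (Hcc (eps / 2)) as [d [Hd H]]; [lra|].
      exists d; split; auto.
    (* At time 0 only the right-hand quotient is known; being within 1 of its limit, it bounds the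
       increment by [q * t']. *)
    - specialize (H0 x); apply filterlim_locally with (eps := mkposreal 1 Rlt_0_1) in H0.
      destruct H0 as [d H].
      assert (Hq := Rabs_pos (ut 0 x)).
      set (q := Rabs (ut 0 x) + 1) in *.
      exists (Rmin d (eps / (2 * (q + 1)))); split.
      { apply Rmin_glb_lt; [apply cond_pos | apply Rdiv_lt_0_compat; unfold q; lra]. }
      intros t' Ht' Hd; rewrite Rminus_0_r, Rabs_pos_eq in Hd by auto.
      destruct (Rle_lt_or_eq_dec 0 t' Ht') as [Hp | <-]; [|rewrite Rminus_diag, Rabs_R0; lra].
      assert (m1 := Rmin_l d (eps / (2 * (q + 1)))); assert (m2 := Rmin_r d (eps / (2 * (q + 1)))).
      assert (Hb : Rabs ((u t' x - u 0 x) / t' - ut 0 x) < 1).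
      { apply (H t'); auto. change (Rabs (t' - 0) < d); rewrite Rminus_0_r, Rabs_pos_eq; lra. }
      assert (Hqq : Rabs ((u t' x - u 0 x) / t') <= q).
      { replace ((u t' x - u 0 x) / t') with ((u t' x - u 0 x) / t' - ut 0 x + ut 0 x) by ring.
        eapply Rle_trans; [apply Rabs_triang|]; unfold q; lra. }
      replace (u t' x - u 0 x) with ((u t' x - u 0 x) / t' * t') by (field; lra).
      rewrite Rabs_mult, (Rabs_pos_eq t') by auto.
      apply Rle_lt_trans with (q * t'); [apply Rmult_le_compat_r; auto|].
      apply Rle_lt_trans with ((q + 1) * t'); [nra|].
      replace (eps / 2) with ((q + 1) * (eps / (2 * (q + 1)))) by (unfold q; field; lra).
      apply Rmult_lt_compat_l; [unfold q|]; lra. }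
  destruct Hct as [d1 [Hd1 H1]].
  destruct (Jx t x Htt 1 Rlt_0_1) as [d2 [Hd2 H2]].
  set (q := Rabs (ux t x) + 1); assert (Hq := Rabs_pos (ux t x)).
  set (d3 := eps / (2 * (q + 1))).
  assert (Hd3 : 0 < d3) by (apply Rdiv_lt_0_compat; unfold q; lra).
  exists (Rmin d1 (Rmin d2 d3)); split; [repeat apply Rmin_glb_lt; auto|].
  intros t' x' Ht' Ha Hb.
  assert (m1 := Rmin_l d1 (Rmin d2 d3)); assert (m2 := Rmin_r d1 (Rmin d2 d3)).
  assert (m3 := Rmin_l d2 d3); assert (m4 := Rmin_r d2 d3).
  specialize (H1 t' Ht' ltac:(lra)).
  destruct (MVT_cor4 (u t') (ux t') x (Rabs (x' - x))) with (b := x') as [z [Hz1 Hz2]].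
  { intros z _; apply Hx, Ht'. } { lra. }
  assert (Hz : Rabs (ux t' z) <= q).
  { specialize (H2 t' z Ht' ltac:(lra) ltac:(lra)).
    replace (ux t' z) with ((ux t' z - ux t x) + ux t x) by ring.
    eapply Rle_trans; [apply Rabs_triang|]; unfold q; lra. }
  replace (u t' x' - u t x) with ((u t' x' - u t' x) + (u t' x - u t x)) by ring.
  eapply Rle_lt_trans; [apply Rabs_triang|].
  assert (Rabs (u t' x' - u t' x) <= eps / 2); [|lra].
  rewrite Hz1, Rabs_mult.
  replace (eps / 2) with ((q + 1) * d3) by (unfold d3, q; field; lra).
  apply Rmult_le_compat; try apply Rabs_pos; lra.
Qed.

(** For an arbitrary solution the bounds come from compactness, not from a maximum principle; [lo]
    is a value that [u] attains, hence positive. *)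
Lemma solves_bounds K rho0 u T : 0 <= T -> solves K rho0 u -> exists lo hi M, 0 < lo /\
  forall t, 0 <= t <= T -> inbox lo hi (u t) /\ forall x, Rabs (Derive (u t) x) <= M.
Proof.
  intros HT Hu; destruct (solves_jcont _ _ _ Hu) as [J Jx].
  destruct Hu as [ut [ux [_ [_ [_ [_ [Hreg [_ [Hper _]]]]]]]]].
  assert (HperD : forall t x, 0 <= t -> Derive (u t) (x + 1) = Derive (u t) x).
  { intros t x Ht; apply Derive_periodic; intros y; auto. }
  destruct (jcont_max u T HT J Hper) as [t1 [x1 [_ B1]]].
  destruct (jcont_max (fun t x => - u t x) T HT) as [t2 [x2 [Ht2 B2]]].
  { intros t x Ht; apply jcont_opp, J, Ht. } { intros t x Ht; now rewrite Hper. }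
  destruct (jcont_max (fun t => Derive (u t)) T HT Jx HperD) as [t3 [x3 [_ B3]]].
  destruct (jcont_max (fun t x => - Derive (u t) x) T HT) as [t4 [x4 [_ B4]]].
  { intros t x Ht; apply (jcont_opp (fun t => Derive (u t))), Jx, Ht. } { intros t x Ht; now rewrite HperD. }
  exists (u t2 x2), (u t1 x1), (Rmax (Derive (u t3) x3) (- Derive (u t4) x4)); split.
  { apply (Hreg t2); lra. }
  intros t Ht; split.
  - intros x; specialize (B1 t x Ht); specialize (B2 t x Ht); cbv beta in B2; lra.
  - intros x; specialize (B3 t x Ht); specialize (B4 t x Ht); cbv beta in B3, B4.
    assert (m1 := Rmax_l (Derive (u t3) x3) (- Derive (u t4) x4)).
    assert (m2 := Rmax_r (Derive (u t3) x3) (- Derive (u t4) x4)).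
    apply Rabs_le; lra.
Qed.

(** The three terms below [lam] bound what the difference of the two equations leaves once the space
    derivatives agree: velocity difference times slope, difference of densities times velocity
    derivative, and density times difference of velocity derivatives. *)
Lemma no_positive_max K vmax L c C gam Gam W rho0 u u' lo hi M T lam t x :
  tame K vmax L c C gam Gam W -> solves K rho0 u -> solves K rho0 u' ->
  0 < lo -> 0 <= t <= T ->
  (forall t, 0 <= t <= T -> inbox lo hi (u t)) -> (forall t, 0 <= t <= T -> inbox lo hi (u' t)) ->
  (forall t x, 0 <= t <= T -> Rabs (Derive (u t) x) <= M) ->
  M * L + c * hi + hi * Gam hi < lam -> 0 < u t x - u' t x ->
  (forall t' x', 0 <= t' <= T ->
     exp (- lam * t') * Rabs (u t' x' - u' t' x') <= exp (- lam * t) * (u t x - u' t x)) -> False.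
Proof.
  intros HK Hu Hu' Hlo Ht Bu Bu' BM Hlam HD Hmax.
  destruct Hu as [ut [ux [Hx [Htt [_ [_ [Hreg [Hi [_ Heq]]]]]]]]].
  destruct Hu' as [ut' [ux' [Hx' [Htt' [_ [_ [Hreg' [Hi' [_ Heq']]]]]]]]].
  set (D := u t x - u' t x) in *.
  (* The initial data coincide, so a positive difference excludes time 0 and the two-sided time
     derivative is available. *)
  assert (Htp : 0 < t).
  { destruct (Rle_lt_or_eq_dec 0 t (proj1 Ht)) as [H|H]; auto.
    exfalso; unfold D in HD; rewrite <- H, Hi, Hi' in HD; lra. }
  assert (Hnear : near D (u t) (u' t)).
  { intros y; specialize (Hmax t y Ht); apply Rmult_le_reg_l with (2 := Hmax), exp_pos. }
  assert (Hp : ux t x - ux' t x = 0).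
  { apply (derive_zero_at_max (fun y => u t y - u' t y) x).
    - apply (is_derive_minus (u t) (u' t)); [apply Hx | apply Hx']; lra.
    - intros y; eapply Rle_trans; [apply Rle_abs | apply Hnear]. }
  assert (Hw : 0 <= exp (- lam * t) * (- lam) * (u t x - u' t x) + exp (- lam * t) * (ut t x - ut' t x)).
  { apply (derive_ge0_of_left (fun t => exp (- lam * t) * (u t x - u' t x)) t _ t); auto.
    - apply (is_derive_mult (fun t => exp (- lam * t)) (fun t => u t x - u' t x)).
      + auto_derive; [auto | ring].
      + apply (is_derive_minus (fun t => u t x) (fun t => u' t x)); [apply Htt | apply Htt']; auto.
      + intros; apply Rmult_comm.
    - intros s Hs; eapply Rle_trans; [|apply (Hmax (t - s) x); lra].
      apply Rmult_le_compat_l; [apply Rlt_le, exp_pos | apply Rle_abs]. }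
  assert (Pu := proj2 (Hreg t (proj1 Ht))); assert (Pu' := proj2 (Hreg' t (proj1 Ht))).
  assert (Ev : near (L * D) (K (u t)) (K (u' t))).
  { apply (tame_sup _ _ _ _ _ _ _ _ HK lo hi); auto. }
  assert (Ew : near (Gam hi * D) (Derive (K (u t))) (Derive (K (u' t)))).
  { apply (tame_der _ _ _ _ _ _ _ _ HK lo hi); auto. }
  assert (Ec := tame_comparison _ _ _ _ _ _ _ _ HK lo hi (u t) x Hlo Pu (Bu t Ht)).
  assert (Hdx : forall y, Derive (u t) y = ux t y) by (intros y; apply is_derive_unique, Hx, Ht).
  assert (Hdx' : forall y, Derive (u' t) y = ux' t y) by (intros y; apply is_derive_unique, Hx', Ht).
  assert (Q := Heq t x (proj1 Ht)); assert (Q' := Heq' t x (proj1 Ht)).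
  rewrite Derive_mult in Q;
    [|eexists; apply Hx, Ht | apply (tame_C1 _ _ _ _ _ _ _ _ HK); auto].
  rewrite Derive_mult in Q';
    [|eexists; apply Hx', Ht | apply (tame_C1 _ _ _ _ _ _ _ _ HK); auto].
  rewrite Hdx in Q; rewrite Hdx' in Q'.
  assert (BMx := BM t x Ht); rewrite Hdx in BMx.
  specialize (Ev x); specialize (Ew x).
  assert (Hb := Bu t Ht x); assert (Hb' := Bu' t Ht x).
  set (v := K (u t) x) in *; set (v' := K (u' t) x) in *.
  set (w := Derive (K (u t)) x) in *; set (w' := Derive (K (u' t)) x) in *.
  assert (Ed : ut t x - ut' t x = - (ux t x * (v - v')) - D * w - u' t x * (w - w')).
  { replace (ut t x) with (- (ux t x * v + u t x * w)) by lra.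
    replace (ut' t x) with (- (ux' t x * v' + u' t x * w')) by lra.
    replace (ux' t x) with (ux t x) by lra. unfold D; ring. }
  assert (T1 : Rabs (ux t x * (v - v')) <= M * (L * D)).
  { rewrite Rabs_mult; apply Rmult_le_compat; auto using Rabs_pos. }
  assert (T2 : - (D * w) <= D * (c * hi)).
  { assert (Hc := tame_c _ _ _ _ _ _ _ _ HK).
    assert (- w <= c * hi) by nra. nra. }
  assert (T3 : Rabs (u' t x * (w - w')) <= hi * (Gam hi * D)).
  { rewrite Rabs_mult; apply Rmult_le_compat; auto using Rabs_pos; rewrite Rabs_pos_eq; lra. }
  apply Rabs_le_between in T1; apply Rabs_le_between in T3.
  assert (T4 : ut t x - ut' t x < lam * D).
  { apply Rle_lt_trans with ((M * L + c * hi + hi * Gam hi) * D); [lra|].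
    apply Rmult_lt_compat_r; auto. }
  fold D in Hw; assert (He := exp_pos (- lam * t)). nra.
Qed.

Lemma solves_unique K vmax L c C gam Gam W rho0 u u' :
  tame K vmax L c C gam Gam W -> solves K rho0 u -> solves K rho0 u' ->
  forall t x, 0 <= t -> u' t x = u t x.
Proof.
  intros HK Hu Hu' T x0 HT.
  destruct (solves_bounds _ _ _ T HT Hu) as [lo1 [hi1 [M1 [Hl1 B1]]]].
  destruct (solves_bounds _ _ _ T HT Hu') as [lo2 [hi2 [M2 [Hl2 B2]]]].
  set (lo := Rmin lo1 lo2); set (hi := Rmax hi1 hi2); set (M := Rmax M1 M2).
  assert (Hlo : 0 < lo) by (apply Rmin_glb_lt; auto).
  assert (m1 := Rmin_l lo1 lo2); assert (m2 := Rmin_r lo1 lo2).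
  assert (m3 := Rmax_l hi1 hi2); assert (m4 := Rmax_r hi1 hi2).
  assert (m5 := Rmax_l M1 M2); assert (m6 := Rmax_r M1 M2).
  fold lo in m1, m2; fold hi in m3, m4; fold M in m5, m6.
  assert (Bu : forall t, 0 <= t <= T -> inbox lo hi (u t)).
  { intros t Ht y; destruct (B1 t Ht) as [E _]; specialize (E y); lra. }
  assert (Bu' : forall t, 0 <= t <= T -> inbox lo hi (u' t)).
  { intros t Ht y; destruct (B2 t Ht) as [E _]; specialize (E y); lra. }
  assert (BM : forall t y, 0 <= t <= T -> Rabs (Derive (u t) y) <= M).
  { intros t y Ht; destruct (B1 t Ht) as [_ E]; specialize (E y); lra. }
  assert (BM' : forall t y, 0 <= t <= T -> Rabs (Derive (u' t) y) <= M).
  { intros t y Ht; destruct (B2 t Ht) as [_ E]; specialize (E y); lra. }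
  set (lam := M * L + c * hi + hi * Gam hi + 1).
  assert (Hlam : M * L + c * hi + hi * Gam hi < lam) by (unfold lam; lra).
  destruct (solves_jcont _ _ _ Hu) as [J _]; destruct (solves_jcont _ _ _ Hu') as [J' _].
  assert (Hper : forall t x, 0 <= t -> u t (x + 1) = u t x).
  { destruct Hu as [? [? [_ [_ [_ [_ [_ [_ [H _]]]]]]]]]; exact H. }
  assert (Hper' : forall t x, 0 <= t -> u' t (x + 1) = u' t x).
  { destruct Hu' as [? [? [_ [_ [_ [_ [_ [_ [H _]]]]]]]]]; exact H. }
  destruct (jcont_max (fun t x => exp (- lam * t) * Rabs (u t x - u' t x)) T HT) as [t [x [Ht Hmax]]].
  - intros t x Ht; apply (jcont_mult (fun t _ => exp (- lam * t)) (fun t x => Rabs (u t x - u' t x))).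
    + intros eps Heps.
      assert (Hc : continuous (fun t => exp (- lam * t)) t).
      { apply (ex_derive_continuous (fun t => exp (- lam * t))); auto_derive; auto. }
      rewrite continuous_eps in Hc; destruct (Hc eps Heps) as [d [Hd H]].
      exists d; split; auto.
    + intros eps Heps.
      destruct (jcont_plus u (fun t x => - u' t x) t x (J t x Ht) (jcont_opp _ _ _ (J' t x Ht)) eps Heps)
        as [d [Hd H]].
      exists d; split; auto; intros t' x' Ht' Ha Hb.
      eapply Rle_lt_trans; [apply Rabs_triang_inv2|]; apply H; auto.
  - intros t x Ht; now rewrite Hper, Hper'.
  - cbv beta in Hmax; destruct (Req_dec (u' T x0) (u T x0)) as [He|Hne]; [exact He | exfalso].
    assert (Hpos : 0 < Rabs (u t x - u' t x)).
    { specialize (Hmax T x0 ltac:(lra)).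
      assert (0 < exp (- lam * T) * Rabs (u T x0 - u' T x0)).
      { apply Rmult_lt_0_compat; [apply exp_pos | apply Rabs_pos_lt; lra]. }
      assert (He := exp_pos (- lam * t)). assert (Hr := Rabs_pos (u t x - u' t x)). nra. }
    (* A negative extremum becomes positive after exchanging the two solutions; this is why bounds
       common to both were prepared. *)
    destruct (Rle_dec 0 (u t x - u' t x)) as [Hs|Hs].
    + rewrite (Rabs_pos_eq (u t x - u' t x)) in * by auto.
      eapply (no_positive_max K vmax L c C gam Gam W rho0 u u' lo hi M T lam t x); eauto.
    + rewrite (Rabs_left (u t x - u' t x)) in * by lra.
      eapply (no_positive_max K vmax L c C gam Gam W rho0 u' u lo hi M T lam t x); eauto; [lra|].
      intros t' x' Ht'; rewrite Rabs_minus_sym; eapply Rle_trans; [apply Hmax; auto|].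
      apply Rmult_le_compat_l; [apply Rlt_le, exp_pos | lra].
Qed.

(** * Passing to the limit on grids *)

(** Uniform over all natural [i], not only [i < N], so that sums of increments may run past the end
    of a period. *)
Definition grid_approx (v : R -> R) (k : nat -> nat -> R) : Prop :=
  forall eps, 0 < eps -> exists N0, forall N, (N0 <= N)%nat -> forall i,
    Rabs (v (INR i / INR N) - k N i) <= eps.

Lemma large_inv d : 0 < d -> exists N0, (0 < N0)%nat /\ forall N, (N0 <= N)%nat -> 0 < INR N /\ / INR N < d.
Proof.
  intros Hd; destruct (archimed_cor1 d Hd) as [N0 [H1 H2]]; exists N0; split; auto.
  intros N HN; assert (0 < INR N0) by (apply lt_0_INR; lia).
  assert (INR N0 <= INR N) by (apply le_INR; auto).
  split; [lra|]; eapply Rle_lt_trans; [apply Rinv_le_contravar|exact H1]; auto.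
Qed.

Lemma grid_near x N : 0 <= x -> 0 < INR N ->
  INR (nf (x * INR N)) / INR N <= x < INR (nf (x * INR N)) / INR N + / INR N.
Proof.
  intros Hx HN; destruct (nf_spec (x * INR N)) as [H1 H2]; [nra|].
  assert (Hi : 0 < / INR N) by (apply Rinv_0_lt_compat; auto).
  assert (E : x = x * INR N * / INR N) by (field; lra).
  split.
  - rewrite E at 2; apply Rmult_le_compat_r; lra.
  - rewrite E at 1; replace (INR (nf (x * INR N)) / INR N + / INR N)
      with ((INR (nf (x * INR N)) + 1) * / INR N) by (unfold Rdiv; ring).
    apply Rmult_lt_compat_r; lra.
Qed.

Lemma grid_value_le w k x B : (forall y, continuous w y) -> grid_approx w k -> 0 <= x ->
  (exists N1, forall N i, (N1 <= N)%nat -> k N i <= B) -> w x <= B.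
Proof.
  intros Hc Ha Hx [N1 HB]; apply le_epsilon; intros eps Heps.
  destruct (Ha (eps / 2)) as [N2 H2]; [lra|].
  destruct (proj1 (continuous_eps w x) (Hc x) (eps / 2)) as [d [Hd H]]; [lra|].
  destruct (large_inv d Hd) as [N3 [_ H3]].
  set (N := (N1 + N2 + N3)%nat).
  destruct (H3 N) as [P1 P2]; [unfold N; lia|].
  assert (G := grid_near x N Hx P1); set (i := nf (x * INR N)) in *.
  specialize (HB N i ltac:(unfold N; lia)); specialize (H2 N ltac:(unfold N; lia) i).
  specialize (H (INR i / INR N)).
  apply Rabs_le_between in H2.
  assert (Hlt : Rabs (INR i / INR N - x) < d) by (apply Rabs_def1; lra).
  specialize (H Hlt); apply Rabs_def2 in H; lra.
Qed.

Lemma grid_opp w k : grid_approx w k -> grid_approx (fun x => - w x) (fun N i => - k N i).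
Proof.
  intros H eps Heps; destruct (H eps Heps) as [N0 H0]; exists N0; intros N HN i.
  replace (- w (INR i / INR N) - - k N i) with (- (w (INR i / INR N) - k N i)) by ring.
  rewrite Rabs_Ropp; auto.
Qed.

Lemma grid_minus w k w' k' : grid_approx w k -> grid_approx w' k' ->
  grid_approx (fun x => w x - w' x) (fun N i => k N i - k' N i).
Proof.
  intros H H' eps Heps.
  destruct (H (eps / 2)) as [N0 H0]; [lra|]; destruct (H' (eps / 2)) as [N1 H1]; [lra|].
  exists (N0 + N1)%nat; intros N HN i.
  specialize (H0 N ltac:(lia) i); specialize (H1 N ltac:(lia) i).
  apply Rabs_le_between in H0; apply Rabs_le_between in H1; apply Rabs_le; lra.
Qed.

(** A translation by [r] is rounded to a whole number of grid steps; the Lipschitz bound makes the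
    rounding error O(1/N). *)
Lemma grid_shift_diff w k A r : lip A w -> grid_approx w k -> 0 <= r ->
  grid_approx (fun x => w (x + r) - w x) (fun N i => k N (i + nf (r * INR N))%nat - k N i).
Proof.
  intros Hl Ha Hr eps Heps; assert (HA := lip_nonneg _ _ Hl).
  destruct (Ha (eps / 4)) as [N0 H0]; [lra|].
  destruct (large_inv (eps / (2 * (A + 1)))) as [N1 [_ H1]]; [apply Rdiv_lt_0_compat; lra|].
  exists (N0 + N1)%nat; intros N HN i.
  destruct (H1 N ltac:(lia)) as [P1 P2].
  assert (G := grid_near r N Hr P1); set (m := nf (r * INR N)) in *.
  assert (E1 := H0 N ltac:(lia) i); assert (E2 := H0 N ltac:(lia) (i + m)%nat).
  assert (E3 : Rabs (w (INR i / INR N + r) - w (INR (i + m) / INR N)) <= eps / 2).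
  { eapply Rle_trans; [apply Hl|].
    replace (INR i / INR N + r - INR (i + m) / INR N) with (r - INR m / INR N)
      by (rewrite plus_INR; field; lra).
    rewrite Rabs_pos_eq by lra.
    replace (eps / 2) with ((A + 1) * (eps / (2 * (A + 1)))) by (field; lra).
    apply Rmult_le_compat; lra. }
  apply Rabs_le_between in E1; apply Rabs_le_between in E2; apply Rabs_le_between in E3.
  apply Rabs_le; lra.
Qed.

Lemma sum_incr_le (k : nat -> R) b i m : (forall j, (j < m)%nat -> k (S (i + j)) - k (i + j)%nat <= b) ->
  k (i + m)%nat - k i <= INR m * b.
Proof.
  induction m as [|m IH]; intros H.
  - rewrite Nat.add_0_r; simpl; lra.
  - rewrite Nat.add_succ_r, S_INR; specialize (H m (Nat.lt_succ_diag_r m)) as H'.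
    assert (k (i + m)%nat - k i <= INR m * b) by (apply IH; intros; apply H; lia). lra.
Qed.

Lemma sum_incr_abs (k : nat -> R) b : (forall j, Rabs (k (S j) - k j) <= b) ->
  forall i m, Rabs (k (i + m)%nat - k i) <= INR m * b.
Proof.
  intros H i m; apply Rabs_le; split.
  - assert (Sm := sum_incr_le (fun j => - k j) b i m); cbv beta in Sm.
    assert (- k (i + m)%nat - - k i <= INR m * b); [|lra].
    apply Sm; intros j _; specialize (H (i + j)%nat); apply Rabs_le_between in H; lra.
  - apply sum_incr_le; intros j _; eapply Rle_trans; [apply Rle_abs | apply H].
Qed.

(** About sN increments are summed, so the error of [grid_approx] enters only at the two ends, while
    the terms with [C0] add up to O(1/N). The margin [eta] is there because the first node used lies
    slightly to the left of [x]. *)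
Lemma grid_slope_le w k x s eta B C0 : (forall y, continuous w y) -> grid_approx w k ->
  0 <= x -> 0 <= s -> 0 < eta ->
  (exists N1, forall N i, (N1 <= N)%nat -> x - eta <= INR i / INR N <= x + s ->
     k N (S i) - k N i <= B * / INR N + C0 * (/ INR N * / INR N)) ->
  w (x + s) - w x <= B * s.
Proof.
  intros Hc Ha Hx Hs Heta [N1 HB]; apply le_epsilon; intros eps Heps.
  destruct (Ha (eps / 8)) as [N2 H2]; [lra|].
  destruct (proj1 (continuous_eps w x) (Hc x) (eps / 8)) as [d1 [Hd1 H3]]; [lra|].
  destruct (proj1 (continuous_eps w (x + s)) (Hc (x + s)) (eps / 8)) as [d2 [Hd2 H4]]; [lra|].
  (* Rounding [s] to the grid costs |B|/N and the quadratic terms cost |C0| s/N; [q / INR N]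
     dominates both. *)
  set (q := Rabs B + Rabs C0 * s + 1).
  assert (Hq : 0 < q) by (unfold q; generalize (Rabs_pos B) (Rabs_pos C0); nra).
  set (d := Rmin (Rmin d1 (d2 / 2)) (Rmin eta (eps / (2 * q)))).
  assert (Hd : 0 < d).
  { assert (0 < eps / (2 * q)) by (apply Rdiv_lt_0_compat; lra).
    unfold d; repeat apply Rmin_glb_lt; lra. }
  assert (Hdd : d <= d1 /\ d <= d2 / 2 /\ d <= eta /\ d <= eps / (2 * q)).
  { unfold d; assert (m1 := Rmin_l (Rmin d1 (d2 / 2)) (Rmin eta (eps / (2 * q)))).
    assert (m2 := Rmin_r (Rmin d1 (d2 / 2)) (Rmin eta (eps / (2 * q)))).
    assert (m3 := Rmin_l d1 (d2 / 2)); assert (m4 := Rmin_r d1 (d2 / 2)).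
    assert (m5 := Rmin_l eta (eps / (2 * q))); assert (m6 := Rmin_r eta (eps / (2 * q))). lra. }
  destruct Hdd as [D1 [D2 [D3 D4]]].
  destruct (large_inv d Hd) as [N3 [_ HN3]].
  set (N := (N1 + N2 + N3)%nat).
  destruct (HN3 N) as [P1 P2]; [unfold N; lia|].
  set (h := / INR N) in *.
  assert (Hh : 0 < h) by (apply Rinv_0_lt_compat; auto).
  assert (G := grid_near x N Hx P1); set (i := nf (x * INR N)) in *.
  assert (G' := grid_near s N Hs P1); set (m := nf (s * INR N)) in *.
  fold h in G, G'.
  assert (Ep : INR (i + m) / INR N = INR i / INR N + INR m / INR N) by (rewrite plus_INR; field; lra).
  assert (S1 : k N (i + m)%nat - k N i <= INR m * (B * h + C0 * (h * h))).
  { apply (sum_incr_le (k N)); intros j Hj; apply HB; [unfold N; lia|].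
    assert (Ej : INR (i + j) / INR N = INR i / INR N + INR j / INR N) by (rewrite plus_INR; field; lra).
    rewrite Ej.
    assert (0 <= INR j / INR N <= INR m / INR N).
    { split; [apply Rmult_le_pos; [apply pos_INR | apply Rlt_le; exact Hh]|].
      apply Rmult_le_compat_r; [apply Rlt_le; exact Hh|]. apply le_INR; lia. }
    lra. }
  assert (S2 : INR m * (B * h + C0 * (h * h)) <= B * s + eps / 2).
  { set (z := INR m / INR N) in *.
    replace (INR m * (B * h + C0 * (h * h))) with (B * z + C0 * (z * h)) by (unfold z, h, Rdiv; ring).
    assert (Hz0 : 0 <= z) by (apply Rmult_le_pos; [apply pos_INR | apply Rlt_le; exact Hh]).
    assert (F1 : B * z <= B * s + Rabs B * h).
    { assert (Hb := Rle_abs (- B)); rewrite Rabs_Ropp in Hb; assert (Hb' := Rabs_pos B).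
      replace (B * z) with (B * s + - B * (s - z)) by ring.
      apply Rplus_le_compat_l, Rle_trans with (Rabs B * (s - z)).
      - apply Rmult_le_compat_r; lra.
      - apply Rmult_le_compat_l; lra. }
    assert (F2 : C0 * (z * h) <= Rabs C0 * s * h).
    { apply Rle_trans with (Rabs C0 * (z * h)).
      - apply Rmult_le_compat_r; [nra | apply Rle_abs].
      - rewrite Rmult_assoc; apply Rmult_le_compat_l; [apply Rabs_pos|].
        apply Rmult_le_compat_r; lra. }
    assert (F3 : q * h <= eps / 2).
    { replace (eps / 2) with (q * (eps / (2 * q))) by (field; lra). apply Rmult_le_compat_l; lra. }
    unfold q in F3; lra. }
  assert (E1 := H2 N ltac:(unfold N; lia) i); assert (E2 := H2 N ltac:(unfold N; lia) (i + m)%nat).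
  assert (E3 : Rabs (w (INR i / INR N) - w x) < eps / 8) by (apply H3, Rabs_def1; lra).
  assert (E4 : Rabs (w (INR (i + m) / INR N) - w (x + s)) < eps / 8).
  { apply H4; rewrite Ep; apply Rabs_def1; lra. }
  apply Rabs_le_between in E1; apply Rabs_le_between in E2.
  apply Rabs_def2 in E3; apply Rabs_def2 in E4. lra.
Qed.

Lemma grid_slope_abs w k x s B C0 : (forall y, continuous w y) -> grid_approx w k ->
  0 <= x -> 0 <= s ->
  (exists N1, forall N i, (N1 <= N)%nat ->
     Rabs (k N (S i) - k N i) <= B * / INR N + C0 * (/ INR N * / INR N)) ->
  Rabs (w (x + s) - w x) <= B * s.
Proof.
  intros Hc Ha Hx Hs [N1 H]; apply Rabs_le; split.
  - assert (- w (x + s) - - w x <= B * s); [|lra].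
    apply (grid_slope_le (fun y => - w y) (fun N i => - k N i) x s 1 B C0); auto; try lra.
    + intros y; apply (continuous_opp w), Hc.
    + apply grid_opp, Ha.
    + exists N1; intros N i HN _; specialize (H N i HN); apply Rabs_le_between in H; lra.
  - apply (grid_slope_le w k x s 1 B C0); auto; try lra.
    exists N1; intros N i HN _; eapply Rle_trans; [apply Rle_abs | auto].
Qed.

Lemma per_shift_pos (x : R) : exists n : Z, 0 <= x + IZR n.
Proof.
  exists (- Int_part x)%Z; rewrite opp_IZR; destruct (base_Int_part x); lra.
Qed.

(** Grid indices are natural numbers and reach only nonnegative points; periodicity carries the
    bound to the whole line. *)
Lemma per_slope_all (w : R -> R) B : (forall x, w (x + 1) = w x) ->
  (forall x s, 0 <= x -> 0 <= s -> Rabs (w (x + s) - w x) <= B * s) ->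
  forall x s, 0 <= s -> Rabs (w (x + s) - w x) <= B * s.
Proof.
  intros Hp H x s Hs; destruct (per_shift_pos x) as [n Hn].
  rewrite <- (per_IZR w Hp n x), <- (per_IZR w Hp n (x + s)).
  replace (x + s + IZR n) with (x + IZR n + s) by ring; auto.
Qed.

Lemma lip_of_slope f B : (forall x s, 0 <= s -> Rabs (f (x + s) - f x) <= B * s) -> lip B f.
Proof.
  intros H x y; destruct (Rle_dec y x) as [E|E].
  - rewrite (Rabs_pos_eq (x - y)) by lra.
    replace x with (y + (x - y)) at 1 by ring; apply H; lra.
  - rewrite (Rabs_minus_sym x y), (Rabs_minus_sym (f x)), (Rabs_pos_eq (y - x)) by lra.
    replace y with (x + (y - x)) at 1 by ring; apply H; lra.
Qed.

(** The slope bound is applied to the increment of [v] over length [r]. Its discrete counterpart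
    spans about rN nodes, so one of its increments telescopes into that many second differences of
    size B/N^2, at most (B r)/N in all. *)
Lemma grid_second_diff v k A B r x s : lip A v -> (forall x, v (x + 1) = v x) -> grid_approx v k ->
  0 <= r -> 0 <= s ->
  (exists N1, forall N i, (N1 <= N)%nat ->
     Rabs (k N (S (S i)) - k N (S i) - (k N (S i) - k N i)) <= B * (/ INR N * / INR N)) ->
  0 <= B ->
  Rabs ((v (x + s + r) - v (x + s)) - (v (x + r) - v x)) <= B * r * s.
Proof.
  intros Hl Hp Ha Hr Hs [N1 H] HB.
  assert (Hc := lip_continuous _ _ Hl).
  apply (per_slope_all (fun x => v (x + r) - v x) (B * r)); auto.
  { intros y; replace (y + 1 + r) with (y + r + 1) by ring; now rewrite !Hp. }
  clear x s Hs; intros x s Hx Hs.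
  apply (grid_slope_abs (fun x => v (x + r) - v x)
           (fun N i => k N (i + nf (r * INR N))%nat - k N i) x s (B * r) 0); auto.
  - intros y; apply (continuous_minus (fun x => v (x + r)) v); [|apply Hc].
    apply (continuous_comp (fun x => x + r) v); [|apply Hc].
    apply (continuous_plus (fun x => x) (fun _ => r)); [apply continuous_id | apply continuous_const].
  - eapply grid_shift_diff; eauto.
  - destruct (large_inv 1 Rlt_0_1) as [N2 [_ HN2]].
    exists (N1 + N2)%nat; intros N i HN; destruct (HN2 N ltac:(lia)) as [P1 _].
    assert (G := grid_near r N Hr P1); set (m := nf (r * INR N)) in *.
    assert (Sm := sum_incr_abs (fun i => k N (S i) - k N i) _ (fun j => H N j ltac:(lia)) i m).
    cbv beta in Sm; change (S i + m)%nat with (S (i + m)).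
    replace (k N (S (i + m)) - k N (S i) - (k N (i + m)%nat - k N i))
      with (k N (S (i + m)) - k N (i + m)%nat - (k N (S i) - k N i)) by ring.
    eapply Rle_trans; [exact Sm|].
    assert (Hh : 0 < / INR N) by (apply Rinv_0_lt_compat; auto).
    replace (INR m * (B * (/ INR N * / INR N))) with (B * (INR m / INR N) * / INR N) by (unfold Rdiv; ring).
    rewrite Rmult_0_l, Rplus_0_r; apply Rmult_le_compat_r; [lra|]; apply Rmult_le_compat_l; lra.
Qed.

(** Same device one order higher: [grid_second_diff] is applied to the increment of [v] over length
    [q], which has Lipschitz constant [A + A]. *)
Lemma grid_third_diff v k A B q r x s : lip A v -> (forall x, v (x + 1) = v x) -> grid_approx v k ->
  0 <= q -> 0 <= r -> 0 <= s ->
  (exists N1, forall N i, (N1 <= N)%nat ->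
     Rabs ((k N (S (S (S i))) - k N (S (S i)) - (k N (S (S i)) - k N (S i)))
           - (k N (S (S i)) - k N (S i) - (k N (S i) - k N i)))
     <= B * (/ INR N * / INR N * / INR N)) ->
  0 <= B ->
  Rabs ((v (x + s + r + q) - v (x + s + r) - (v (x + s + q) - v (x + s)))
        - (v (x + r + q) - v (x + r) - (v (x + q) - v x))) <= B * q * r * s.
Proof.
  intros Hl Hp Ha Hq Hr Hs [N1 H] HB.
  apply (grid_second_diff (fun x => v (x + q) - v x)
           (fun N i => k N (i + nf (q * INR N))%nat - k N i) (A + A)); auto.
  - intros y z; replace (v (y + q) - v y - (v (z + q) - v z)) with
      ((v (y + q) - v (z + q)) - (v y - v z)) by ring.
    eapply Rle_trans; [apply Rabs_triang|]; rewrite Rabs_Ropp, Rmult_plus_distr_r.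
    apply Rplus_le_compat; [|apply Hl].
    replace (y - z) with (y + q - (z + q)) by ring; apply Hl.
  - intros y; replace (y + 1 + q) with (y + q + 1) by ring; now rewrite !Hp.
  - eapply grid_shift_diff; eauto.
  - destruct (large_inv 1 Rlt_0_1) as [N2 [_ HN2]].
    exists (N1 + N2)%nat; intros N i HN; destruct (HN2 N ltac:(lia)) as [P1 _].
    assert (G := grid_near q N Hq P1); set (m := nf (q * INR N)) in *.
    assert (Sm := sum_incr_abs (fun i => k N (S (S i)) - k N (S i) - (k N (S i) - k N i)) _
                   (fun j => H N j ltac:(lia)) i m).
    cbv beta in Sm; change (S (S i) + m)%nat with (S (S (i + m))); change (S i + m)%nat with (S (i + m)).
    match goal with |- Rabs ?a <= _ => match type of Sm with Rabs ?b <= _ => replace a with b by ring end end.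
    eapply Rle_trans; [exact Sm|].
    assert (Hh : 0 < / INR N) by (apply Rinv_0_lt_compat; auto).
    replace (INR m * (B * (/ INR N * / INR N * / INR N)))
      with (B * (INR m / INR N) * (/ INR N * / INR N)) by (unfold Rdiv; ring).
    apply Rmult_le_compat_r; [nra|]; apply Rmult_le_compat_l; lra.
  - apply Rmult_le_pos; auto.
Qed.

Lemma per_uniform_continuous f : (forall x, continuous f x) -> (forall x, f (x + 1) = f x) ->
  forall eps, 0 < eps -> exists d, 0 < d /\ forall x y, Rabs (x - y) < d -> Rabs (f x - f y) < eps.
Proof.
  intros Hc Hp eps Heps.
  assert (Hc' : forall x, -1 <= x <= 2 -> continuity_pt f x).
  { intros x _; apply continuity_pt_filterlim, Hc. }
  destruct (Heine_cor2 Hc' (mkposreal eps Heps)) as [d Hd].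
  exists (Rmin d 1); split; [apply Rmin_glb_lt; [apply cond_pos | lra]|]; intros x y Hxy.
  assert (m1 := Rmin_l d 1); assert (m2 := Rmin_r d 1).
  destruct (base_Int_part x) as [B1 B2]; set (n := Int_part x) in *.
  rewrite <- (per_IZR f Hp (- n) x), <- (per_IZR f Hp (- n) y), opp_IZR.
  assert (Hxy' := Hxy); apply Rabs_def2 in Hxy'.
  apply Hd; try lra.
  replace (x + - IZR n - (y + - IZR n)) with (x - y) by ring; lra.
Qed.

(** The bound on increments varies with the node, so the slope estimate is used only on a window
    where [phi] is within [eps] of [phi x]. *)
Lemma grid_derive_le w k phi x l : (forall y, continuous w y) -> grid_approx w k ->
  0 <= x -> continuous phi x -> is_derive w x l ->
  (exists N1, forall N i, (N1 <= N)%nat -> k N (S i) - k N i <= phi (INR i / INR N) * / INR N) ->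
  l <= phi x.
Proof.
  intros Hc Ha Hx Hphi Hd [N1 H]; apply le_epsilon; intros eps Heps.
  destruct (proj1 (continuous_eps phi x) Hphi eps Heps) as [d [Hdp Hd1]].
  apply (derive_le_of_slope w x l _ (d / 2)); auto; [lra|]; intros s Hs.
  apply (grid_slope_le w k x s (d / 2) _ 0); auto; try lra.
  destruct (large_inv 1 Rlt_0_1) as [N2 [_ HN2]].
  exists (N1 + N2)%nat; intros N i HN Hi; destruct (HN2 N ltac:(lia)) as [P1 _].
  eapply Rle_trans; [apply H; lia|].
  assert (Hh : 0 < / INR N) by (apply Rinv_0_lt_compat; auto).
  rewrite Rmult_0_l, Rplus_0_r; apply Rmult_le_compat_r; [lra|].
  assert (E : Rabs (phi (INR i / INR N) - phi x) < eps) by (apply Hd1, Rabs_def1; lra).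
  apply Rabs_def2 in E; lra.
Qed.

From mathcomp Require Import ssreflect ssrbool eqtype ssrnat div fintype bigop.

(** * Samples of a periodic function and their piecewise linear interpolation *)

Lemma INR_addn m n : INR (m + n)%N = INR m + INR n.
Proof. exact: plus_INR. Qed.

Lemma INR_muln m n : INR (m * n)%N = INR m * INR n.
Proof. exact: mult_INR. Qed.

Lemma INR_gt0 N : (0 < N)%N -> 0 < INR N.
Proof. move=> /ltP; exact: lt_0_INR. Qed.

Definition sample (N : nat) (f : R -> R) : 'I_N -> R := fun i => f (INR i / INR N).

Lemma vget_sample N f k : (0 < N)%N -> (forall x, f (x + 1) = f x) ->
  vget (sample N f) k = f (INR k / INR N).
Proof.
  move=> HN Hp; have HN' := INR_gt0 N HN; rewrite /vget.
  case: insubP => [i _ Ei|]; last by rewrite ltn_mod HN.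
  rewrite /sample; move: Ei => /= ->.
  have -> : INR k / INR N = INR (k %% N)%N / INR N + IZR (Z.of_nat (k %/ N)%N).
    rewrite {1}(divn_eq k N) INR_addn INR_muln -INR_IZR_INZ; field; lra.
  by rewrite per_IZR.
Qed.

Lemma cshift_sample N f k : (0 < N)%N -> (forall x, f (x + 1) = f x) ->
  cshift k (sample N f) = sample N (fun x => f (x + INR k / INR N)).
Proof.
  move=> HN Hp; have HN' := INR_gt0 N HN; apply: functional_extensionality => i.
  rewrite /cshift vget_sample // INR_addn /sample; congr f; field; lra.
Qed.

Lemma vnorm_le N (v : 'I_N -> R) b : 0 <= b -> (forall i, Rabs (v i) <= b) -> vnorm v <= b.
Proof. by move=> Hb H; rewrite /vnorm; elim/big_ind: _ => // x y; apply: Rmax_lub. Qed.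

(** One formula for all real [x] and all integer cells: the reduction to [0,1) and the wrap-around
    of the last cell are absorbed by the periodicity of [f]. *)
Lemma PN_cell N f x (j : Z) : (0 < N)%N -> (forall x, f (x + 1) = f x) ->
  IZR j <= INR N * x < IZR j + 1 ->
  PN N (sample N f) x =
    f (IZR j / INR N) * (IZR j + 1 - INR N * x) + f ((IZR j + 1) / INR N) * (INR N * x - IZR j).
Proof.
  move=> HN Hp Hj; have HN' := INR_gt0 N HN; rewrite /PN.
  have [B1 B2] := base_Int_part x.
  move: B1 B2; set n := Int_part x => B1 B2; set y := x - IZR n.
  have Ej : Int_part (INR N * y) = (j - Z.of_nat N * n)%Z.
    symmetry; apply: Int_part_spec; rewrite minus_IZR mult_IZR -INR_IZR_INZ /y; lra.
  have Hpos : (0 <= j - Z.of_nat N * n)%Z.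
    suff : (-1 < j - Z.of_nat N * n)%Z by lia.
    apply: lt_IZR; rewrite minus_IZR mult_IZR -INR_IZR_INZ.
    have : 0 <= INR N * (x - IZR n) by apply: Rmult_le_pos; lra.
    lra.
  set i := Z.to_nat _.
  have Ei : INR i = IZR j - INR N * IZR n.
    by rewrite /i Ej INR_IZR_INZ Z2Nat.id // minus_IZR mult_IZR -INR_IZR_INZ.
  rewrite !vget_sample // INR_addn Ei /=.
  have -> : IZR j / INR N = (IZR j - INR N * IZR n) / INR N + IZR n by field; lra.
  have -> : (IZR j + 1) / INR N = (IZR j - INR N * IZR n + 1) / INR N + IZR n by field; lra.
  rewrite !per_IZR // /y; field; lra.
Qed.

Lemma PN_cellP N f x : (0 < N)%N -> (forall x, f (x + 1) = f x) ->
  exists j : Z, exists th, [/\ 0 <= th < 1, INR N * x = IZR j + th &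
    PN N (sample N f) x = f (IZR j / INR N) * (1 - th) + f ((IZR j + 1) / INR N) * th].
Proof.
  move=> HN Hp; have [B1 B2] := base_Int_part (INR N * x).
  exists (Int_part (INR N * x)), (INR N * x - IZR (Int_part (INR N * x))).
  split; [lra|lra|].
  rewrite (PN_cell N f x (Int_part (INR N * x))) //; last lra.
  by congr (_ * _ + _); ring.
Qed.

Lemma PN_inbox N f lo hi : (0 < N)%N -> (forall x, f (x + 1) = f x) -> inbox lo hi f ->
  inbox lo hi (PN N (sample N f)).
Proof.
  move=> HN Hp Hb x; have [j [th [Hth _ ->]]] := PN_cellP N f x HN Hp.
  have := Hb (IZR j / INR N); have := Hb ((IZR j + 1) / INR N); nra.
Qed.

Lemma PN_near N f eps d : (0 < N)%N -> (forall x, f (x + 1) = f x) ->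
  (forall x y, Rabs (x - y) < d -> Rabs (f x - f y) < eps) -> / INR N < d ->
  near eps f (PN N (sample N f)).
Proof.
  move=> HN Hp Hu Hd x; have HN' := INR_gt0 N HN.
  have Hi : 0 < / INR N by apply: Rinv_0_lt_compat.
  have [j [th [Hth Hx ->]]] := PN_cellP N f x HN Hp.
  have Ex : x = (IZR j + th) / INR N by rewrite -Hx; field; lra.
  have E1 : x - IZR j / INR N = th * / INR N by rewrite Ex; field; lra.
  have E2 : x - (IZR j + 1) / INR N = - ((1 - th) * / INR N) by rewrite Ex; field; lra.
  have H1 : Rabs (f x - f (IZR j / INR N)) < eps.
    by apply: Hu; rewrite E1 Rabs_pos_eq; nra.
  have H2 : Rabs (f x - f ((IZR j + 1) / INR N)) < eps.
    by apply: Hu; rewrite E2 Rabs_Ropp Rabs_pos_eq; nra.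
  move: H1 H2 => /Rabs_def2 H1 /Rabs_def2 H2.
  apply: Rabs_le; nra.
Qed.

Lemma PN_per N f : (0 < N)%N -> (forall x, f (x + 1) = f x) ->
  forall x, PN N (sample N f) (x + 1) = PN N (sample N f) x.
Proof.
  move=> HN Hp x; have HN' := INR_gt0 N HN.
  have [B1 B2] := base_Int_part (INR N * x); move: B1 B2; set j := Int_part _ => B1 B2.
  rewrite (PN_cell N f x j) //; last lra.
  have EN : IZR (j + Z.of_nat N) = IZR j + INR N by rewrite plus_IZR -INR_IZR_INZ.
  rewrite (PN_cell N f (x + 1) (j + Z.of_nat N)%Z) //; last by rewrite EN; lra.
  rewrite EN.
  have -> : (IZR j + INR N) / INR N = IZR j / INR N + 1 by field; lra.
  have -> : (IZR j + INR N + 1) / INR N = (IZR j + 1) / INR N + 1 by field; lra.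
  by rewrite !Hp; ring.
Qed.

(* Points at distance less than 1/N lie in the same cell or in adjacent ones, and
   in the second case the common node can be inserted between them. *)
Lemma PN_continuous N f lo hi : (0 < N)%N -> (forall x, f (x + 1) = f x) -> inbox lo hi f ->
  forall x, continuous (PN N (sample N f)) x.
Proof.
  move=> HN Hp Hb; have HN' := INR_gt0 N HN.
  have Hi : 0 < / INR N by apply: Rinv_0_lt_compat.
  have Hlh : lo <= hi by have := Hb 0; lra.
  have Hle : forall x y, x <= y -> y - x < / INR N ->
    Rabs (PN N (sample N f) y - PN N (sample N f) x) <= (hi - lo) * (INR N * (y - x)).
    move=> x y Hxy Hd.
    have Hd' : INR N * y - INR N * x < 1.
      have -> : 1 = INR N * / INR N by field; lra.
      by rewrite -Rmult_minus_distr_l; apply: Rmult_lt_compat_l.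
    have Hxy' : INR N * x <= INR N * y by apply: Rmult_le_compat_l; lra.
    have [B1 B2] := base_Int_part (INR N * x); move: B1 B2; set j := Int_part _ => B1 B2.
    rewrite (PN_cell N f x j) //; last lra.
    have F0 := Hb (IZR j / INR N); have F1 := Hb ((IZR j + 1) / INR N).
    have [Hc|Hc] := Rlt_dec (INR N * y) (IZR j + 1).
    - rewrite (PN_cell N f y j) //; last lra.
      set a := f _ in F0 *; set b := f _ in F1 *.
      have -> : a * (IZR j + 1 - INR N * y) + b * (INR N * y - IZR j)
        - (a * (IZR j + 1 - INR N * x) + b * (INR N * x - IZR j)) = (b - a) * (INR N * (y - x)) by ring.
      rewrite Rabs_mult (Rabs_pos_eq (INR N * (y - x))); last by apply: Rmult_le_pos; lra.
      apply: Rmult_le_compat_r; first by apply: Rmult_le_pos; lra.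
      by apply: Rabs_le; lra.
    - have E1 : IZR (j + 1) = IZR j + 1 by rewrite plus_IZR.
      rewrite (PN_cell N f y (j + 1)%Z) //; last by rewrite E1; lra.
      rewrite E1.
      have F2 := Hb ((IZR j + 1 + 1) / INR N).
      set a := f _ in F0 *; set b := f _ in F1 *; set e := f _ in F2 *.
      have -> : b * (IZR j + 1 + 1 - INR N * y) + e * (INR N * y - (IZR j + 1))
        - (a * (IZR j + 1 - INR N * x) + b * (INR N * x - IZR j))
        = (e - b) * (INR N * y - (IZR j + 1)) + (b - a) * (IZR j + 1 - INR N * x) by ring.
      apply: Rle_trans (Rabs_triang _ _) _.
      rewrite !Rabs_mult (Rabs_pos_eq (INR N * y - (IZR j + 1))); last lra.
      rewrite (Rabs_pos_eq (IZR j + 1 - INR N * x)); last lra.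
      have G1 : Rabs (e - b) <= hi - lo by apply: Rabs_le; lra.
      have G2 : Rabs (b - a) <= hi - lo by apply: Rabs_le; lra.
      have : Rabs (e - b) * (INR N * y - (IZR j + 1)) <= (hi - lo) * (INR N * y - (IZR j + 1))
        by apply: Rmult_le_compat_r; lra.
      have : Rabs (b - a) * (IZR j + 1 - INR N * x) <= (hi - lo) * (IZR j + 1 - INR N * x)
        by apply: Rmult_le_compat_r; lra.
      lra.
  move=> x; apply/continuous_eps => eps Heps.
  set q := (hi - lo) * INR N + 1.
  have Hq : 0 < q.
    have : 0 <= (hi - lo) * INR N by apply: Rmult_le_pos; lra.
    rewrite /q; lra.
  have He : 0 < eps / q by apply: Rdiv_lt_0_compat.
  exists (Rmin (/ INR N) (eps / q)); split; first by apply: Rmin_glb_lt.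
  move=> y Hy.
  have m1 := Rmin_l (/ INR N) (eps / q); have m2 := Rmin_r (/ INR N) (eps / q).
  have Hz : Rabs (PN N (sample N f) y - PN N (sample N f) x) <= (hi - lo) * (INR N * Rabs (y - x)).
    move/Rabs_def2: Hy => Hy; have [Hxy|Hxy] := Rle_dec x y.
    - rewrite (Rabs_pos_eq (y - x)); last lra.
      by apply: Hle; lra.
    - rewrite Rabs_minus_sym (Rabs_minus_sym y) (Rabs_pos_eq (x - y)); last lra.
      by apply: Hle; lra.
  apply: Rle_lt_trans Hz _.
  have P := Rabs_pos (y - x).
  apply: (Rle_lt_trans _ (q * Rabs (y - x))); first by rewrite /q; lra.
  have -> : eps = q * (eps / q) by field; lra.
  by apply: Rmult_lt_compat_l; lra.
Qed.

Lemma PN_Per1 N f lo hi : (0 < N)%N -> 0 < lo -> (forall x, f (x + 1) = f x) -> inbox lo hi f ->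
  Per1 (PN N (sample N f)).
Proof.
  move=> HN Hlo Hp Hb; split; [|split].
  - exact: PN_continuous Hb.
  - move=> x; have := PN_inbox N f lo hi HN Hp Hb x; lra.
  - exact: PN_per.
Qed.

(** * From K_N to K *)

Section Limit.

Context (K : (R -> R) -> (R -> R)) (vmax : R) (KN : forall N : nat, ('I_N -> R) -> R).
Context (HK1 : forall rho, Per1 rho -> C1fun (K rho) /\ Per1 (K rho)).
Context (HKc : K_continuous K).
Context (HKb : forall rho x, Per1 rho -> 0 <= K rho x <= vmax).
Context (L c C S : R) (gam Gam W : R -> R).
Context (HL : 0 <= L) (Hc : 0 <= c) (HC : 0 <= C) (HS : 0 <= S).
Context (Hgam : nondec_nonneg gam) (HGam : nondec_nonneg Gam) (HW : nondec_nonneg W).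
Context (Happ : forall N : nat, (2 < N)%N ->
    forall rmin rmax : R, 0 < rmin -> rmin <= rmax ->
    forall rho rhot : 'I_N -> R,
      (forall i, rmin <= rho i <= rmax) -> (forall i, rmin <= rhot i <= rmax) ->
      let h := / INR N in
      let y := fun i => (cshift 1 rho i - rho i) / h in
      let phi := fun i => (cshift 2 rho i - 2 * cshift 1 rho i + rho i) / (h * h) in
      Rabs (KN N rho - KN N rhot) <= L * vnorm (vsub rho rhot) /\
      Rabs (KN N rho - KN N (cshift 1 rho) - KN N rhot + KN N (cshift 1 rhot))
        <= (h * vnorm (vsub rho rhot) + h * h) * Gam rmax /\
      (forall i0 : 'I_N, nat_of_ord i0 = 0%N ->
        - c * h * (rmax - rho i0) <= KN N (cshift 1 rho) - KN N rho
        /\ KN N (cshift 1 rho) - KN N rho <= c * h * (rho i0 - rmin)) /\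
      Rabs (2 * KN N (cshift 1 rho) - KN N rho - KN N (cshift 2 rho))
        <= h * h * (gam rmax + C * vnorm y) /\
      Rabs (3 * KN N (cshift 1 rho) + KN N (cshift 3 rho) - KN N rho
            - 3 * KN N (cshift 2 rho))
        <= h * h * h * (W (rmax + vnorm y) + C * vnorm phi) /\
      (forall i : 'I_N,
        Rabs (K (PN N rho) (INR i * h) - KN N (cshift i rho)) <= h * S * rmax)).

(** Discrete velocity at the node i/N. Translating the density plays the part of the cyclic shift,
    and makes sense for every natural [i]. *)
Definition kap (f : R -> R) (N i : nat) : R := KN N (sample N (fun x => f (x + INR i / INR N))).

Lemma KN_cshift f N i m : (0 < N)%N -> (forall x, f (x + 1) = f x) ->
  KN N (cshift m (sample N (fun x => f (x + INR i / INR N)))) = kap f N (i + m)%N.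
Proof.
  move=> HN Hp; have HN' := INR_gt0 N HN; rewrite cshift_sample //; last first.
    by move=> x; rewrite (_ : x + 1 + INR i / INR N = x + INR i / INR N + 1) ?Hp //; ring.
  rewrite /kap; congr (KN N); congr (sample N); apply: functional_extensionality => x.
  by rewrite INR_addn; congr f; field; lra.
Qed.

(** The comparison of [K] with [KN] is stated for indices below [N]; this extends it to all
    indices. *)
Lemma kap_mod f N i : (0 < N)%N -> (forall x, f (x + 1) = f x) ->
  kap f N i = kap f N (i %% N)%N /\ forall g : R -> R, (forall x, g (x + 1) = g x) ->
  g (INR i / INR N) = g (INR (i %% N)%N / INR N).
Proof.
  move=> HN Hp; have HN' := INR_gt0 N HN.
  have E : INR i / INR N = INR (i %% N)%N / INR N + IZR (Z.of_nat (i %/ N)%N).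
    rewrite {1}(divn_eq i N) INR_addn INR_muln -INR_IZR_INZ; field; lra.
  split; last by move=> g Hg; rewrite E per_IZR.
  rewrite /kap; congr (KN N); congr (sample N); apply: functional_extensionality => x.
  by rewrite E -Rplus_assoc per_IZR.
Qed.

Lemma gt2_gt0 N : (2 < N)%N -> (0 < N)%N.
Proof. exact: leq_trans. Qed.

(** Successive differences of [kap] are the form consumed by the grid lemmas. The quotients of first
    and second order in the hypotheses are computed from samples, hence bounded by [M] and [M2], and
    monotonicity of [W] replaces the norm inside it by [M]. *)
Lemma kap_props f g lo hi N i : (2 < N)%N -> 0 < lo -> Per1 f -> Per1 g ->
  inbox lo hi f -> inbox lo hi g ->
  let h := / INR N in
  [/\ forall d, near d f g -> Rabs (kap f N i - kap g N i) <= L * d,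
      forall d, near d f g -> Rabs (kap f N (i + 1)%N - kap g N (i + 1)%N - (kap f N i - kap g N i))
        <= Gam hi * d * h + Gam hi * (h * h),
      - (c * (hi - f (INR i / INR N)) * h) <= kap f N (i + 1)%N - kap f N i
        <= c * (f (INR i / INR N) - lo) * h,
      forall M, lip M f ->
        Rabs (kap f N (i + 2)%N - kap f N (i + 1)%N - (kap f N (i + 1)%N - kap f N i))
        <= (gam hi + C * M) * (h * h) &
      forall M M2, lip M f -> lip2 M2 f ->
        Rabs ((kap f N (i + 3)%N - kap f N (i + 2)%N - (kap f N (i + 2)%N - kap f N (i + 1)%N))
          - (kap f N (i + 2)%N - kap f N (i + 1)%N - (kap f N (i + 1)%N - kap f N i)))
        <= (W (hi + M) + C * M2) * (h * h * h)].
Proof.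
  move=> HN Hlo [_ [_ Hf]] [_ [_ Hg]] Bf Bg h.
  have HN0 := gt2_gt0 N HN; have HN' := INR_gt0 N HN0.
  have Hh : 0 < h by apply: Rinv_0_lt_compat.
  have Hlh : lo <= hi by have := Bf 0; lra.
  have Hhi : 0 <= hi by lra.
  set F := fun x => f (x + INR i / INR N); set G := fun x => g (x + INR i / INR N).
  have HF : forall x, F (x + 1) = F x.
    by move=> x; rewrite /F (_ : x + 1 + INR i / INR N = x + INR i / INR N + 1) ?Hf //; ring.
  have [H1 [H2 [H3 [H4 [H5 _]]]]] := Happ N HN lo hi Hlo Hlh (sample N F) (sample N G)
    (fun j => Bf _) (fun j => Bg _).
  rewrite -/h in H1 H2 H3 H4 H5.
  have Es : forall m, cshift m (sample N F) = sample N (fun x => F (x + INR m * h)).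
    by move=> m; rewrite cshift_sample.
  have Hgh := proj1 HGam hi Hhi.
  have hh : 0 < h * h by apply: Rmult_lt_0_compat.
  have Vy : forall M, lip M f -> vnorm (fun j => (cshift 1 (sample N F) j - sample N F j) / h) <= M.
    move=> M HM; apply: vnorm_le; first exact: lip_nonneg HM.
    move=> j; rewrite Es /sample /Rdiv Rabs_mult Rabs_inv (Rabs_pos_eq h); last lra.
    apply: (Rmult_le_reg_r h); first done.
    rewrite Rmult_assoc Rinv_l ?Rmult_1_r; last lra.
    apply: Rle_trans (HM _ _) _; rewrite /=.
    rewrite (_ : _ - _ = h); last by ring.
    rewrite Rabs_pos_eq; lra.
  rewrite !(KN_cshift f) // !(KN_cshift g) // -/(kap f N i) -/(kap g N i) in H1 H2 H3 H4 H5.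
  have Vd : forall d, near d f g -> vnorm (vsub (sample N F) (sample N G)) <= d.
    move=> d Hd; apply: vnorm_le; [exact: near_nonneg Hd | by move=> j; apply: Hd].
  split.
  - by move=> d /Vd Hd; apply: Rle_trans H1 _; apply: Rmult_le_compat_l.
  - move=> d /Vd Hd.
    rewrite -Rabs_Ropp (_ : - _ = kap f N i - kap f N (i + 1)%N - kap g N i + kap g N (i + 1)%N);
      last by ring.
    apply: Rle_trans H2 _.
    rewrite (_ : Gam hi * d * h + _ = (h * d + h * h) * Gam hi); last by ring.
    apply: Rmult_le_compat_r => //; apply: Rplus_le_compat_r; apply: Rmult_le_compat_l; lra.
  (* The comparison refers to the entry of index 0; after the translation that entry is f(i/N). *)
  - have := H3 (Ordinal HN0) (Logic.eq_refl); rewrite /sample /F /=.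
    rewrite (_ : 0 / INR N + INR i / INR N = INR i / INR N); last by rewrite /Rdiv; ring.
    lra.
  - move=> M HM; have HyM := Vy M HM.
    rewrite -Rabs_Ropp (_ : - _ = 2 * kap f N (i + 1)%N - kap f N i - kap f N (i + 2)%N); last by ring.
    apply: Rle_trans H4 _; rewrite Rmult_comm; apply: Rmult_le_compat_r; first lra.
    by apply: Rplus_le_compat_l; apply: Rmult_le_compat_l.
  - move=> M M2 HM HM2; have HyM := Vy M HM.
    have Hv0 : 0 <= vnorm (fun j => (cshift 1 (sample N F) j - sample N F j) / h).
      by rewrite /vnorm; elim/big_ind: _ => //; [lra | move=> a b Ha _; apply: Rle_trans Ha (Rmax_l _ _) | move=> j _; apply: Rabs_pos].
    have Hphi : vnorm (fun j => (cshift 2 (sample N F) j - 2 * cshift 1 (sample N F) j + sample N F j) / (h * h)) <= M2.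
      apply: vnorm_le; first exact: lip2_nonneg HM2.
      move=> j; rewrite !Es /sample /Rdiv Rabs_mult Rabs_inv (Rabs_pos_eq (h * h)); last lra.
      apply: (Rmult_le_reg_r (h * h)); first done.
      rewrite Rmult_assoc Rinv_l ?Rmult_1_r; last lra.
      have := HM2 h h (INR j * / INR N + INR i / INR N) (Rlt_le _ _ Hh) (Rlt_le _ _ Hh).
      rewrite /F /=.
      rewrite (_ : INR j * / INR N + (1 + 1) * h + INR i / INR N = INR j * / INR N + INR i / INR N + h + h); last by ring.
      rewrite (_ : INR j * / INR N + 1 * h + INR i / INR N = INR j * / INR N + INR i / INR N + h); last by ring.
      set a := f _; set b := f _; set e := f _.
      rewrite (_ : a - b - b + e = a - 2 * b + e); last by ring.
      lra.
    rewrite (_ : _ - _ = 3 * kap f N (i + 1)%N + kap f N (i + 3)%N - kap f N i - 3 * kap f N (i + 2)%N); last by ring.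
    apply: Rle_trans H5 _; rewrite Rmult_comm; apply: Rmult_le_compat_r.
      by apply: Rmult_le_pos; lra.
    apply: Rplus_le_compat; last exact: Rmult_le_compat_l.
    apply: (proj2 HW); lra.
Qed.

(** The interpolants of the samples converge uniformly to [f], so continuity of [K] at [f] brings
    [K (PN N _)] close to [K f]; its distance to [kap] at the nodes is at most S hi/N. *)
Lemma kap_grid f lo hi : 0 < lo -> Per1 f -> inbox lo hi f -> grid_approx (K f) (kap f).
Proof.
  move=> Hlo Pf Bf eps Heps; have [Cf [_ Hf]] := Pf.
  have [d [Hd Hdc]] := HKc f Pf (eps / 2) ltac:(lra).
  have [d1 [Hd1 Hu]] := per_uniform_continuous f Cf Hf d Hd.
  have Hhi : 0 < hi by have := Bf 0; lra.
  set q := S * hi + 1.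
  have Hq : 0 < q by have : 0 <= S * hi := Rmult_le_pos _ _ HS (Rlt_le _ _ Hhi); rewrite /q; lra.
  have Hd2 : 0 < Rmin d1 (eps / (2 * q)).
    by apply: Rmin_glb_lt => //; apply: Rdiv_lt_0_compat; lra.
  have [N0 [_ HN0]] := large_inv _ Hd2.
  exists (3 + N0)%N => N HN i.
  have HN3 : (2 < N)%N.
    by apply/ltP; apply: (Nat.lt_le_trans _ (3 + N0)%coq_nat) => //; lia.
  have [P1 P2] : 0 < INR N /\ / INR N < Rmin d1 (eps / (2 * q)).
    by apply: HN0; apply: (Nat.le_trans _ (3 + N0)%coq_nat) => //; lia.
  have m1 := Rmin_l d1 (eps / (2 * q)); have m2 := Rmin_r d1 (eps / (2 * q)).
  have HNp := gt2_gt0 N HN3.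
  have [-> Eg] := kap_mod f N i HNp Hf.
  have PK := proj2 (HK1 f Pf); rewrite (Eg _ (proj2 (proj2 PK))).
  have Hi : (i %% N < N)%N by rewrite ltn_mod.
  have Hlh : lo <= hi by have := Bf 0; lra.
  have [_ [_ [_ [_ [_ H6]]]]] := Happ N HN3 lo hi Hlo Hlh (sample N f) (sample N f)
    (fun j => Bf _) (fun j => Bf _).
  have := H6 (Ordinal Hi); rewrite /= => {}H6.
  rewrite cshift_sample // -/(kap f N (i %% N)%N) in H6.
  have PP := PN_Per1 N f lo hi HNp Hlo Hf Bf.
  have Hn := PN_near N f d d1 HNp Hf Hu ltac:(lra).
  have := Hdc _ PP Hn (INR (i %% N)%N / INR N).
  have Hh : 0 < / INR N by apply: Rinv_0_lt_compat.
  have Hq2 : / INR N * S * hi <= eps / 2.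
    apply: (Rle_trans _ (q * / INR N)); first by rewrite /q; lra.
    rewrite (_ : eps / 2 = q * (eps / (2 * q))); last by field; lra.
    apply: Rmult_le_compat_l; lra.
  move: H6; rewrite -/(Rdiv _ _) => /Rabs_le_between H6 /Rabs_le_between H7.
  apply: Rabs_le; lra.
Qed.

Lemma per_all (P : R -> Prop) : (forall (n : Z) x, P (x + IZR n) -> P x) ->
  (forall x, 0 <= x -> P x) -> forall x, P x.
Proof. by move=> H1 H2 x; have [n Hn] := per_shift_pos x; apply: (H1 n); apply: H2. Qed.

Lemma geq3_gt2 N : (3 <= N)%coq_nat -> (2 < N)%N.
Proof. by move/leP. Qed.

Lemma vel_is_derive f x : Per1 f -> is_derive (K f) x (Derive (K f) x).
Proof. by move=> Pf; apply: Derive_correct; apply: (proj1 (proj1 (HK1 f Pf))). Qed.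

Lemma vel_minus_derive f g x : Per1 f -> Per1 g ->
  is_derive (fun y => K f y - K g y) x (Derive (K f) x - Derive (K g) x).
Proof. by move=> Pf Pg; apply: (is_derive_minus (K f) (K g)); apply: vel_is_derive. Qed.

(** The bound on an increment involves [f] at the node, so it is localised by [grid_derive_le], with
    [phi] equal to [c * (hi - f y)] on one side and [c * (f y - lo)] on the other. *)
Lemma lim_comparison lo hi f x : 0 < lo -> Per1 f -> inbox lo hi f ->
  - c * (hi - f x) <= Derive (K f) x <= c * (f x - lo).
Proof.
  move=> Hlo Pf Bf; have [Cf [_ Hf]] := Pf; have [CK [_ HKp]] := proj2 (HK1 f Pf).
  move: x; apply: per_all.
    move=> n x; rewrite (per_IZR f Hf) (per_IZR (Derive (K f))) //; exact: Derive_periodic.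
  move=> x Hx; have Hk := kap_grid f lo hi Hlo Pf Bf.
  have HN3 : forall N i, (3 <= N)%coq_nat -> - (c * (hi - f (INR i / INR N)) * / INR N)
      <= kap f N (i.+1) - kap f N i <= c * (f (INR i / INR N) - lo) * / INR N.
    move=> N i /geq3_gt2 HN; rewrite -(addn1 i).
    by have [] := kap_props f f lo hi N i HN Hlo Pf Pf Bf Bf.
  split.
  - suff : - Derive (K f) x <= c * (hi - f x) by lra.
    apply: (grid_derive_le (fun y => - K f y) (fun N i => - kap f N i) (fun y => c * (hi - f y))) => //.
    + by move=> y; apply: (continuous_opp (K f)).
    + exact: grid_opp.
    + apply: (continuous_mult (fun _ => c) (fun y => hi - f y)); first exact: continuous_const.
      by apply: (continuous_minus (fun _ => hi) f); first exact: continuous_const.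
    + exact: (is_derive_opp (K f) x _ (vel_is_derive f x Pf)).
    + by exists 3%N => N i HN; have := HN3 N i HN; lra.
  - apply: (grid_derive_le (K f) (kap f) (fun y => c * (f y - lo))) => //.
    + apply: (continuous_mult (fun _ => c) (fun y => f y - lo)); first exact: continuous_const.
      by apply: (continuous_minus f (fun _ => lo)); last exact: continuous_const.
    + exact: vel_is_derive.
    + by exists 3%N => N i HN; have := HN3 N i HN; lra.
Qed.

Lemma lim_vel_lip lo hi f : 0 < lo -> Per1 f -> inbox lo hi f -> lip (c * hi) (K f).
Proof.
  move=> Hlo Pf Bf; apply: (lip_of_derive _ (Derive (K f))) => x; first exact: vel_is_derive.
  have := lim_comparison lo hi f x Hlo Pf Bf; have := Bf x => B1 B2; apply: Rabs_le; nra.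
Qed.

Lemma lim_sup lo hi d f g : 0 < lo -> Per1 f -> Per1 g -> inbox lo hi f -> inbox lo hi g ->
  near d f g -> near (L * d) (K f) (K g).
Proof.
  move=> Hlo Pf Pg Bf Bg Hd.
  have [CK [_ HKp]] := proj2 (HK1 f Pf); have [CK' [_ HKp']] := proj2 (HK1 g Pg).
  have G := grid_minus _ _ _ _ (kap_grid f lo hi Hlo Pf Bf) (kap_grid g lo hi Hlo Pg Bg).
  have Cw : forall y, continuous (fun y => K f y - K g y) y.
    by move=> y; apply: (continuous_minus (K f) (K g)).
  have HN3 : forall N i, (3 <= N)%coq_nat -> Rabs (kap f N i - kap g N i) <= L * d.
    move=> N i /geq3_gt2 HN.
    by have [H _ _ _ _] := kap_props f g lo hi N i HN Hlo Pf Pg Bf Bg; apply: H.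
  apply: per_all; first by move=> n x; rewrite !per_IZR.
  move=> x Hx; apply: Rabs_le; split.
  - suff : - (K f x - K g x) <= L * d by lra.
    apply: (grid_value_le (fun y => - (K f y - K g y)) (fun N i => - (kap f N i - kap g N i))) => //.
    + by move=> y; apply: (continuous_opp (fun y => K f y - K g y)).
    + exact: grid_opp.
    + by exists 3%N => N i HN; have /Rabs_le_between := HN3 N i HN; lra.
  - apply: (grid_value_le (fun y => K f y - K g y) (fun N i => kap f N i - kap g N i)) => //.
    by exists 3%N => N i HN; have /Rabs_le_between := HN3 N i HN; lra.
Qed.

(** The increments of the difference are bounded by [Gam hi * d] times 1/N plus [Gam hi] times
    1/N^2; the second part is the [C0] term, which the summation eliminates. *)
Lemma lim_der lo hi d f g : 0 < lo -> Per1 f -> Per1 g -> inbox lo hi f -> inbox lo hi g ->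
  near d f g -> near (Gam hi * d) (Derive (K f)) (Derive (K g)).
Proof.
  move=> Hlo Pf Pg Bf Bg Hd x.
  have [CK [_ HKp]] := proj2 (HK1 f Pf); have [CK' [_ HKp']] := proj2 (HK1 g Pg).
  have G := grid_minus _ _ _ _ (kap_grid f lo hi Hlo Pf Bf) (kap_grid g lo hi Hlo Pg Bg).
  have Cw : forall y, continuous (fun y => K f y - K g y) y.
    by move=> y; apply: (continuous_minus (K f) (K g)).
  apply: derive_abs_le_of_slope (vel_minus_derive f g x Pf Pg) _ => s Hs.
  apply: (per_slope_all (fun y => K f y - K g y)) => //; first by move=> y; rewrite HKp HKp'.
  move=> {x}x {Hs}s Hx Hs.
  apply: (grid_slope_abs (fun y => K f y - K g y) (fun N i => kap f N i - kap g N i) x s _ (Gam hi)) => //.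
  exists 3%N => N i /geq3_gt2 HN; rewrite -(addn1 i).
  by have [_ H _ _ _] := kap_props f g lo hi N i HN Hlo Pf Pg Bf Bg; apply: H.
Qed.

Lemma lim_lip lo hi M f : 0 < lo -> Per1 f -> inbox lo hi f -> lip M f ->
  lip (gam hi + C * M) (Derive (K f)).
Proof.
  move=> Hlo Pf Bf HM; have [CK [_ HKp]] := proj2 (HK1 f Pf).
  have Hhi : 0 <= hi by have := Bf 0; lra.
  have HB : 0 <= gam hi + C * M.
    apply: Rplus_le_le_0_compat; first exact: (proj1 Hgam).
    by apply: Rmult_le_pos => //; apply: lip_nonneg HM.
  apply: lip_of_slope => x r Hr.
  have Hd : is_derive (fun y => K f (y + r) - K f y) x (Derive (K f) (x + r) - Derive (K f) x).
    apply: (is_derive_minus (fun y => K f (y + r)) (K f)); last exact: vel_is_derive.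
    by apply: is_derive_shift; apply: vel_is_derive.
  apply: derive_abs_le_of_slope Hd _ => s Hs.
  apply: (grid_second_diff (K f) (kap f) (c * hi)) => //.
  - exact: lim_vel_lip Bf.
  - exact: kap_grid Bf.
  - exists 3%N => N i /geq3_gt2 HN; rewrite -(addn2 i) -(addn1 i).
    by have [_ _ _ H _] := kap_props f f lo hi N i HN Hlo Pf Pf Bf Bf; apply: H.
Qed.

(** The second difference of (K f)' is the derivative of the second difference of [K f], so slopes
    of the latter suffice, and these are third differences. *)
Lemma lim_lip2 lo hi M M2 f : 0 < lo -> Per1 f -> inbox lo hi f -> lip M f -> lip2 M2 f ->
  lip2 (W (hi + M) + C * M2) (Derive (K f)).
Proof.
  move=> Hlo Pf Bf HM HM2; have [CK [_ HKp]] := proj2 (HK1 f Pf).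
  have Hhi : 0 <= hi by have := Bf 0; lra.
  have HB : 0 <= W (hi + M) + C * M2.
    apply: Rplus_le_le_0_compat; first by apply: (proj1 HW); have := lip_nonneg _ _ HM; lra.
    by apply: Rmult_le_pos => //; apply: lip2_nonneg HM2.
  move=> r q x Hr Hq; set v := Derive (K f).
  have Hd : is_derive (fun y => K f (y + r + q) - K f (y + r) - (K f (y + q) - K f y)) x
      (v (x + r + q) - v (x + r) - (v (x + q) - v x)).
    have D : forall y, is_derive (fun y => K f (y + q) - K f y) y (v (y + q) - v y).
      move=> y; apply: (is_derive_minus (fun y => K f (y + q)) (K f)); last exact: vel_is_derive.
      by apply: is_derive_shift; apply: vel_is_derive.
    apply: (is_derive_minus (fun y => K f (y + r + q) - K f (y + r)) (fun y => K f (y + q) - K f y)) => //.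
    exact: (is_derive_shift (fun y => K f (y + q) - K f y)).
  rewrite (_ : _ + v x = v (x + r + q) - v (x + r) - (v (x + q) - v x)); last by ring.
  apply: derive_abs_le_of_slope Hd _ => s Hs.
  rewrite (_ : _ * _ * _ * s = (W (hi + M) + C * M2) * q * r * s); last by ring.
  apply: (grid_third_diff (K f) (kap f) (c * hi)) => //.
  - exact: lim_vel_lip Bf.
  - exact: kap_grid Bf.
  - exists 3%N => N i /geq3_gt2 HN; rewrite -(addn3 i) -(addn2 i) -(addn1 i).
    by have [_ _ _ _ H] := kap_props f f lo hi N i HN Hlo Pf Pf Bf Bf; apply: H.
Qed.

Lemma limit_tame : tame K vmax L c C gam Gam W.
Proof.
  split=> //.
  - by move=> rho /HK1 [].
  - by move=> rho /HK1 [].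
  - exact: lim_sup.
  - exact: lim_der.
  - exact: lim_comparison.
  - exact: lim_lip.
  - exact: lim_lip2.
Qed.

End Limit.

Lemma W2inf_lip2 f : W2inf f -> exists M2, lip2 M2 f.
Proof.
  move=> [Hd [M HM]]; exists M => r s x Hr Hs.
  have D : forall y, is_derive (fun y => f (y + r) - f y) y (Derive f (y + r) - Derive f y).
    move=> y; apply: (is_derive_minus (fun y => f (y + r)) f); last exact: Derive_correct.
    by apply: is_derive_shift; apply: Derive_correct.
  have Hl : lip (M * r) (fun y => f (y + r) - f y).
    apply: lip_of_derive D _ => y; apply: Rle_trans (HM _ _) _.
    rewrite (_ : y + r - y = r); last by ring.
    rewrite Rabs_pos_eq //; exact: Rle_refl.
  have := Hl (x + s) x; rewrite (_ : x + s - x = s); last by ring.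
  rewrite (Rabs_pos_eq s) //.
  rewrite (_ : x + s + r = x + r + s); last by ring.
  by rewrite (_ : f (x + r + s) - f (x + s) - (f (x + r) - f x)
    = f (x + r + s) - f (x + r) - f (x + s) + f x); last by ring.
Qed.

(* By the mean value theorem over a period f' vanishes within distance 1 of any point. *)
Lemma W2inf_per_lip f : W2inf f -> (forall x, f (x + 1) = f x) -> exists M, lip M f.
Proof.
  move=> [Hd [M HM]] Hp; exists M.
  have HM0 : 0 <= M := lip_nonneg M (Derive f) HM.
  apply: lip_of_derive => x; first exact: Derive_correct.
  have [z [Hz1 Hz2]] : exists z, Rmin x (x + 1) <= z <= Rmax x (x + 1) /\
      f (x + 1) - f x = Derive f z * (x + 1 - x).
    apply: MVT_gen => z _; first exact: Derive_correct.
    by apply/continuity_pt_filterlim; apply: (ex_derive_continuous f).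
  rewrite Rmin_left in Hz1; last lra.
  rewrite Rmax_right in Hz1; last lra.
  have Ez : Derive f z = 0 by move: Hz2; rewrite Hp; lra.
  have := HM x z; rewrite Ez Rminus_0_r => H; apply: Rle_trans H _.
  rewrite -{2}(Rmult_1_r M); apply: Rmult_le_compat_l => //.
  by apply: Rabs_le; lra.
Qed.

Theorem theorem2p3 (K : (R -> R) -> (R -> R)) (vmax : R) (a : R -> R)
    (KN : forall N : nat, ('I_N -> R) -> R) :
  (forall rho, Per1 rho -> C1fun (K rho) /\ Per1 (K rho)) ->
  K_continuous K ->
  0 < vmax ->
  (forall rho x, Per1 rho -> 0 <= K rho x <= vmax) ->
  nondec_nonneg a ->
  (forall rho rhob, Per1 rho -> Per1 rhob ->
     RInt (fun x => Rabs (rho x - rhob x) * Rabs (K rho x - K rhob x)) 0 1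
     <= a (supnorm rho + supnorm rhob) * RInt (fun x => Rabs (rho x - rhob x) ^ 2) 0 1) ->
  (forall rho rhob, Per1 rho -> Per1 rhob ->
     RInt (fun x => Rabs (rho x - rhob x)
                    * Rabs (Derive (fun y => K rho y - K rhob y) x)) 0 1
     <= a (supnorm rho + supnorm rhob) * RInt (fun x => Rabs (rho x - rhob x) ^ 2) 0 1) ->
  smoothly_approximates K vmax KN ->
  forall rho0 : R -> R, W2inf rho0 -> Per1 rho0 ->
  exists u : R -> R -> R,
    solves K rho0 u /\
    (forall u', solves K rho0 u' -> forall t x, 0 <= t -> u' t x = u t x) /\
    (forall t x, 0 <= t -> min01 rho0 <= u t x <= max01 rho0).
Proof.
  move=> HK1 HKc _ HKb _ _ _ [_ [L [c [C [S [HL [Hc [HC [HS [gam [Gam [W Happ]]]]]]]]]]]] rho0 Hw Hper.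
  have [Hgam [HGam [HW [_ {}Happ]]]] := Happ.
  have HK : tame K vmax L c C gam Gam W by apply: (limit_tame K vmax KN) Happ.
  have [M0 HM0] := W2inf_per_lip rho0 Hw (proj2 (proj2 Hper)).
  have [M2 HM2] := W2inf_lip2 rho0 Hw.
  (* Choosing [lo] and [hi] as the exact extrema of the initial density turns admissibility of the
     limit into the asserted bounds. *)
  have [Hlo Hbox] := Per1_inbox rho0 Hper.
  have Hadm : adm (min01 rho0) (max01 rho0) rho0 by split.
  have Hsol := flow_solves K vmax L c C gam Gam W HK _ _ Hlo rho0 M0 M2 Hadm HM0 HM2.
  exists (flow K c (max01 rho0) rho0); split; [exact: Hsol | split].
  - move=> u' Hu' t x Ht; exact: (solves_unique K vmax L c C gam Gam W rho0) HK Hsol Hu' t x Ht.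
  - move=> t x Ht.
    exact: (proj2 (flow_adm K vmax L c C gam Gam W HK _ _ Hlo rho0 M0 Hadm HM0 t Ht)).
Qed.
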